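(* Let $k$ be a quadratic étale algebra over $\mathbb{Q}$, let $f$ be a positive integer, and let $\chi$ be a primitive character of $Cl_{k,f}$ of odd order. For each $d\ge 1$ let $\chi$ also denote the induced character $\chi\circ\varphi_{k,f,fd}$ of $Cl_{k,fd}$. Then, as Dirichlet series (equivalently, for $\mathrm{Re}(s)$ sufficiently large), \[ \sum_{d=1}^{\infty}\frac{1}{d^{s}}\,L(s,\chi,\mathcal{O}_{k,fd})=\zeta(s)\,\zeta(3s-1)\,\frac{L^*(s,\chi,\mathcal{O}_{k,f})}{L^*(2s,\chi,\mathcal{O}_{k,f})}, \] where $\zeta$ is the Riemann zeta function.
   Context: A quadratic étale algebra $k$ over $\mathbb{Q}$ is either a quadratic field or $\mathbb{Q}\oplus\mathbb{Q}$ (with $\mathbb{Q}$ embedded diagonally). $\mathcal{O}_k$ denotes its maximal order ($\mathbb{Z}\oplus\mathbb{Z}$ for $\mathbb{Q}\oplus\mathbb{Q}$). For $m\in\mathbb{Z}_{>0}$, $\mathcal{O}_{k,m}=\mathbb{Z}\cdot 1+m\mathcal{O}_k$; its conductor is the ideal $m\mathcal{O}_k$. For an order $\mathcal{O}$, a fractional $\mathcal{O}$-ideal is a finitely generated $\mathbb{Z}$-submodule $\mathfrak a$ of $k$ of rank 2 with $\mathcal{O}\mathfrak a=\mathfrak a$; it is invertible if $\mathfrak a\mathfrak b=\mathcal{O}$ for some fractional $\mathcal{O}$-ideal $\mathfrak b$. $Cl_{k,m}$ is the group of invertible $\mathcal{O}_{k,m}$-ideals modulo the principal ideals $\alpha\mathcal{O}_{k,m}$,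 $\alpha\in k^*$. For an integral invertible ideal $\mathfrak a$ of $\mathcal{O}$, $\mathbf{N}\mathfrak a=[\mathcal{O}:\mathfrak a]$. For $m'\mid m$, $\varphi_{k,m',m}:Cl_{k,m}\to Cl_{k,m'}$ is the surjective homomorphism $[\mathfrak a]\mapsto[\mathfrak a\mathcal{O}_{k,m'}]$. For a character $\chi$ of $Cl_{k,m}$: $L(s,\chi,\mathcal{O}_{k,m})=\sum_{\mathfrak a}\chi([\mathfrak a])\mathbf{N}\mathfrak a^{-s}$, summed over all integral invertible $\mathcal{O}_{k,m}$-ideals; $L^*(s,\chi,\mathcal{O}_{k,m})$ is the same sum restricted to integral ideals $\mathfrak a$ prime to the conductor, i.e. with $\mathfrak a+m\mathcal{O}_k=\mathcal{O}_{k,m}$ (such ideals are invertible). A character $\chi$ of $Cl_{k,m}$ is defined at $Cl_{k,m'}$ ($m'\mid m$) if $\chi=\chi'\circ\varphi_{k,m',m}$ for some character $\chi'$ of $Cl_{k,m'}$; the conductor of $\chi$ is the gcd of all such $m'$ (and $\chi$ is defined at its conductor); $\chi$ is primitive if its conductor is $m$. *)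

(* Defs.v *)
From HB Require Import structures.
From mathcomp Require Import all_boot all_order all_algebra all_field.
From mathcomp Require Import boolp classical_sets cardinality fsbigop filter.
From mathcomp Require Import reals complex.

Set Implicit Arguments.
Unset Strict Implicit.
Unset Printing Implicit Defensive.

Import Order.TTheory GRing.Theory Num.Theory.
Local Open Scope classical_set_scope.
Local Open Scope ring_scope.
Local Open Scope card_scope.

Section QuadraticAlgebra.
Variable k : comUnitAlgType rat.

(* rat^o is rat viewed as an algebra over itself; \dim is the degree over rat. *)
Definition quadratic_etale : Prop :=
  (exists L : fieldExtType rat, \dim {:L} = 2%N /\
     exists g : {lrmorphism k -> L}, bijective g) \/
  (exists g : {lrmorphism k -> (rat^o * rat^o)%type}, bijective g).

Definition max_order : set k := [set x | integralOver (intr : int -> k) x].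

Definition quad_order (m : nat) : set k :=
  [set x | exists z : int, exists2 y, max_order y & x = z%:~R + m%:R * y].

Definition conductor_ideal (m : nat) : set k := [set m%:R * y | y in max_order].

Definition zmod_fg (a : set k) : Prop :=
  exists n (s : n.-tuple k), a = [set x | inIntSpan s x].

Definition zfree n (s : n.-tuple k) : Prop :=
  forall c : 'I_n -> int, \sum_(i < n) s`_i *~ c i = 0 -> forall i, c i = 0.

Definition zmod_rank (a : set k) (r : nat) : Prop :=
  (exists s : r.-tuple k, (forall x, x \in s -> a x) /\ zfree s) /\
  (forall s : r.+1.-tuple k, (forall x, x \in s -> a x) -> ~ zfree s).

Definition zmod_add (a b : set k) : set k :=
  [set x | exists y z, [/\ a y, b z & x = y + z]].

(* All finite sums of products y * z with y in a and z in b. *)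
Definition zmod_mul (a b : set k) : set k :=
  [set x | exists s : seq (k * k),
     (forall p, p \in s -> a p.1 /\ b p.2) /\ x = \sum_(p <- s) p.1 * p.2].

(* The number of cosets x + a, for x in O, is n. *)
Definition zmod_index (O a : set k) (n : nat) : Prop :=
  [set [set x + y | y in a] | x in O] #= `I_n.

Definition fractional_ideal (m : nat) (a : set k) : Prop :=
  [/\ zmod_fg a, zmod_rank a 2 & zmod_mul (quad_order m) a = a].

Definition invertible_ideal (m : nat) (a : set k) : Prop :=
  fractional_ideal m a /\
  exists2 b, fractional_ideal m b & zmod_mul a b = quad_order m.

Definition principal_ideal (m : nat) (x : k) : set k :=
  [set x * y | y in quad_order m].

Definition ideal_class (m : nat) (a : set k) : set (set k) :=
  [set zmod_mul (principal_ideal m x) a | x in [set x | x \is a GRing.unit]].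

Definition class_group (m : nat) : set (set (set k)) :=
  [set ideal_class m a | a in invertible_ideal m].

(* On a class [a] this is [a O_{k,m'}], whichever representative is used. *)
Definition class_map (m' : nat) (c : set (set k)) : set (set k) :=
  \bigcup_(a in c) ideal_class m' (zmod_mul a (quad_order m')).

Variable C : fieldType.

(* Only the values of chi on class_group m are relevant: a character of Cl_{k,m}
   is represented by any function whose restriction to it is a homomorphism to
   the multiplicative group of C. *)
Definition is_character (m : nat) (chi : set (set k) -> C) : Prop :=
  (forall a, invertible_ideal m a -> chi (ideal_class m a) != 0) /\
  (forall a b, invertible_ideal m a -> invertible_ideal m b ->
     chi (ideal_class m (zmod_mul a b)) =
     chi (ideal_class m a) * chi (ideal_class m b)).

Definition char_order (m : nat) (chi : set (set k) -> C) (n : nat) : Prop :=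
  [/\ (0 < n)%N,
      forall c, class_group m c -> chi c ^+ n = 1
    & forall j, (0 < j < n)%N ->
        ~ (forall c, class_group m c -> chi c ^+ j = 1)].

Definition induced (m' : nat) (chi' : set (set k) -> C) : set (set k) -> C :=
  chi' \o class_map m'.

Definition defined_at (m : nat) (chi : set (set k) -> C) (m' : nat) : Prop :=
  exists2 chi', is_character m' chi' &
    forall c, class_group m c -> chi c = induced m' chi' c.

Definition conductor (m : nat) (chi : set (set k) -> C) : nat :=
  \big[gcdn/0%N]_(m' <- divisors m | `[< defined_at m chi m' >]) m'.

Definition primitive (m : nat) (chi : set (set k) -> C) : Prop :=
  conductor m chi = m.

End QuadraticAlgebra.

(* Formal Dirichlet series: F stands for \sum_(n >= 1) F n * n^-s, so F 0 is
    ignored. *)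

Section DirichletSeries.
Variable C : fieldType.
Implicit Types F G : nat -> C.

Definition dmonom (d : nat) : nat -> C := fun n => (n == d)%:R.

Definition dmul F G : nat -> C :=
  fun n => \sum_(d <- divisors n) F d * G (n %/ d)%N.

(* F(r s - c) = \sum_m F m * m^c * (m^r)^-s *)
Definition dsubst F (r c : nat) : nat -> C :=
  fun n => \sum_(1 <= m < n.+1 | (m ^ r == n)%N) F m * m%:R ^+ c.

(* The inverse for dmul, computed by recursion on n, when G 1 != 0; N only bounds
   the depth of the recursion. *)
Fixpoint dinv_rec G (N n : nat) : C :=
  if N is N'.+1 then
    if n == 1%N then (G 1%N)^-1
    else - (G 1%N)^-1 *
         \sum_(d <- divisors n | (d < n)%N) dinv_rec G N' d * G (n %/ d)%N
  else 0.

Definition dinv G : nat -> C := fun n => dinv_rec G n n.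

Definition ddiv F G : nat -> C := dmul F (dinv G).

(* The sum of the F d, d >= 1, is G: coefficientwise, the partial sums are
   eventually constant. *)
Definition dsums_to (F : nat -> nat -> C) G : Prop :=
  forall n, (0 < n)%N -> \forall D \near \oo, \sum_(1 <= d < D) F d n = G n.

Definition dzeta : nat -> C := fun=> 1.

Lemma dinv_recE G N n : (0 < n <= N)%N -> dinv_rec G N n = dinv G n.
Proof.
rewrite /dinv => /andP[n0 nN].
suff H p q m : (0 < m)%N -> (m <= p)%N -> (m <= q)%N ->
    dinv_rec G p m = dinv_rec G q m by apply: H.
elim: p q m => [|p IH] [|q] m m0; rewrite ?leqn0 //.
- by move=> /eqP m0'; rewrite m0' in m0.
- by move=> _ /eqP m0'; rewrite m0' in m0.
move=> mp mq /=; case: eqP => // _; congr (_ * _).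
rewrite big_seq_cond [RHS]big_seq_cond; apply: eq_bigr => d.
rewrite -dvdn_divisors // => /andP[dm ltdm]; congr (_ * _).
apply: IH; first exact: dvdn_gt0 dm.
  by rewrite -ltnS (leq_trans ltdm).
by rewrite -ltnS (leq_trans ltdm).
Qed.

Lemma dmulVd G n : G 1%N != 0 -> (0 < n)%N -> dmul (dinv G) G n = dmonom 1 n.
Proof.
move=> G1 n0; rewrite /dmul /dmonom (bigID (fun d => d < n)%N) /=.
have -> : \sum_(d <- divisors n | ~~ (d < n)%N) dinv G d * G (n %/ d)%N =
    dinv G n * G 1%N.
  rewrite big_mkcond (bigD1_seq n) ?divisors_uniq -?dvdn_divisors //=.
  rewrite ltnn divnn n0 big_seq_cond big1 ?addr0 // => d /andP[].
  rewrite -dvdn_divisors // => /dvdn_leq -/(_ n0) dn /negPf dNn.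
  by rewrite ltn_neqAle dNn dn.
case: n n0 => // n _; rewrite {2}/dinv /=; case: eqP => [->|n1].
  rewrite mulVf // big_seq_cond big1 ?add0r // => d /andP[].
  rewrite -dvdn_divisors // => /dvdn_gt0 -/(_ isT) d0.
  by rewrite ltnS leqn0 => /eqP d0'; rewrite d0' in d0.
rewrite mulrAC mulNr mulVf // mulN1r; apply/eqP; rewrite subr_eq0; apply/eqP.
rewrite big_seq_cond [RHS]big_seq_cond; apply: eq_bigr => d.
rewrite -dvdn_divisors // => /andP[dn ltdn]; congr (_ * _).
by rewrite dinv_recE // (dvdn_gt0 _ dn).
Qed.

End DirichletSeries.

Section LSeries.
Variables (k : comUnitAlgType rat) (C : fieldType).

(* The integral invertible ideals of O_{k,m} of norm n. *)
Definition Lideals (m n : nat) : set (set k) :=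
  [set a | [/\ invertible_ideal m a, a `<=` @quad_order k m
             & zmod_index (@quad_order k m) a n]].

(* Those prime to the conductor m O_k. *)
Definition Lstar_ideals (m n : nat) : set (set k) :=
  [set a | Lideals m n a /\
           zmod_add a (@conductor_ideal k m) = @quad_order k m].

(* There are finitely many ideals of a given norm, so the sum over the ideals is
   the Dirichlet series obtained by grouping them by norm. *)
Definition Lseries (m : nat) (chi : set (set k) -> C) : nat -> C :=
  fun n => \sum_(a \in Lideals m n) chi (ideal_class m a).

Definition Lstar (m : nat) (chi : set (set k) -> C) : nat -> C :=
  fun n => \sum_(a \in Lstar_ideals m n) chi (ideal_class m a).

End LSeries.

(* Main.v *)
(* Let Y_d(n) be the n-th coefficient of L(s, chi, O_{fd}): the sum of chi[a O_f] over the
   invertible ideals a of norm n of O_{fd}. If p does not divide n, then a -> a O_m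
   identifies the ideals of norm n of O_{mp} and of O_m, whence Y_{dp}(n) = Y_d(n). If p
   divides n, an ideal of norm n of O_{mp} is contained in p O_m and is p times a
   neighbour of an O_m-ideal of norm n / p^2; each such ideal has p + 1 - rho neighbours,
   rho being the number of zeros of the norm form of O_m on the projective line over F_p,
   whence Y_{dp}(n) = (p + 1 - rho) Y_d(n / p^2).

   If p does not divide f, the zeros of the norm form correspond to the ideals of norm p
   of O_f, and counting the ideals of norm p that contain a given ideal yields the Hecke
   relation t Y_1(n) = Y_1(pn) + (rho - 1) Y_1(n / p). If p divides f, then chi, being
   primitive, takes a value different from 1 at some ideal c with c O_{f/p} = O_{f/p};
   multiplication by c permutes the ideals of norm n when p divides n, since they are
   contained in p O_{f/p}, so that Y_1(n) = 0. In particular Y_1 is also the coefficient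
   of L^*(s, chi, O_f).

   Hence all the functions involved are multiplicative, and the identity reduces, at each
   prime, to an identity between rational functions. *)

(* The link between ideals and norms is Gauss's. A lattice carries the binary quadratic form given
   by its norms. If [c] is the content of that form, then [a ** cj a = c O_m] for exactly one [m],
   because [O_1] contains every element of integral trace and norm. The predicate [inv_norm] records
   this equation. It provides the inverse and the norm at once, and products, conjugation, scaling
   and extension to a larger order preserve it.

   The number [rho] enters both relations for one reason. The lattices of index [p] between [p O_m]
   and [O_m] are the points of the projective line over F_p. Where the norm form does not vanish,
   the lattice is an ideal of [O_(mp)] that extends to [O_m]. Where it vanishes and [p] does not
   divide [m], the lattice is an ideal of norm [p] of [O_m].

   Arguments local at [p] are made without localising: an element lies in a subgroup as soon as two
   coprime multiples of it do. The passage from the relations to the Dirichlet series is made for an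
   abstract family [Y], so that it involves no ideals. *)
Require Import Defs.
From mathcomp Require Import all_boot all_order all_algebra all_field.
From mathcomp Require Import finmap.
From mathcomp Require Import boolp classical_sets functions cardinality fsbigop filter.
From mathcomp Require Import reals complex.
From mathcomp Require Import ring lra zify.
Set Implicit Arguments.
Unset Strict Implicit.
Unset Printing Implicit Defensive.
Import Order.TTheory GRing.Theory Num.Theory.
Local Open Scope classical_set_scope.
Local Open Scope ring_scope.

(* [ib_t] and [ib_u] are the trace and the norm of [ib_w]; [ib_maximal] says that
   [Z + Z ib_w] contains all elements of integral trace and norm. *)
Record integral_basis (k : comUnitAlgType rat) := IntegralBasis {
  ib_w : k;
  ib_t : int;
  ib_u : int;
  ib_re : k -> rat;
  ib_im : k -> rat;
  ib_coord : forall x, x = in_alg k (ib_re x) + in_alg k (ib_im x) * ib_w;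
  ib_reE : forall a b, ib_re (in_alg k a + in_alg k b * ib_w) = a;
  ib_imE : forall a b, ib_im (in_alg k a + in_alg k b * ib_w) = b;
  ib_sqr : ib_w * ib_w = ib_t%:~R * ib_w - ib_u%:~R;
  ib_max : forall x, max_order x <->
    exists i j : int, x = i%:~R + j%:~R * ib_w;
  ib_maximal : forall a b : rat,
    2 * a + b * ib_t%:~R \is a Num.int ->
    a * a + a * b * ib_t%:~R + b * b * ib_u%:~R \is a Num.int ->
    a \is a Num.int /\ b \is a Num.int }.

Definition is_subgroup (V : zmodType) (a : set V) : Prop :=
  a 0 /\ forall x y, a x -> a y -> a (x - y).

Section InAlg.
Variable k : comUnitAlgType rat.
Local Notation "a %:K" := (in_alg k a)
  (at level 2, left associativity, format "a %:K").

Lemma algM (a b : rat) : (a * b)%:K = a%:K * b%:K. Proof. exact: rmorphM. Qed.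
Lemma alg1 : 1%:K = 1. Proof. exact: rmorph1. Qed.
Lemma algN (a : rat) : (- a)%:K = - a%:K. Proof. exact: rmorphN. Qed.
Lemma algz (i : int) : i%:~R%:K = i%:~R. Proof. exact: rmorph_int. Qed.
Lemma algn (n : nat) : n%:R%:K = n%:R. Proof. exact: rmorph_nat. Qed.
End InAlg.

(** * Products of additive subgroups *)

Section SetOperations.
Variable k : comUnitAlgType rat.
Implicit Types (a b c : set k) (x y z : k).

Definition scale x a : set k := [set x * y | y in a].

Lemma subgroupN a x : is_subgroup a -> a x -> a (- x).
Proof. by move=> [a0 aB] ax; rewrite -sub0r; apply: aB. Qed.

Lemma subgroupD a x y : is_subgroup a -> a x -> a y -> a (x + y).
Proof.
by move=> sa ax ay; rewrite -[y]opprK; apply: sa.2 => //; apply: subgroupN.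
Qed.

Lemma subgroup_sum a (I : Type) (r : seq I) (P : pred I) (F : I -> k) :
  is_subgroup a -> (forall i, P i -> a (F i)) -> a (\sum_(i <- r | P i) F i).
Proof.
by move=> sa aF; apply: big_ind => //; [apply: sa.1 | move=> *; apply: subgroupD].
Qed.

Lemma subgroupMn a x n : is_subgroup a -> a x -> a (n%:R * x).
Proof.
move=> sa ax; elim: n => [|n IH]; first by rewrite mul0r; apply: sa.1.
by rewrite -natr1 mulrDl mul1r; apply: subgroupD.
Qed.

Lemma subgroupMz a x (i : int) : is_subgroup a -> a x -> a (i%:~R * x).
Proof.
move=> sa ax; case: i => n; first exact: subgroupMn.
by rewrite NegzE mulrNz mulNr; apply: subgroupN => //; apply: subgroupMn.
Qed.

Lemma mem_zmod_mul a b x y : a x -> b y -> zmod_mul a b (x * y).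
Proof.
move=> ax ay; exists [:: (x, y)]; rewrite big_seq1; split=> // p.
by rewrite inE => /eqP ->.
Qed.

Lemma zmod_mul_sub a b c : is_subgroup c ->
  (forall x y, a x -> b y -> c (x * y)) -> zmod_mul a b `<=` c.
Proof.
move=> sc H z [s [sP ->]]; rewrite big_seq; apply: subgroup_sum => // p ps.
by have [] := sP _ ps; apply: H.
Qed.

Lemma zmod_mul0 a b : zmod_mul a b 0.
Proof. by exists [::]; rewrite big_nil; split. Qed.

Lemma zmod_mulD a b x y :
  zmod_mul a b x -> zmod_mul a b y -> zmod_mul a b (x + y).
Proof.
move=> [s [sP ->]] [s' [sP' ->]]; exists (s ++ s'); rewrite big_cat; split=> // p.
by rewrite mem_cat => /orP[/sP|/sP'].
Qed.

Lemma zmod_mul_sum a b (I : eqType) (r : seq I) (F : I -> k) :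
  (forall i, i \in r -> zmod_mul a b (F i)) -> zmod_mul a b (\sum_(i <- r) F i).
Proof.
move=> H; rewrite big_seq; apply: big_ind => //; first exact: zmod_mul0.
by move=> *; apply: zmod_mulD.
Qed.

Lemma subgroup_zmod_mul a b : is_subgroup a -> is_subgroup (zmod_mul a b).
Proof.
move=> sa; split; first exact: zmod_mul0.
move=> x y Hx [s [sP ->]]; apply: zmod_mulD => //.
rewrite -sumrN; apply: zmod_mul_sum => p /sP[ap bp].
by rewrite -mulNr; apply: mem_zmod_mul => //; apply: subgroupN.
Qed.

Lemma zmod_mulC a b : zmod_mul a b = zmod_mul b a.
Proof.
suff H (c d : set k) : zmod_mul c d `<=` zmod_mul d c by apply/seteqP; split; apply: H.
move=> x [s [sP ->]]; apply: zmod_mul_sum => p /sP[cp dp].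
by rewrite mulrC; apply: mem_zmod_mul.
Qed.

Lemma zmod_mulA a b c : zmod_mul a (zmod_mul b c) = zmod_mul (zmod_mul a b) c.
Proof.
suff H (d e f : set k) : zmod_mul d (zmod_mul e f) `<=` zmod_mul (zmod_mul d e) f.
  apply/seteqP; split; first exact: H.
  rewrite zmod_mulC [zmod_mul a b]zmod_mulC [zmod_mul b c]zmod_mulC.
  by rewrite [zmod_mul a _]zmod_mulC; apply: H.
move=> x [s [sP ->]]; apply: zmod_mul_sum => -[y z] /sP /= [dy [s' [sP' ->]]].
rewrite mulr_sumr; apply: zmod_mul_sum => p /sP' [ep fp].
by rewrite mulrA; apply: mem_zmod_mul => //; apply: mem_zmod_mul.
Qed.

Lemma zmod_mulCA a b c : zmod_mul a (zmod_mul b c) = zmod_mul b (zmod_mul a c).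
Proof. by rewrite !zmod_mulA [zmod_mul a b]zmod_mulC. Qed.

Lemma zmod_mulACA a b c d :
  zmod_mul (zmod_mul a b) (zmod_mul c d) = zmod_mul (zmod_mul a c) (zmod_mul b d).
Proof. by rewrite -!zmod_mulA [zmod_mul b (zmod_mul c d)]zmod_mulCA. Qed.

Lemma zmod_mulS a b c d : a `<=` b -> c `<=` d -> zmod_mul a c `<=` zmod_mul b d.
Proof.
move=> ab cd x [s [sP ->]]; exists s; split=> // p /sP[ap cp].
by split; [apply: ab | apply: cd].
Qed.

Lemma subgroup_scale x a : is_subgroup a -> is_subgroup (scale x a).
Proof.
move=> [a0 aB]; split; first by exists 0; rewrite ?mulr0.
by move=> _ _ [y ay <-] [z az <-]; exists (y - z); [apply: aB | rewrite mulrBr].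
Qed.

Lemma scaleA x y a : scale x (scale y a) = scale (x * y) a.
Proof.
apply/seteqP; split=> z.
  by move=> [_ [v av <-] <-]; exists v; rewrite ?mulrA.
by move=> [v av <-]; exists (y * v); rewrite ?mulrA //; exists v.
Qed.

Lemma scale1 a : scale 1 a = a.
Proof.
apply/seteqP; split=> z; first by move=> [v av <-]; rewrite mul1r.
by move=> av; exists z; rewrite ?mul1r.
Qed.

Lemma scaleS x a b : a `<=` b -> scale x a `<=` scale x b.
Proof. by move=> ab z [y ay <-]; exists y => //; apply: ab. Qed.

Lemma zmod_mulZl x a b : zmod_mul (scale x a) b = scale x (zmod_mul a b).
Proof.
apply/seteqP; split=> z.
  move=> [s [sP ->]]; rewrite big_seq.
  elim/big_ind: _ => [|_ _ [y1 m1 <-] [y2 m2 <-]|p /sP[]].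
  - by exists 0; rewrite ?mulr0 //; apply: zmod_mul0.
  - by exists (y1 + y2); rewrite ?mulrDr //; apply: zmod_mulD.
  - move=> [y ay <-] bp; exists (y * p.2); rewrite ?mulrA //.
    exact: mem_zmod_mul.
move=> [_ [s [sP ->]] <-]; rewrite mulr_sumr; apply: zmod_mul_sum => p /sP[ap bp].
by rewrite mulrA; apply: mem_zmod_mul => //; exists p.1.
Qed.

Lemma zmod_mulZr x a b : zmod_mul a (scale x b) = scale x (zmod_mul a b).
Proof. by rewrite zmod_mulC zmod_mulZl zmod_mulC. Qed.

End SetOperations.

(** * Subgroups of the rationals, integral linear relations, counting along fibres *)

(** Multiplication by [N] embeds [S] in the integers. The generator is [n / N] for the least
    positive numerator [n], since the remainder of a division by [n] would be a smaller one. *)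
Lemma cyclic_rat_subgroup (S : set rat) (N : nat) : is_subgroup S ->
  (0 < N)%N -> (forall q, S q -> N%:R * q \is a Num.int) ->
  (exists2 q, S q & q != 0) ->
  exists2 g, 0 < g & forall q, S q <-> exists i : int, q = i%:~R * g.
Proof.
move=> [S0 SB] N0 SN [q0 Sq0 q00].
have SNeg q : S q -> S (- q) by move=> Sq; rewrite -sub0r; apply: SB.
have N0q : (N%:R : rat) != 0 by rewrite pnatr_eq0 -lt0n.
have Sabs q : S q -> S `|q| by case: (ger0P q) => // _; apply: SNeg.
pose P n := (0 < n)%N && `[< S (n%:R / N%:R) >].
have exP : exists n, P n.
  have /intrP[i ei] := SN _ (Sabs _ Sq0).
  have i0 : 0 < i by rewrite -(ltr0z rat) -ei mulr_gt0 ?normr_gt0 ?ltr0n.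
  exists `|i|%N; rewrite /P absz_gt0 gt_eqF //=; apply/asboolP.
  have -> : (`|i|%N%:R : rat) = i%:~R by rewrite pmulrn gez0_abs ?ltW.
  by rewrite -ei mulrAC divff ?mul1r //; apply: Sabs.
case: (ex_minnP exP) => n /andP[n0 /asboolP Sn] nmin.
pose g : rat := n%:R / N%:R.
have g0 : 0 < g by rewrite divr_gt0 ?ltr0n.
have Sig (i : int) : S (i%:~R * g).
  have Smg (m : nat) : S (m%:R * g).
    elim: m => [|m IH]; first by rewrite mul0r.
    rewrite -natr1 mulrDl mul1r -[g in X in _ + X]opprK.
    by apply: SB => //; apply: SNeg.
  case: i => m; first exact: Smg.
  by rewrite NegzE mulrNz mulNr; apply: SNeg; apply: Smg.
exists g => // q; split=> [Sq|[i ->] //].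
have /intrP[i ei] := SN _ Sq.
have qE : q = i%:~R / N%:R by rewrite -ei mulrAC divff ?mul1r.
exists (i %/ n%:Z)%Z.
have mod0 : (i %% n%:Z)%Z = 0.
  apply: contrapT => /eqP m0.
  have m0' : 0 < (i %% n%:Z)%Z by rewrite lt_def m0 modz_ge0 // gt_eqF.
  have mn : (i %% n%:Z)%Z < n%:Z by rewrite ltz_mod // gt_eqF.
  have : P `|(i %% n%:Z)%Z|%N.
    rewrite /P absz_gt0 m0 /=; apply/asboolP.
    have -> : (`|(i %% n%:Z)%Z|%N%:R : rat) / N%:R = q - (i %/ n%:Z)%Z%:~R * g.
      rewrite pmulrn gez0_abs ?ltW // /modz intrD mulrNz intrM qE /g -pmulrn.
      by rewrite mulrBl !mulrA.
    by apply: SB.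
  by move=> /nmin; lia.
by rewrite qE {1}(divz_eq i n%:Z) mod0 addr0 intrM /g -pmulrn mulrA.
Qed.

Lemma common_denominator (s : seq rat) :
  exists2 N : nat, (0 < N)%N & forall q, q \in s -> N%:R * q \is a Num.int.
Proof.
elim: s => [|q s [N N0 NP]]; first by exists 1%N.
exists (N * `|denq q|)%N; first by rewrite muln_gt0 N0 absz_gt0 denq_neq0.
have dE : (`|denq q|%N%:R : rat) = (denq q)%:~R by rewrite pmulrn absz_denq.
move=> r; rewrite inE natrM dE => /orP[/eqP ->|/NP Nr].
  rewrite -mulrA; apply: rpredM; first by rewrite natr_int.
  by rewrite mulrC -numqE; apply: intr_int.
by rewrite mulrAC; apply: rpredM => //; apply: intr_int.
Qed.

(** This is the content of a binary quadratic form with coefficients [n1], [n2], [n3]. The Bezout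
    relation in the last clause will put the content itself into [a ** cj a]. *)
Lemma rat_gcd3 (n1 n2 n3 : rat) : n1 != 0 -> exists2 c : rat, 0 < c &
  [/\ exists i : int, n1 = i%:~R * c, exists i : int, n2 = i%:~R * c,
      exists i : int, n3 = i%:~R * c &
      exists i j l : int, c = i%:~R * n1 + j%:~R * n2 + l%:~R * n3].
Proof.
move=> n10; have [N N0 Nn] := common_denominator [:: n1; n2; n3].
have [||||c c0 cE] := @cyclic_rat_subgroup
  (fun q => exists i j l : int, q = i%:~R * n1 + j%:~R * n2 + l%:~R * n3) N.
- split; first by exists 0, 0, 0; rewrite !mul0r !addr0.
  move=> _ _ [i [j [l ->]]] [i' [j' [l' ->]]].
  by exists (i - i'), (j - j'), (l - l'); ring.
- exact: N0.
- move=> _ [i [j [l ->]]].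
  rewrite !mulrDr ![N%:R * (_%:~R * _)]mulrCA.
  by apply: rpredD; [apply: rpredD|]; apply: rpredM; rewrite ?intr_int // Nn // !inE eqxx ?orbT.
- exists n1 => //.
  by exists 1, 0, 0; ring.
exists c => //; split; [| | | by apply/cE; exists 1; rewrite mul1r]; apply/cE.
- by exists 1, 0, 0; ring.
- by exists 0, 1, 0; ring.
- by exists 0, 0, 1; ring.
Qed.

(** The coefficients are the 2 by 2 minors, a determinant with a repeated row being zero. If the
    minor [d12] vanishes, a relation between the first two vectors is used instead. *)
Lemma int_dependent3 (x1 y1 x2 y2 x3 y3 : int) : exists c1 c2 c3 : int,
  [/\ ~ [/\ c1 = 0, c2 = 0 & c3 = 0], c1 * x1 + c2 * x2 + c3 * x3 = 0 &
      c1 * y1 + c2 * y2 + c3 * y3 = 0].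
Proof.
pose d12 := x1 * y2 - x2 * y1.
have [d0|d0] := eqVneq d12 0; last first.
  exists (x2 * y3 - x3 * y2), (x3 * y1 - x1 * y3), d12.
  by split; [case=> _ _; apply/eqP | rewrite /d12; ring | rewrite /d12; ring].
have [x0|x0] := eqVneq x1 0; last first.
  exists (- x2), x1, 0; split; [by case=> _ /eqP; rewrite (negPf x0) | ring |].
  by rewrite -[RHS]d0 /d12; ring.
have [y0|y0] := eqVneq y1 0; last first.
  exists (- y2), y1, 0; split; [by case=> _ /eqP; rewrite (negPf y0) | | ring].
  by rewrite -[RHS]oppr0 -[in RHS]d0 /d12; ring.
exists 1, 0, 0; split; [by case | by rewrite x0; ring | by rewrite y0; ring].
Qed.

Lemma eq_of_dvdz (p i j : nat) : (i < p)%N -> (j < p)%N ->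
  (p%:Z %| i%:Z - j%:Z)%Z -> i = j.
Proof.
move=> ip jp; rewrite -eqz_mod_dvd !modz_nat eqz_nat !modn_small //.
by move=> /eqP.
Qed.

(** Double counting: each injective [h i] hits [a] at most once, so the multiplicity of [a] is the
    number of [i] whose image contains it. The neighbour count and the Hecke relation are both
    instances. *)
Lemma fsbig_fibers (R : pzSemiRingType) (I : finType) (P : pred I) (U V : choiceType)
    (A : set V) (D : set U) (h : I -> U -> V) (G : V -> R) :
  finite_set A -> (forall i, P i -> set_inj D (h i)) ->
  (forall i b, P i -> D b -> A (h i b)) ->
  \sum_(i | P i) \sum_(b \in D) G (h i b) =
  \sum_(a \in A) G a *+ #|[pred i | P i & `[< exists2 b, D b & h i b = a >]]|.
Proof.
move=> finA hinj hA.
transitivity (\sum_(i | P i) \sum_(a <- fset_set A)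
    if `[< exists2 b, D b & h i b = a >] then G a else 0).
  apply: eq_bigr => i Pi; rewrite -(@reindex_fsbig _ _ _ _ _ (h i) D (h i @` D)); last first.
    exact/inj_bij/hinj.
  have -> : h i @` D = A `&` [set a | exists2 b, D b & h i b = a].
    apply/seteqP; split=> [a Ha|a [_ Ha]] //; split=> //.
    by case: Ha => b Db <-; apply: hA.
  rewrite fsbig_mkcondr fsbig_finite //; apply: eq_bigr => a _.
rewrite exchange_big fsbig_finite //=; apply: eq_bigr => a _.
by rewrite -big_mkcondr /= sumr_const.
Qed.

Lemma card_option_pred (T : finType) (P : pred (option T)) :
  #|P| = (P None + #|[pred i | P (Some i)]|)%N.
Proof.
have Some_inj : injective (@Some T) by move=> ? ? [].
rewrite (cardD1 None) -(fintype.card_image Some_inj); congr (_ + _)%N.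
apply: eq_card => -[i|]; rewrite !inE /=; last first.
  by apply/esym/negbTE/negP => /mapP[].
by rewrite (fintype.mem_image Some_inj) inE.
Qed.

(** * Multiplicative functions and Dirichlet series *)

Section LocalFactor.
Variable C : fieldType.

Lemma poly_low_coef0 (P : {poly C}) N :
  (forall i, (i < N)%N -> P`_i = 0) -> exists R, P = 'X^N * R.
Proof.
move=> H; exists (drop_poly N P).
rewrite -{1}(poly_take_drop N P) mulrC -[RHS]add0r; congr (_ + _).
by apply/polyP => i; rewrite coef_take_poly coef0; case: ifP => // /H.
Qed.

Definition cauchy (a b : nat -> C) (r : nat) : C := \sum_(i < r.+1) a i * b (r - i)%N.

Lemma coef_cauchy N (a b : nat -> C) r : (r < N)%N ->
  (\poly_(i < N) a i * \poly_(i < N) b i)`_r = cauchy a b r.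
Proof.
move=> rN; rewrite coefM; apply: eq_bigr => i _; rewrite !coef_poly.
rewrite (leq_ltn_trans _ rN) ?(leq_ltn_trans (leq_subr i r) rN) //.
by rewrite -ltnS.
Qed.

(* As power series, [la] is [1 / (1 - t X + e X^2)], [la2] is [la] at [X^2],
   [z3] is [1 / (1 - q X^3)] and [(1 - q X^3) s = (1 - e X^3) la + X / (1 - X)]; the
   claim rests on
   [X (1 - t X + e X^2) + (1 - X) (1 - e X^3) = 1 - t X^2 + e X^4]. *)
Lemma local_factor_identity (t e q : C) (la la2 z3 s : nat -> C) :
  la 0%N = 1 -> la 1%N = t -> (forall r, la r.+2 = t * la r.+1 - e * la r) ->
  (forall r, la2 r = if odd r then 0 else la r./2) ->
  (forall r, z3 r = if (3 %| r)%N then q ^+ (r %/ 3) else 0) ->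
  s 0%N = 1 -> s 1%N = la 1%N + 1 -> s 2%N = la 2%N + 1 ->
  (forall r, s r.+3 = q * s r + la r.+3 - e * la r + 1) ->
  forall r, cauchy s la2 r = cauchy (cauchy (fun=> 1) z3) la r.
Proof.
move=> la0 la1 laS la2E z3E s0 s1 s2 sS r.
(* Power series are truncated below degree [N], so that each functional equation becomes a
   polynomial congruence modulo [Q]. *)
pose N := r.+1; pose Q : {poly C} := 'X^N.
pose La := \poly_(i < N) la i; pose La2 := \poly_(i < N) la2 i.
pose Z3 := \poly_(i < N) z3 i; pose S := \poly_(i < N) s i.
pose Z1 : {poly C} := \poly_(i < N) 1.
pose A : {poly C} := 1 - 'X; pose B : {poly C} := 1 - q%:P * 'X^3.
pose L : {poly C} := 1 - t%:P * 'X + e%:P * 'X^2.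
pose M : {poly C} := 1 - t%:P * 'X^2 + e%:P * 'X^4.
pose G : {poly C} := 1 - e%:P * 'X^3.
have lt2 i : (i.+2 < N)%N -> (i < N)%N by move=> H; apply: ltnW (ltnW H).
have [R1 e1] : exists R, L * La - 1 = Q * R.
  have -> : L * La - 1 = La - t%:P * ('X * La) + e%:P * ('X * ('X * La)) - 1.
    by rewrite /L; ring.
  apply: poly_low_coef0 => i iN; rewrite !(coefD, coefN) !coefCM !coefXM coef1.
  rewrite !coef_poly iN; case: i iN => [|[|i]] iN /=.
  - by rewrite la0; ring.
  - by rewrite la0 la1; ring.
  - by rewrite (ltnW iN) (lt2 _ iN) laS; ring.
have [R2 e2] : exists R, M * La2 - 1 = Q * R.
  have -> : M * La2 - 1 = La2 - t%:P * ('X * ('X * La2)) +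
      e%:P * ('X * ('X * ('X * ('X * La2)))) - 1 by rewrite /M; ring.
  apply: poly_low_coef0 => i iN; rewrite !(coefD, coefN) !coefCM !coefXM coef1.
  rewrite !coef_poly iN; case: i iN => [|[|[|[|i]]]] iN /=; rewrite ?(lt2 _ iN) !la2E /=.
  - by rewrite la0; ring.
  - by ring.
  - by rewrite la0 la1; ring.
  - by ring.
  - rewrite (lt2 _ (lt2 _ iN)) !negbK; case: odd; first by ring.
    by rewrite laS; ring.
have [R3 e3] : exists R, A * Z1 - 1 = Q * R.
  have -> : A * Z1 - 1 = Z1 - 'X * Z1 - 1 by rewrite /A; ring.
  apply: poly_low_coef0 => i iN; rewrite !(coefD, coefN) coefXM coef1 !coef_poly iN.
  by case: i iN => [|i] iN /=; [ring | rewrite (ltnW iN); ring].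
have [R4 e4] : exists R, B * Z3 - 1 = Q * R.
  have -> : B * Z3 - 1 = Z3 - q%:P * ('X * ('X * ('X * Z3))) - 1 by rewrite /B; ring.
  apply: poly_low_coef0 => i iN; rewrite !(coefD, coefN) coefCM !coefXM coef1.
  rewrite !coef_poly iN; case: i iN => [|[|[|i]]] iN /=; rewrite z3E.
  - by rewrite dvdn0 div0n expr0; ring.
  - by rewrite /=; ring.
  - by rewrite /=; ring.
  - rewrite (ltnW (lt2 _ iN)) z3E -(addn3 i) dvdn_addl //; case: ifP => d; last by ring.
    by rewrite divnDr // divnn addn1 exprS; ring.
have [R5 e5] : exists R, B * S - (G * La + 'X * Z1) = Q * R.
  have -> : B * S - (G * La + 'X * Z1) = S - q%:P * ('X * ('X * ('X * S))) -
      (La - e%:P * ('X * ('X * ('X * La))) + 'X * Z1) by rewrite /B /G; ring.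
  apply: poly_low_coef0 => i iN; rewrite !(coefD, coefN) !coefCM !coefXM.
  rewrite !coef_poly iN; case: i iN => [|[|[|i]]] iN /=; rewrite ?(ltnW iN).
  - by rewrite s0 la0; ring.
  - by rewrite s1; ring.
  - by rewrite s2; ring.
  - by rewrite (ltnW (lt2 _ iN)) sS; ring.
have AGL : A * G + L * 'X = M by rewrite /A /G /L /M; ring.
have DZ : A * B * L * M * (S * La2 - Z1 * Z3 * La) = Q * (
    (A * G * R1 + L * 'X * R3 + A * L * R5) * (1 + Q * R2) + M * R2
    - M * (R1 + R3 + R4 + Q * (R1 * R3 + R1 * R4 + R3 * R4) + Q * Q * R1 * R3 * R4)).
  have {}e1 : L * La = 1 + Q * R1 by rewrite -e1; ring.
  have {}e2 : M * La2 = 1 + Q * R2 by rewrite -e2; ring.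
  have {}e3 : A * Z1 = 1 + Q * R3 by rewrite -e3; ring.
  have {}e4 : B * Z3 = 1 + Q * R4 by rewrite -e4; ring.
  have {}e5 : B * S = G * La + 'X * Z1 + Q * R5 by rewrite -e5; ring.
  transitivity ((A * G * (L * La) + L * 'X * (A * Z1) + A * L * Q * R5) * (M * La2)
      - (A * Z1) * (B * Z3) * (L * La) * M).
    transitivity (A * L * (B * S) * (M * La2) - (A * Z1) * (B * Z3) * (L * La) * M).
      by clear; ring.
    by rewrite e5; clear; ring.
  rewrite e1 e2 e3 e4 -AGL; clear; ring.
(* The denominators have constant term 1, hence are prime to [Q] and can be cancelled. *)
have co : coprimep Q (A * B * L * M).
  rewrite /Q; apply: coprimep_expl; rewrite coprimep_sym coprimepX.
  by rewrite /root /A /B /L /M !hornerE /= !(mulr0, subr0, addr0, mulr1) oner_eq0.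
have : Q %| A * B * L * M * (S * La2 - Z1 * Z3 * La) by rewrite DZ dvdp_mulr.
rewrite Gauss_dvdpr // => /dvdpP[R eR].
have : (S * La2 - Z1 * Z3 * La)`_r = 0 by rewrite eR coefMXn ltnS leqnn.
rewrite coefB => /eqP; rewrite subr_eq0 coef_cauchy // => /eqP ->.
rewrite -(@coef_cauchy N) // [LHS]coefM [RHS]coefM; apply: eq_bigr => i _.
congr (_ * _); rewrite coef_poly ltnS -ltnS ltn_ord coef_cauchy //.
Qed.

End LocalFactor.

Section Multiplicative.
Variable C : fieldType.
Implicit Types F G : nat -> C.

Lemma big_divisors_pfactor (p r n : nat) (H : nat -> C) :
  prime p -> (0 < n)%N -> ~~ (p %| n)%N ->
  \sum_(d <- divisors (p ^ r * n)) H d =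
  \sum_(i < r.+1) \sum_(d <- divisors n) H (p ^ i * d)%N.
Proof.
move=> pp n0 pn; have p0 := prime_gt0 pp.
have pr0 : (0 < p ^ r * n)%N by rewrite muln_gt0 expn_gt0 p0.
rewrite -(big_mkord xpredT (fun i => \sum_(d <- divisors n) H (p ^ i * d)%N)).
rewrite -(big_allpairs_dep (h := fun i d => (p ^ i * d)%N) (r1 := index_iota 0 r.+1)
  (r2 := fun=> divisors n) (F := H)).
apply: perm_big; apply: uniq_perm; first exact: divisors_uniq.
  apply: allpairs_uniq_dep; rewrite ?iota_uniq //.
    by move=> i _; apply: divisors_uniq.
  move=> _ _ /allpairsPdep[i [d [Hi Hd ->]]] /allpairsPdep[j [e [Hj He ->]]] /= E.
  have nd d' : d' \in divisors n -> logn p d' = 0%N /\ (0 < d')%N.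
    rewrite -dvdn_divisors // => d'n; split; last exact: dvdn_gt0 d'n.
    by apply/eqP; rewrite lognE; case: ifP => // /and3P[_ _ /dvdn_trans /(_ d'n) pn']; rewrite pn' in pn.
  have [ld d0] := nd _ Hd; have [le e0] := nd _ He.
  have ij : i = j.
    have := congr1 (logn p) E; rewrite !lognM ?expn_gt0 ?p0 // !pfactorK //.
    by rewrite ld le !addn0.
  move: E; rewrite ij => /eqP; rewrite eqn_pmul2l ?expn_gt0 ?p0 // => /eqP -> //.
move=> d; rewrite -dvdn_divisors //; apply/idP/allpairsPdep => [dd|[i [e [Hi He ->]]]].
  have d0 := dvdn_gt0 pr0 dd.
  have [d' pd' e] := pfactor_coprime pp d0.
  exists (logn p d), d'; rewrite mem_index_iota -dvdn_divisors //; split; last by rewrite mulnC.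
    rewrite /= ltnS; have := dvdn_leq_log p pr0 dd.
    by rewrite lognM ?expn_gt0 ?p0 // pfactorK // [logn p n]lognE (negPf pn) !andbF addn0.
  have : (d' %| p ^ r * n)%N by apply: dvdn_trans dd; rewrite e dvdn_mulr.
  by rewrite Gauss_dvdr // coprime_sym coprimeXl.
move: Hi He; rewrite mem_index_iota -dvdn_divisors //= ltnS => ir en.
by apply: dvdn_mul => //; apply: dvdn_exp2l.
Qed.

(** Splitting off a full prime power is the form in which the recurrences produce multiplicativity
    and in which [mult_eq] consumes it. *)
Definition mult F : Prop := F 1%N = 1 /\ forall p r n, prime p -> (0 < n)%N ->
  ~~ (p %| n)%N -> F (p ^ r * n)%N = F (p ^ r)%N * F n.

Lemma mult_eq F G : mult F -> mult G ->
  (forall p r, prime p -> F (p ^ r)%N = G (p ^ r)%N) ->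
  forall n, (0 < n)%N -> F n = G n.
Proof.
move=> [F1 FM] [G1 GM] FG n; have [N] := ubnP n; elim: N n => // N IH n nN n0.
have [->|n1] := eqVneq n 1%N; first by rewrite F1 G1.
have n2 : (1 < n)%N by rewrite ltn_neqAle eq_sym n1.
have pp := pdiv_prime n2; set p := pdiv n in pp.
have [m pm e] := pfactor_coprime pp n0.
have l0 : (0 < logn p n)%N by rewrite logn_gt0 mem_primes pp n0 pdiv_dvd.
move: (logn p n) l0 e => l l0 e.
have m0 : (0 < m)%N by move: n0; rewrite e muln_gt0 => /andP[].
have pm' : ~~ (p %| m)%N by rewrite -prime_coprime.
have mn : (m < n)%N.
  by rewrite e -{1}[m]muln1 ltn_pmul2l // -{1}(expn0 p) ltn_exp2l ?prime_gt1.
rewrite e mulnC FM // GM // FG // IH //.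
by apply: leq_trans mn _; rewrite -ltnS.
Qed.

Lemma divn_pfactor p r i n d : (0 < p)%N -> (0 < n)%N -> (i <= r)%N -> (d %| n)%N ->
  ((p ^ r * n) %/ (p ^ i * d) = p ^ (r - i) * (n %/ d))%N.
Proof.
move=> p0 n0 ir dn; have d0 := dvdn_gt0 n0 dn.
rewrite -{1}(divnK dn) -{1}(subnKC ir) expnD.
rewrite (_ : _ * _ * (_ * _) = (p ^ (r - i) * (n %/ d)) * (p ^ i * d))%N; last by ring.
by rewrite mulnK // muln_gt0 expn_gt0 p0.
Qed.

Lemma dmul_pfactor F G p r n : prime p -> (0 < n)%N -> ~~ (p %| n)%N ->
  dmul F G (p ^ r * n)%N =
  \sum_(i < r.+1) \sum_(d <- divisors n) F (p ^ i * d)%N * G (p ^ (r - i) * (n %/ d))%N.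
Proof.
move=> pp n0 pn; rewrite /dmul big_divisors_pfactor //.
apply: eq_bigr => i _; rewrite big_seq [RHS]big_seq; apply: eq_bigr => d.
rewrite -dvdn_divisors // => dn; congr (_ * G _).
by apply: divn_pfactor => //; [exact: prime_gt0 | exact: leq_ord].
Qed.

Lemma dmul_prime_power F G p r : prime p ->
  dmul F G (p ^ r)%N = cauchy (fun i => F (p ^ i)%N) (fun i => G (p ^ i)%N) r.
Proof.
move=> pp; rewrite -[(p ^ r)%N]muln1 dmul_pfactor ?dvdn1 //; last first.
  by apply: contraTneq pp => ->.
by apply: eq_bigr => i _; rewrite (_ : divisors 1 = [:: 1%N]) // big_seq1 !muln1.
Qed.

Lemma dmul_mult F G : mult F -> mult G -> mult (dmul F G).
Proof.
move=> [F1 FM] [G1 GM]; split.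
  by rewrite /dmul (_ : divisors 1 = [:: 1%N]) // big_seq1 F1 G1 mulr1.
move=> p r n pp n0 pn; rewrite dmul_pfactor // dmul_prime_power // /cauchy mulr_suml.
apply: eq_bigr => i _; rewrite /dmul mulr_sumr big_seq [RHS]big_seq.
apply: eq_bigr => d; rewrite -dvdn_divisors // => dn.
have d0 := dvdn_gt0 n0 dn; have nd0 : (0 < n %/ d)%N by rewrite divn_gt0 // dvdn_leq.
rewrite FM ?GM //; first by ring.
  by apply: contra pn => H; apply: dvdn_trans H (dvdn_div dn).
by apply: contra pn => H; apply: dvdn_trans H dn.
Qed.

Lemma dsubstE F r c m : (0 < r)%N -> (0 < m)%N ->
  dsubst F r c (m ^ r)%N = F m * m%:R ^+ c.
Proof.
move=> r0 m0; rewrite /dsubst big_mkcond (bigD1_seq m) ?iota_uniq //=; last first.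
  by rewrite mem_index_iota m0 ltnS -{1}(expn1 m) leq_pexp2l.
rewrite eqxx big1 ?addr0 // => i im; rewrite eqn_exp2r //.
by rewrite (negPf im).
Qed.

Lemma dsubst0 F r c n : (forall m, (m ^ r)%N <> n) -> dsubst F r c n = 0.
Proof. by move=> H; rewrite /dsubst big1 // => m /eqP /H. Qed.

Lemma expn_pfactor p r s n m : prime p -> (0 < n)%N -> ~~ (p %| n)%N -> (0 < r)%N ->
  (m ^ r = p ^ s * n)%N -> exists i m', [/\ s = (i * r)%N, n = (m' ^ r)%N & m = (p ^ i * m')%N] /\ (0 < m')%N /\ ~~ (p %| m')%N.
Proof.
move=> pp n0 pn r0 e; have p0 := prime_gt0 pp.
have m0 : (0 < m)%N.
  by rewrite lt0n; apply: contraTneq n0 => m0; move: e; rewrite m0 exp0n // => /esym/eqP; rewrite muln_eq0 expn_eq0 (gtn_eqF p0) /= => /eqP ->.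
have [m' pm' em] := pfactor_coprime pp m0.
have pm'' : ~~ (p %| m')%N by rewrite -prime_coprime.
have m'0 : (0 < m')%N by move: m0; rewrite em muln_gt0 => /andP[].
have sE : s = (logn p m * r)%N.
  have := congr1 (logn p) e; rewrite lognX lognM ?expn_gt0 ?p0 // pfactorK //.
  by rewrite [logn p n]lognE (negPf pn) !andbF addn0 mulnC => ->.
exists (logn p m), m'; split; last by [].
split=> //; last by rewrite mulnC.
move: e; rewrite {1}em expnMn -expnM -sE mulnC => /eqP.
by rewrite eqn_pmul2l ?expn_gt0 ?p0 // => /eqP.
Qed.

(** The factors [p ^ s] and [n] are coprime, so their product is an [r]-th power exactly when both
    are; otherwise both sides vanish. *)
Lemma dsubst_mult F r c : (0 < r)%N -> mult F -> mult (dsubst F r c).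
Proof.
move=> r0 [F1 FM]; split; first by rewrite -(exp1n r) dsubstE // F1 expr1n mulr1.
move=> p s n pp n0 pn; have p0 := prime_gt0 pp.
have [[m e]|H] := pselect (exists m, (m ^ r = p ^ s * n)%N).
  have [i [m' [[-> -> em] [m'0 pm']]]] := expn_pfactor pp n0 pn r0 e.
  rewrite expnM -expnMn !dsubstE ?muln_gt0 ?expn_gt0 ?p0 // FM // natrM exprMn.
  by ring.
rewrite dsubst0; last by move=> m e; apply: H; exists m.
have [[i es]|Hs] := pselect (exists i, (i ^ r = p ^ s)%N); last first.
  by rewrite dsubst0 ?mul0r // => m e; apply: Hs; exists m.
rewrite [X in _ * X]dsubst0 ?mulr0 // => m e; apply: H; exists (i * m)%N.
by rewrite expnMn es e.
Qed.

Lemma dsubst_prime_power F r c p s : (0 < r)%N -> prime p ->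
  dsubst F r c (p ^ s)%N =
  if (r %| s)%N then F (p ^ (s %/ r))%N * (p%:R ^+ c) ^+ (s %/ r) else 0.
Proof.
move=> r0 pp; have p0 := prime_gt0 pp; case: ifP => [/dvdnP[i ->]|rs].
  by rewrite mulnK // expnM dsubstE ?expn_gt0 ?p0 // natrX exprAC.
apply: dsubst0 => m e; have p1 : ~~ (p %| 1)%N by rewrite dvdn1 gtn_eqF ?prime_gt1.
have [|i [m' [[es _ _] _]]] := @expn_pfactor p r s 1 m pp isT p1 r0; first by rewrite muln1.
by rewrite es dvdn_mull in rs.
Qed.

Lemma dzeta_mult : mult (dzeta C).
Proof. by split=> // *; rewrite /dzeta mulr1. Qed.

Lemma eq_dmul F F' G G' n : (0 < n)%N ->
  (forall m, (0 < m)%N -> F m = F' m) -> (forall m, (0 < m)%N -> G m = G' m) ->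
  dmul F G n = dmul F' G' n.
Proof.
move=> n0 FF GG; rewrite /dmul big_seq [RHS]big_seq; apply: eq_bigr => d.
rewrite -dvdn_divisors // => dn; have d0 := dvdn_gt0 n0 dn.
by rewrite FF // GG // divn_gt0 // dvdn_leq.
Qed.

Lemma dmulC F G n : (0 < n)%N -> dmul F G n = dmul G F n.
Proof.
move=> n0; have H d : d \in divisors n -> (n %/ (n %/ d) = d)%N.
  by rewrite -dvdn_divisors // => dn; rewrite divnA // mulKn.
rewrite /dmul (perm_big [seq (n %/ d)%N | d <- divisors n]) /=; last first.
  apply: uniq_perm; first exact: divisors_uniq.
    by rewrite map_inj_in_uniq ?divisors_uniq // => d e dn en E; rewrite -(H d) // E H.
  move=> d; apply/idP/mapP => [dn|[e + ->]].
    by exists (n %/ d)%N; rewrite ?H // -dvdn_divisors // dvdn_div // dvdn_divisors.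
  by rewrite -!dvdn_divisors // => en; apply: dvdn_div.
rewrite big_map big_seq [RHS]big_seq; apply: eq_bigr => d dn.
by rewrite H // mulrC.
Qed.

Lemma dmulA F G H n : (0 < n)%N -> dmul F (dmul G H) n = dmul (dmul F G) H n.
Proof.
move=> n0; rewrite /dmul.
transitivity (\sum_(e <- divisors n) \sum_(d <- divisors n | (e %| d)%N)
    F e * G (d %/ e)%N * H (n %/ d)%N); last first.
  rewrite (exchange_big_dep xpredT) //= big_seq [RHS]big_seq; apply: eq_bigr => d.
  rewrite -dvdn_divisors // => dn; have d0 := dvdn_gt0 n0 dn.
  rewrite mulr_suml -big_filter; apply: perm_big; apply: uniq_perm.
  - by rewrite filter_uniq // divisors_uniq.
  - exact: divisors_uniq.
  move=> e; rewrite mem_filter -!dvdn_divisors //; apply: andb_idr => ed.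
  exact: dvdn_trans dn.
rewrite big_seq [RHS]big_seq; apply: eq_bigr => e; rewrite -dvdn_divisors // => en.
have e0 := dvdn_gt0 n0 en; have ne0 : (0 < n %/ e)%N by rewrite divn_gt0 // dvdn_leq.
rewrite mulr_sumr -[RHS]big_filter [RHS](perm_big [seq (e * g)%N | g <- divisors (n %/ e)]) /=.
  rewrite big_map; apply: eq_bigr => g _.
  by rewrite mulKn // mulrA -divnMA.
apply: uniq_perm; first by rewrite filter_uniq // divisors_uniq.
  rewrite map_inj_uniq ?divisors_uniq // => g g' /eqP.
  by rewrite eqn_pmul2l // => /eqP.
move=> d; rewrite mem_filter -dvdn_divisors //; apply/andP/mapP => [[/dvdnP[g ->] gn]|[g + ->]].
  exists g; last by rewrite mulnC.
  by rewrite -dvdn_divisors // dvdn_divRL.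
by rewrite -dvdn_divisors // dvdn_divRL // [(g * e)%N]mulnC dvdn_mulr.
Qed.

Lemma dmul_delta F n : (0 < n)%N -> dmul F (dmonom C 1) n = F n.
Proof.
move=> n0; rewrite dmulC // /dmul (bigD1_seq 1%N) ?divisors_uniq //=; last first.
  by rewrite -dvdn_divisors // dvd1n.
by rewrite /dmonom eqxx mul1r divn1 big1 ?addr0 // => d /negPf ->; rewrite mul0r.
Qed.

(** Replaces an identity with a quotient by one with a product, to which multiplicativity applies;
    [dinv] never has to be shown multiplicative. *)
Lemma ddiv_unique F G K : G 1%N != 0 -> (forall n, (0 < n)%N -> dmul F G n = K n) ->
  forall n, (0 < n)%N -> F n = dmul K (dinv G) n.
Proof.
move=> G1 FG n n0; rewrite -[LHS]dmul_delta //.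
rewrite -(@eq_dmul (dmul F G) K (dinv G) (dinv G)) // -dmulA //; apply: eq_dmul => // m m0.
by rewrite dmulC // dmulVd.
Qed.

End Multiplicative.

(* [Y d] stands for the coefficients of [L(s, chi, O_{fd})], and the Euler factor of
   [Y 1] at [p] is [1 / (1 - tt p X + ee p X^2)]. *)
Section Recurrences.
Variables (C : fieldType) (Y : nat -> nat -> C) (tt ee : nat -> C).
Hypothesis Y11 : Y 1 1 = 1.
Hypothesis Y_coprime : forall d p n, (0 < d)%N -> prime p -> (0 < n)%N ->
  ~~ (p %| n)%N -> Y (d * p) n = Y d n.
(** The factor is the number [p + 1 - rho] of neighbours, with [ee p] standing for [rho - 1]. Once
    [p] divides the conductor of the order [rho] is 1, whence the plain [p] when [p] divides [d]. *)
Hypothesis Y_ramified : forall d p n, (0 < d)%N -> prime p -> (0 < n)%N ->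
  (p %| n)%N -> Y (d * p) n = if (p * p %| n)%N then
    (if (p %| d)%N then p%:R else p%:R - ee p) * Y d (n %/ (p * p)) else 0.
Hypothesis Y_hecke1 : forall p n, prime p -> (0 < n)%N ->
  tt p * Y 1 n = Y 1 (p * n) + ee p * (if (p %| n)%N then Y 1 (n %/ p) else 0).

(** Induction on [d], removing one prime [q] at a time. As [q] differs from [p], the two rules that
    lead from [c * q] to [c] commute with multiplying or dividing the argument by [p]. *)
Lemma Y_hecke d p n : (0 < d)%N -> prime p -> ~~ (p %| d)%N -> (0 < n)%N ->
  tt p * Y d n = Y d (p * n) + ee p * (if (p %| n)%N then Y d (n %/ p) else 0).
Proof.
have [N] := ubnP d; elim: N d n => // N IH d n dN d0 pp pd n0.
have [->|d1] := eqVneq d 1%N; first exact: Y_hecke1.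
have d2 : (1 < d)%N by rewrite ltn_neqAle eq_sym d1.
have qp := pdiv_prime d2; have qd := pdiv_dvd d; move: (pdiv d) qp qd => q qp qd.
have [c dE] : exists c, d = (c * q)%N by apply/dvdnP.
have c0 : (0 < c)%N by move: d0; rewrite dE muln_gt0 => /andP[].
have cN : (c < N)%N.
  rewrite -ltnS; apply: leq_ltn_trans dN; rewrite dE -{1}[c]muln1.
  by rewrite ltn_pmul2l // prime_gt1.
have pq : prime p && (p != q) by rewrite pp; apply: contra pd => /eqP ->.
have pc : ~~ (p %| c)%N by apply: contra pd; rewrite dE; apply: dvdn_mulr.
have qNp : ~~ (q %| p)%N by rewrite dvdn_prime2 // eq_sym; case/andP: pq.
have pn0 : (0 < p * n)%N by rewrite muln_gt0 prime_gt0.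
rewrite dE; have [qn|qn] := boolP (q %| n)%N; last first.
  have qpn : ~~ (q %| p * n)%N by rewrite Euclid_dvdM // negb_or qNp.
  rewrite (Y_coprime c0 qp n0 qn) (Y_coprime c0 qp pn0 qpn) IH //; congr (_ + _ * _); case: ifP => // pn.
  have np0 : (0 < n %/ p)%N by rewrite divn_gt0 ?prime_gt0 // dvdn_leq.
  have qnp : ~~ (q %| n %/ p)%N.
    by apply: contra qn => /dvdn_trans; apply; apply: dvdn_div.
  by rewrite (Y_coprime c0 qp np0 qnp).
have copq : coprime (q * q) p by rewrite coprimeMl andbb prime_coprime.
have qpn : (q %| p * n)%N by apply: dvdn_mull.
(* The weight [W] depends on [c] and [q] only, so the relation for [c], being linear, can be
   multiplied by it. *)
have [W YW] : exists W, forall m, (0 < m)%N -> (q %| m)%N -> Y (c * q) m =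
    if (q * q %| m)%N then W * Y c (m %/ (q * q)) else 0.
  by eexists=> m m0 qm; exact: Y_ramified c0 qp m0 qm.
rewrite (YW _ n0 qn) (YW _ pn0 qpn).
rewrite [(q * q %| p * n)%N]Gauss_dvdr //.
have [qq|qq] := boolP (q * q %| n)%N; last first.
  rewrite mulr0 add0r; case: ifP => [pn|]; last by rewrite mulr0.
  have qnp : (q %| n %/ p)%N.
    by rewrite -(@Gauss_dvdr q p) ?prime_coprime // [(p * _)%N]mulnC divnK.
  have np0 : (0 < n %/ p)%N by rewrite divn_gt0 ?prime_gt0 // dvdn_leq.
  rewrite (YW _ np0 qnp) ifF ?mulr0 //.
  apply/negbTE; apply: contra qq => /dvdn_trans; apply; exact: dvdn_div.
have qq0 : (0 < q * q)%N by rewrite muln_gt0 prime_gt0.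
have nq0 : (0 < n %/ (q * q))%N by rewrite divn_gt0 // dvdn_leq.
rewrite mulrCA IH // -muln_divA //.
have -> : (p %| n %/ (q * q))%N = (p %| n)%N.
  by rewrite -{2}(divnK qq) Gauss_dvdl // coprime_sym.
case: (boolP (p %| n)%N) => pn /=; last by ring.
have qnp : (q %| n %/ p)%N.
  by rewrite -(@Gauss_dvdr q p) ?prime_coprime // [(p * _)%N]mulnC divnK.
have np0 : (0 < n %/ p)%N by rewrite divn_gt0 ?prime_gt0 // dvdn_leq.
rewrite (YW _ np0 qnp) ifT; last by rewrite -(@Gauss_dvdr _ p) // [(p * _)%N]mulnC divnK.
have -> : (n %/ p %/ (q * q) = n %/ (q * q) %/ p)%N by rewrite -!divnMA mulnC.
by ring.
Qed.

(** The coefficients of the left-hand side of the theorem: the factor d^-s shifts the series of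
    [Y d] by [d]. *)
Definition csum (n : nat) : C := \sum_(d <- divisors n) Y d (n %/ d).

Section Prime.
Variables (p n : nat).
Hypotheses (pp : prime p) (n0 : (0 < n)%N) (pn : ~~ (p %| n)%N).

(** The part of [csum (p ^ (j + r) * n)] that comes from the indices of [p]-adic valuation exactly
    [j]. *)
Let Z j r := \sum_(d <- divisors n) Y (p ^ j * d) (p ^ r * (n %/ d)).

Let dP d : d \in divisors n ->
  [/\ (0 < d)%N, (0 < n %/ d)%N, ~~ (p %| d)%N & ~~ (p %| n %/ d)%N].
Proof.
rewrite -dvdn_divisors // => dn; have d0 := dvdn_gt0 n0 dn.
split=> //; first by rewrite divn_gt0 // dvdn_leq.
  by apply: contra pn => H; apply: dvdn_trans dn.
by apply: contra pn => H; apply: dvdn_trans H (dvdn_div dn).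
Qed.

Let ZS0 j : Z j.+1 0 = Z j 0.
Proof.
rewrite /Z big_seq [RHS]big_seq; apply: eq_bigr => d /dP[d0 nd0 pd pnd].
rewrite expnS -mulnA mulnC Y_coprime ?mul1n //.
by rewrite muln_gt0 expn_gt0 prime_gt0.
Qed.

Let ZS1 j : Z j.+1 1 = 0.
Proof.
rewrite /Z big_seq big1 // => d /dP[d0 nd0 pd pnd].
have p0 := prime_gt0 pp.
have dj0 : (0 < p ^ j * d)%N by rewrite muln_gt0 expn_gt0 p0.
have pnd0 : (0 < p * (n %/ d))%N by rewrite muln_gt0 p0.
rewrite expnS -mulnA mulnC expn1 (Y_ramified dj0 pp pnd0 (dvdn_mulr _ (dvdnn p))).
by rewrite dvdn_pmul2l // (negPf pnd).
Qed.

Let ZSS j r : Z j.+1 r.+2 = (if j is 0%N then p%:R - ee p else p%:R) * Z j r.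
Proof.
rewrite /Z mulr_sumr big_seq [RHS]big_seq; apply: eq_bigr => d /dP[d0 nd0 pd pnd].
have p0 := prime_gt0 pp.
have dj0 : (0 < p ^ j * d)%N by rewrite muln_gt0 expn_gt0 p0.
have pnd0 : (0 < p ^ r.+2 * (n %/ d))%N by rewrite muln_gt0 expn_gt0 p0.
have e : (p ^ r.+2 * (n %/ d) = p * p * (p ^ r * (n %/ d)))%N by rewrite !expnS !mulnA.
have pd1 : (p %| p ^ r.+2 * (n %/ d))%N by rewrite e -mulnA dvdn_mulr.
rewrite expnS -mulnA mulnC (Y_ramified dj0 pp pnd0 pd1) e dvdn_mulr // mulKn ?muln_gt0 ?p0 //.
by case: j {dj0} => [|j]; rewrite ?mul1n ?(negPf pd) // expnS -mulnA dvdn_mulr.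
Qed.

Let Zhecke1 : Z 0 1 = tt p * Z 0 0.
Proof.
rewrite /Z mulr_sumr big_seq [RHS]big_seq; apply: eq_bigr => d /dP[d0 nd0 pd pnd].
by rewrite !mul1n expn1 Y_hecke // (negPf pnd) mulr0 addr0.
Qed.

Let Zhecke r : Z 0 r.+2 = tt p * Z 0 r.+1 - ee p * Z 0 r.
Proof.
rewrite /Z !mulr_sumr -sumrB big_seq [RHS]big_seq; apply: eq_bigr => d /dP[d0 nd0 pd pnd].
have p0 := prime_gt0 pp.
have pnd0 : (0 < p ^ r.+1 * (n %/ d))%N by rewrite muln_gt0 expn_gt0 p0.
rewrite !mul1n [tt p * _]Y_hecke //.
rewrite expnS -mulnA [(p ^ r.+1)%N]expnS -mulnA dvdn_mulr // mulKn //.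
by rewrite addrK.
Qed.

Let csumE r : csum (p ^ r * n) = \sum_(j < r.+1) Z j (r - j).
Proof.
rewrite /csum big_divisors_pfactor //; apply: eq_bigr => j _.
rewrite /Z big_seq [RHS]big_seq; apply: eq_bigr => d; rewrite -dvdn_divisors // => dn.
by congr (Y _ _); apply: divn_pfactor => //; [exact: prime_gt0 | exact: leq_ord].
Qed.

Let csum0 : csum (p ^ 0 * n) = Z 0 0.
Proof. by rewrite csumE big_ord1. Qed.

Let csum1 : csum (p ^ 1 * n) = Z 0 1 + Z 0 0.
Proof. by rewrite csumE big_ord_recr big_ord1 /= ZS0. Qed.

Let Z_diag j : Z j 0 = Z 0 0.
Proof. by elim: j => // j IH; rewrite ZS0. Qed.

Let csum2 : csum (p ^ 2 * n) = Z 0 2 + Z 0 0.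
Proof. by rewrite csumE !big_ord_recr big_ord0 /= ZS1 Z_diag; ring. Qed.

(** The extreme terms of the sum over [j] give [Z 0 r.+3] and [Z 0 0], and the term before the last
    is zero. Each remaining term loses one in [j] and two in the exponent; together they form
    [p * csum], except that the weight at [j = 0] is [p - ee p]. *)
Let csum3 r : csum (p ^ r.+3 * n) =
  p%:R * csum (p ^ r * n) + Z 0 r.+3 - ee p * Z 0 r + Z 0 0.
Proof.
rewrite !csumE big_ord_recl subn0 2!big_ord_recr /= /bump /= !add1n subnn Z_diag.
rewrite (_ : r.+3 - r.+2 = 1)%N ?ZS1; last by lia.
rewrite (eq_bigr (fun j : 'I_r.+1 => (if (j : nat) is 0%N then p%:R - ee p else p%:R) * Z j (r - j))); last first.
  move=> j _ /=; rewrite /bump /= add1n subSS -ZSS.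
  by congr (Z _ _); have := leq_ord j; lia.
rewrite big_ord_recl [in RHS]big_ord_recl /= subn0 mulrDr -mulr_sumr.
by ring.
Qed.

(** Both sides obey the same recurrence of order two, so the induction carries two consecutive
    exponents. *)
Let Z0E r : Z 0 r = Y 1 (p ^ r) * Z 0 0 /\ Z 0 r.+1 = Y 1 (p ^ r.+1) * Z 0 0.
Proof.
have p0 := prime_gt0 pp.
have p1 : ~~ (p %| 1)%N by rewrite dvdn1 gtn_eqF // prime_gt1.
elim: r => [|r [IH1 IH2]]; split=> //.
- by rewrite expn0 Y11 mul1r.
- by rewrite Zhecke1 expn1 -(mulr1 (tt p)) -Y11 Y_hecke1 // muln1 (negPf p1) mulr0 addr0.
have := @Y_hecke1 p (p ^ r.+1) pp; rewrite expn_gt0 p0 => /(_ isT).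
rewrite -expnS [in (_ %| _)%N]expnS [in (_ %/ _)%N]expnS dvdn_mulr // mulKn // => E.
by rewrite Zhecke IH1 IH2 mulrA E; ring.
Qed.

(** For [n = 1] these are the relations on [s] that [local_factor_identity] requires; for general
    [n] they give the multiplicativity of [csum], as [csum n] enters linearly. *)
Lemma csum_pfactor :
  [/\ csum (p ^ 1 * n) = (Y 1 (p ^ 1) + 1) * csum n,
      csum (p ^ 2 * n) = (Y 1 (p ^ 2) + 1) * csum n &
      forall r, csum (p ^ r.+3 * n) = p%:R * csum (p ^ r * n) +
        (Y 1 (p ^ r.+3) - ee p * Y 1 (p ^ r) + 1) * csum n].
Proof.
have S0 : csum n = Z 0 0 by rewrite -csum0 mul1n.
split=> [||r]; rewrite S0; first by rewrite csum1 (Z0E 0).2; ring.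
  by rewrite csum2 (Z0E 1).2; ring.
by rewrite csum3 (Z0E r.+2).2 (Z0E r).1; ring.
Qed.

Lemma Y1_pfactor r : Y 1 (p ^ r * n) = Y 1 (p ^ r) * Y 1 n.
Proof.
have p0 := prime_gt0 pp.
have p1 : ~~ (p %| 1)%N by rewrite dvdn1 gtn_eqF // prime_gt1.
suff H : Y 1 (p ^ r * n) = Y 1 (p ^ r) * Y 1 n /\
    Y 1 (p ^ r.+1 * n) = Y 1 (p ^ r.+1) * Y 1 n by case: H.
elim: r => [|r [IH1 IH2]]; split=> //.
- by rewrite expn0 Y11 mul1r mul1n.
- have := Y_hecke1 pp n0; rewrite (negPf pn) mulr0 addr0 expn1 => <-.
  have := Y_hecke1 pp (isT : 0 < 1)%N; rewrite (negPf p1) mulr0 addr0 muln1 Y11 mulr1.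
  by move=> ->.
have pr0 : (0 < p ^ r.+1)%N by rewrite expn_gt0 p0.
have prn0 : (0 < p ^ r.+1 * n)%N by rewrite muln_gt0 pr0.
have e1 : (p %| p ^ r.+1)%N by rewrite expnS dvdn_mulr.
have e2 : (p ^ r.+1 %/ p = p ^ r)%N by rewrite expnS mulKn.
have e3 : (p ^ r.+1 * n %/ p = p ^ r * n)%N by rewrite expnS -mulnA mulKn.
have := Y_hecke1 pp pr0; have := Y_hecke1 pp prn0.
rewrite dvdn_mulr // e1 e2 e3 -expnS mulnA -expnS IH1 IH2 => E1 E2.
have -> : Y 1 (p ^ r.+2) = tt p * Y 1 (p ^ r.+1) - ee p * Y 1 (p ^ r) by rewrite E2; ring.
have -> : Y 1 (p ^ r.+2 * n) = tt p * (Y 1 (p ^ r.+1) * Y 1 n) - ee p * (Y 1 (p ^ r) * Y 1 n).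
  by rewrite E1; ring.
by ring.
Qed.

Lemma Y1_prime_power r : Y 1 (p ^ 1) = tt p /\
  Y 1 (p ^ r.+2) = tt p * Y 1 (p ^ r.+1) - ee p * Y 1 (p ^ r).
Proof.
have p0 := prime_gt0 pp.
have p1 : ~~ (p %| 1)%N by rewrite dvdn1 gtn_eqF // prime_gt1.
split.
  have := Y_hecke1 pp (isT : 0 < 1)%N; rewrite (negPf p1) mulr0 addr0 muln1 Y11 mulr1.
  by rewrite expn1.
have pr0 : (0 < p ^ r.+1)%N by rewrite expn_gt0 p0.
have e1 : (p %| p ^ r.+1)%N by rewrite expnS dvdn_mulr.
have e2 : (p ^ r.+1 %/ p = p ^ r)%N by rewrite expnS mulKn.
by have := Y_hecke1 pp pr0; rewrite e1 e2 -expnS => ->; ring.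
Qed.

End Prime.

Lemma csum1E : csum 1 = 1.
Proof. by rewrite /csum (_ : divisors 1 = [:: 1%N]) // big_seq1 Y11. Qed.

Lemma Y1_mult : mult (Y 1).
Proof. by split=> // p r n pp n0 pn; apply: Y1_pfactor. Qed.

Lemma csum_mult : mult csum.
Proof.
split=> [|p r n pp n0 pn]; first exact: csum1E.
have p1 : ~~ (p %| 1)%N by rewrite dvdn1 gtn_eqF // prime_gt1.
have [s1 s2 s3] := csum_pfactor pp (isT : 0 < 1)%N p1.
have [c1 c2 c3] := csum_pfactor pp n0 pn.
rewrite !muln1 csum1E !mulr1 in s1 s2.
have {}s3 q : csum (p ^ q.+3) = p%:R * csum (p ^ q) +
    (Y 1 (p ^ q.+3) - ee p * Y 1 (p ^ q) + 1).
  by have := s3 q; rewrite !muln1 csum1E mulr1.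
(* The recurrence has step three, hence three consecutive exponents in the induction. *)
suff H : [/\ csum (p ^ r * n) = csum (p ^ r) * csum n,
    csum (p ^ r.+1 * n) = csum (p ^ r.+1) * csum n &
    csum (p ^ r.+2 * n) = csum (p ^ r.+2) * csum n] by case: H.
elim: r => [|r [IH0 IH1 IH2]]; split=> //.
- by rewrite mul1n csum1E mul1r.
- by rewrite c1 s1.
- by rewrite c2 s2.
by rewrite c3 s3 IH0; ring.
Qed.

Theorem csum_dirichlet n : (0 < n)%N ->
  csum n = dmul (dmul (dzeta C) (dsubst (dzeta C) 3 1)) (ddiv (Y 1) (dsubst (Y 1) 2 0)) n.
Proof.
move=> n0; have m3 : mult (dsubst (dzeta C) 3 1) by apply: dsubst_mult => //; exact: dzeta_mult.
have m2 : mult (dsubst (Y 1) 2 0) by apply: dsubst_mult => //; exact: Y1_mult.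
have mz : mult (dmul (dzeta C) (dsubst (dzeta C) 3 1)) by apply: dmul_mult => //; exact: dzeta_mult.
rewrite /ddiv dmulA //; apply: (ddiv_unique (G := dsubst (Y 1) 2 0)) => //.
  by rewrite m2.1 oner_eq0.
apply: mult_eq => [||p r pp].
- by apply: dmul_mult => //; exact: csum_mult.
- by apply: dmul_mult => //; exact: Y1_mult.
have p1 : ~~ (p %| 1)%N by rewrite dvdn1 gtn_eqF // prime_gt1.
have [s1 s2 s3] := csum_pfactor pp (isT : 0 < 1)%N p1.
rewrite !muln1 csum1E !mulr1 in s1 s2.
rewrite !dmul_prime_power // /cauchy.
under [RHS]eq_bigr => i _ do rewrite dmul_prime_power //.
apply: (@local_factor_identity _ (tt p) (ee p) p%:R (fun i => Y 1 (p ^ i))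
  (fun i => dsubst (Y 1) 2 0 (p ^ i)) (fun i => dsubst (dzeta C) 3 1 (p ^ i))
  (fun i => csum (p ^ i))) => [||i|i|i||||i].
- exact: Y11.
- by have [] := Y1_prime_power pp 0.
- by have [] := Y1_prime_power pp i.
- rewrite dsubst_prime_power // dvdn2 -divn2 expr0 expr1n mulr1.
  by case: odd.
- by rewrite dsubst_prime_power // /dzeta mul1r expr1.
- by rewrite expn0 csum1E.
- by [].
- by [].
by have := s3 i; rewrite !muln1 csum1E mulr1 => ->; ring.
Qed.

End Recurrences.

(** * Invertible ideals of quadratic orders *)

Section QuadraticOrders.
Variables (k : comUnitAlgType rat) (B : integral_basis k).
Local Notation w := (ib_w B).
Local Notation t := (ib_t B).
Local Notation u := (ib_u B).
Local Notation re := (ib_re B).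
Local Notation im := (ib_im B).
Local Notation "a %:K" := (in_alg k a)
  (at level 2, left associativity, format "a %:K").
Local Notation O := (@quad_order k).
Local Notation "a ** b" := (zmod_mul a b) (at level 40, left associativity).
Implicit Types (a b : set k) (x y z : k) (m : nat) (c : rat).

(** * Coordinates, conjugation and the norm form *)

Lemma coord_ext x y : re x = re y -> im x = im y -> x = y.
Proof. by move=> e1 e2; rewrite (ib_coord B x) (ib_coord B y) e1 e2. Qed.

Let reim_eq x r s : x = r%:K + s%:K * w -> (re x = r) * (im x = s).
Proof. by move=> ->; rewrite ib_reE ib_imE. Qed.

Lemma reimD x y : (re (x + y) = re x + re y) * (im (x + y) = im x + im y).
Proof.
by apply: reim_eq; rewrite {1}(ib_coord B x) {1}(ib_coord B y); ring.
Qed.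

Lemma reimM x y : (re (x * y) = re x * re y - u%:~R * im x * im y) *
  (im (x * y) = re x * im y + im x * re y + t%:~R * im x * im y).
Proof.
apply: reim_eq; rewrite {1}(ib_coord B x) {1}(ib_coord B y).
by have E := ib_sqr B; ring: E.
Qed.

Lemma reimN x : (re (- x) = - re x) * (im (- x) = - im x).
Proof. by apply: reim_eq; rewrite {1}(ib_coord B x); ring. Qed.

Lemma reimK c : (re c%:K = c) * (im c%:K = 0).
Proof. by apply: reim_eq; ring. Qed.

Lemma reimw : (re w = 0) * (im w = 1).
Proof. by apply: reim_eq; ring. Qed.

Lemma reim0 : (re 0 = 0) * (im 0 = 0).
Proof. by apply: reim_eq; ring. Qed.

Lemma reim1 : (re 1 = 1) * (im 1 = 0).
Proof. by apply: reim_eq; ring. Qed.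

Lemma reimz (i : int) : (re i%:~R = i%:~R) * (im i%:~R = 0).
Proof. by apply: reim_eq; ring. Qed.

Lemma reimn (n : nat) : (re n%:R = n%:R) * (im n%:R = 0).
Proof. by apply: reim_eq; ring. Qed.

Definition reimE := (reimD, reimM, reimN, reimK, reimw, reim0, reim1, reimz, reimn).

Definition conjk x : k := (re x + t%:~R * im x)%:K - (im x)%:K * w.
Definition nm x : rat := re x * re x + t%:~R * re x * im x + u%:~R * im x * im x.

Lemma reimJ x : (re (conjk x) = re x + t%:~R * im x) * (im (conjk x) = - im x).
Proof. by rewrite /conjk !reimE; split; ring. Qed.

Lemma conjD x y : conjk (x + y) = conjk x + conjk y.
Proof. by apply: coord_ext; rewrite !(reimJ, reimE); ring. Qed.
Lemma conjN x : conjk (- x) = - conjk x.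
Proof. by apply: coord_ext; rewrite !(reimJ, reimE); ring. Qed.
Lemma conjM x y : conjk (x * y) = conjk x * conjk y.
Proof. by apply: coord_ext; rewrite !(reimJ, reimE); ring. Qed.
Lemma conjK x : conjk (conjk x) = x.
Proof. by apply: coord_ext; rewrite !(reimJ, reimE); ring. Qed.
Lemma conj_alg c : conjk c%:K = c%:K.
Proof. by apply: coord_ext; rewrite !(reimJ, reimE); ring. Qed.
Lemma conjz (i : int) : conjk i%:~R = i%:~R.
Proof. by apply: coord_ext; rewrite !(reimJ, reimE); ring. Qed.
Lemma conjw : conjk w = t%:~R - w.
Proof. by apply: coord_ext; rewrite !(reimJ, reimE); ring. Qed.
Lemma mul_conj x : x * conjk x = (nm x)%:K.
Proof. by apply: coord_ext; rewrite !(reimJ, reimE) /nm; ring. Qed.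

(** * The orders, and the calculus of lattices satisfying [inv_norm] *)

Lemma ordP m x :
  O m x <-> exists i j : int, x = i%:~R + (j * m%:Z)%:~R * w.
Proof.
split=> [[i [y /(ib_max B) [i' [j' ->]] ->]]|[i [j ->]]].
  by exists (i + m%:Z * i'), j'; ring.
exists i; exists (0%:~R + j%:~R * w); first by apply/(ib_max B); exists 0, j.
ring.
Qed.

Lemma ord_int m (i : int) : O m i%:~R.
Proof. by apply/ordP; exists i, 0; ring. Qed.

Lemma ord1 m : O m 1. Proof. exact: (ord_int m 1). Qed.

Lemma ordw m : O m (m%:R * w).
Proof. by apply/ordP; exists 0, 1; ring. Qed.

Lemma subgroup_ord m : is_subgroup (O m).
Proof.
split; first exact: (ord_int m 0).
move=> x y /ordP[i [j ->]] /ordP[i' [j' ->]]; apply/ordP.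
by exists (i - i'), (j - j'); ring.
Qed.
Hint Resolve subgroup_ord : core.

Lemma ordM m x y : O m x -> O m y -> O m (x * y).
Proof.
move=> /ordP[i [j ->]] /ordP[i' [j' ->]]; apply/ordP.
exists (i * i' - j * j' * m%:Z * m%:Z * u), (i * j' + j * i' + j * j' * m%:Z * t).
by have E := ib_sqr B; ring: E.
Qed.

Lemma ordJ m x : O m x -> O m (conjk x).
Proof.
move=> /ordP[i [j ->]]; apply/ordP; exists (i + j * m%:Z * t), (- j).
by apply: coord_ext; rewrite !(reimJ, reimE); ring.
Qed.

Lemma ord_sub m m' : (m' %| m)%N -> O m `<=` O m'.
Proof.
move=> /dvdnP[q ->] x /ordP[i [j ->]]; apply/ordP.
by exists i, (j * q%:Z); rewrite PoszM mulrA.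
Qed.

Lemma ord_subP m m' : O m `<=` O m' -> (m' %| m)%N.
Proof.
move=> /(_ _ (ordw m)) /ordP[i [j]] /(congr1 im); rewrite !reimE => /eqP.
rewrite !(mul0r, mulr0, addr0, add0r, mulr1) [m%:R]pmulrn eqr_int => /eqP /(congr1 absz).
by rewrite abszM /= => ->; apply: dvdn_mull.
Qed.

Lemma ord_mul m m' : (m' %| m)%N -> O m ** O m' = O m'.
Proof.
move=> d; apply/seteqP; split=> [|x Ox].
  apply: zmod_mul_sub => // x y Ox Oy; apply: ordM => //; exact: ord_sub Ox.
by rewrite -[x]mul1r; apply: mem_zmod_mul => //; apply: ord1.
Qed.

Lemma ord_scalar m c : O m c%:K -> c \is a Num.int.
Proof.
move=> /ordP[i [j]] /(congr1 re); rewrite !reimE => ->.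
by rewrite !(mul0r, mulr0, subr0, addr0); apply: intr_int.
Qed.

Definition cj a : set k := [set conjk x | x in a].

Lemma cjE a x : cj a x <-> a (conjk x).
Proof.
split; first by move=> [y ay <-]; rewrite conjK.
by move=> ax; exists (conjk x); rewrite ?conjK.
Qed.

Lemma cjK a : cj (cj a) = a.
Proof.
by apply/seteqP; split=> x; rewrite !cjE conjK.
Qed.

Lemma cj_ord m : cj (O m) = O m.
Proof.
apply/seteqP; split=> x; rewrite cjE; last exact: ordJ.
by move/ordJ; rewrite conjK.
Qed.

Lemma cj_mul a b : cj (a ** b) = cj a ** cj b.
Proof.
suff H (a' b' : set k) : cj (a' ** b') `<=` cj a' ** cj b'.
  apply/seteqP; split; first exact: H.
  by move=> x xab; apply/cjE; rewrite -[a]cjK -[b]cjK; apply: H; apply/cjE; rewrite conjK.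
move=> _ [_ [s [sP ->]] <-]; have -> : conjk (\sum_(p <- s) p.1 * p.2) =
    \sum_(p <- s) conjk p.1 * conjk p.2.
  elim: s {sP} => [|p s IH]; first by rewrite !big_nil (conjz 0).
  by rewrite !big_cons conjD conjM IH.
apply: zmod_mul_sum => p /sP[ap bp]; apply: mem_zmod_mul; apply/cjE; by rewrite conjK.
Qed.

Lemma cj_scale x a : cj (scale x a) = scale (conjk x) (cj a).
Proof.
apply/seteqP; split=> y.
  by move=> [_ [z az <-] <-]; exists (conjk z); rewrite ?conjM //; exists z.
by move=> [_ [z az <-] <-]; exists (x * z); rewrite ?conjM //; exists z.
Qed.

Lemma subgroup_cj a : is_subgroup a -> is_subgroup (cj a).
Proof.
move=> [a0 aB]; split; first by apply/cjE; rewrite (conjz 0).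
by move=> _ _ [x ax <-] [y ay <-]; exists (x - y); [apply: aB | rewrite conjD conjN].
Qed.

Lemma cjS a b : a `<=` b -> cj a `<=` cj b.
Proof. by move=> ab _ [x ax <-]; exists x => //; apply: ab. Qed.

(* [a] is an invertible [O m]-ideal of norm [c]: for a lattice with ring of multipliers
   [O m], the inverse is always [conj a] up to a rational factor. *)
Definition inv_norm m c a : Prop :=
  [/\ (0 < m)%N, 0 < c, is_subgroup a, O m ** a = a
    & a ** cj a = scale c%:K (O m)].

Lemma scale_ord_scalar m c c' :
  c' != 0 -> scale c'%:K (O m) c%:K -> c / c' \is a Num.int.
Proof.
move=> c'0 [y Oy e]; apply: (ord_scalar (m := m)).
suff -> : (c / c')%:K = y by [].
by rewrite mulrC algM -e mulrA -algM mulVf // alg1 mul1r.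
Qed.

Lemma posint_inv_eq1 c : 0 < c -> c \is a Num.int -> c^-1 \is a Num.int -> c = 1.
Proof.
move=> c0 /intrP[i ci] /intrP[j cj0].
have i0 : 0 < i by rewrite -(ltr0z rat) -ci.
have j0 : 0 < j by rewrite -(ltr0z rat) -cj0 invr_gt0.
have : i * j = 1.
  by apply/eqP; rewrite -(eqr_int rat) intrM -ci -cj0 divff ?lt0r_neq0.
by move=> ij; rewrite ci; have -> : i = 1 by nia.
Qed.

Lemma scale_ord_inj m c c' : 0 < c -> 0 < c' ->
  scale c%:K (O m) = scale c'%:K (O m) -> c = c'.
Proof.
move=> c0 c'0 e; apply: divr1_eq; apply: posint_inv_eq1; first exact: divr_gt0.
  apply: (@scale_ord_scalar m); rewrite ?lt0r_neq0 // -e.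
  by exists 1; rewrite ?mulr1 //; apply: ord1.
rewrite invf_div; apply: (@scale_ord_scalar m); rewrite ?lt0r_neq0 // e.
by exists 1; rewrite ?mulr1 //; apply: ord1.
Qed.

Lemma scaleN1_ord m : scale (-1) (O m) = O m.
Proof.
apply/seteqP; split=> x.
  by move=> [y Oy <-]; rewrite mulN1r; apply: subgroupN.
by move=> Ox; exists (- x); rewrite ?mulN1r ?opprK //; apply: subgroupN.
Qed.

Lemma ord_mul_self m : O m ** O m = O m.
Proof. exact: ord_mul. Qed.

Lemma inv_norm_ord m : (0 < m)%N -> inv_norm m 1 (O m).
Proof.
by move=> m0; split; rewrite ?cj_ord ?ord_mul_self ?alg1 ?scale1.
Qed.

Lemma inv_normM m c c' a b :
  inv_norm m c a -> inv_norm m c' b -> inv_norm m (c * c') (a ** b).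
Proof.
move=> [m0 c0 sa Oa ea] [_ c'0 sb Ob eb]; split=> //.
- exact: mulr_gt0.
- exact: subgroup_zmod_mul.
- by rewrite zmod_mulA Oa.
- by rewrite cj_mul zmod_mulACA ea eb zmod_mulZl zmod_mulZr ord_mul_self scaleA -algM.
Qed.

(** Extension multiplies both sides of [a ** cj a = scale c%:K (O m)] by [O m'], so the norm is
    unchanged. *)
Lemma inv_norm_ext m m' c a : (m' %| m)%N ->
  inv_norm m c a -> inv_norm m' c (a ** O m').
Proof.
move=> d [m0 c0 sa Oa ea]; split=> //.
- exact: dvdn_gt0 d.
- exact: subgroup_zmod_mul.
- by rewrite zmod_mulCA ord_mul_self.
- by rewrite cj_mul cj_ord zmod_mulACA ea ord_mul_self zmod_mulZl ord_mul.
Qed.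

Lemma inv_norm_scale m c a x : nm x != 0 ->
  inv_norm m c a -> inv_norm m (`|nm x| * c) (scale x a).
Proof.
move=> x0 [m0 c0 sa Oa ea]; split=> //.
- by rewrite mulr_gt0 // normr_gt0.
- exact: subgroup_scale.
- by rewrite zmod_mulZr Oa.
- rewrite cj_scale zmod_mulZl zmod_mulZr scaleA mul_conj ea.
  (* [nm x] may be negative when the norm form is indefinite; the sign is absorbed by the unit -1 of
     [O m]. *)
  have [n0|n0] := ger0P; first by rewrite scaleA -algM.
  by rewrite -[in LHS]scaleN1_ord !scaleA mulrN1 mulNr algN algM.
Qed.

Lemma nm_alg c : nm c%:K = c * c.
Proof. by rewrite /nm !reimE; ring. Qed.

Lemma inv_norm_scaleK m c a c' : 0 < c' ->
  inv_norm m c a -> inv_norm m (c' * c' * c) (scale c'%:K a).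
Proof.
move=> c'0 /(@inv_norm_scale _ _ _ c'%:K).
by rewrite nm_alg ger0_norm ?mulr_ge0 ?ltW //; apply; rewrite mulf_neq0 ?lt0r_neq0.
Qed.

Lemma inv_norm_cj m c a : inv_norm m c a -> inv_norm m c (cj a).
Proof.
move=> [m0 c0 sa Oa ea]; split=> //.
- exact: subgroup_cj.
- by rewrite -(cj_ord m) -cj_mul Oa.
- by rewrite cjK zmod_mulC.
Qed.

Definition inv_ideal c a := scale c^-1%:K (cj a).

Lemma inv_normV m c a : inv_norm m c a -> inv_norm m c^-1 (inv_ideal c a).
Proof.
move=> na; have [_ c0 _ _ _] := na.
have := @inv_norm_scaleK _ _ _ c^-1 _ (inv_norm_cj na).
by rewrite -mulrA mulVf ?mulr1 ?lt0r_neq0 ?invr_gt0 //; apply.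
Qed.

Lemma mul_inv_ideal m c a : inv_norm m c a -> a ** inv_ideal c a = O m.
Proof.
move=> [m0 c0 sa Oa ea].
by rewrite zmod_mulZr ea scaleA -algM mulVf ?lt0r_neq0 // alg1 scale1.
Qed.

(** A lattice determines its order: [O m1] acts on [a], hence on the product of [a] with its inverse
    over [O m2], which is [O m2] itself. The norm then follows. *)
Lemma inv_norm_uniq m c m' c' a :
  inv_norm m c a -> inv_norm m' c' a -> m = m' /\ c = c'.
Proof.
move=> na na'.
suff H m1 m2 c1 c2 : inv_norm m1 c1 a -> inv_norm m2 c2 a -> (m2 %| m1)%N.
  have mm' : m = m' by apply/eqP; rewrite eqn_dvd (H _ _ _ _ na na') (H _ _ _ _ na' na).
  split=> //; have [_ c0 _ _ e] := na; have [_ c'0 _ _ e'] := na'.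
  by apply: (@scale_ord_inj m) => //; rewrite -e e' mm'.
move=> n1 n2; have [_ _ _ O1 _] := n1; have [_ _ _ O2 _] := n2.
have e2 : O m1 ** O m2 = O m2 by rewrite -(mul_inv_ideal n2) zmod_mulA O1.
apply: ord_subP; rewrite -e2.
move=> x Ox; rewrite -[x]mulr1; apply: mem_zmod_mul => //; exact: ord1.
Qed.

Lemma inv_normI m c a b b' : inv_norm m c a ->
  O m ** b = b -> O m ** b' = b' -> a ** b = a ** b' -> b = b'.
Proof.
move=> na Ob Ob' e; rewrite -Ob -Ob' -(mul_inv_ideal na) zmod_mulC.
by rewrite [RHS]zmod_mulC !zmod_mulA [b ** _]zmod_mulC [b' ** _]zmod_mulC e.
Qed.

Lemma inv_norm_mem_nm m c a x : inv_norm m c a -> a x ->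
  exists i : int, nm x = i%:~R * c.
Proof.
move=> [m0 c0 sa Oa ea] ax.
have : scale c%:K (O m) (nm x)%:K.
  by rewrite -ea -mul_conj; apply: mem_zmod_mul => //; exists x.
move=> /scale_ord_scalar; rewrite lt0r_neq0 // => /(_ isT) /intrP[i e].
by exists i; rewrite -e divfK ?lt0r_neq0.
Qed.

Lemma inv_norm_memM m c a x y : inv_norm m c a -> O m x -> a y -> a (x * y).
Proof. by move=> [_ _ _ Oa _] Ox ay; rewrite -Oa; apply: mem_zmod_mul. Qed.

Lemma inv_norm_sub m c a : inv_norm m c a -> a `<=` O m ->
  scale c%:K (O m) `<=` a.
Proof.
move=> [m0 c0 sa Oa ea] aO; rewrite -ea -[X in _ `<=` X]Oa zmod_mulC.
by apply: zmod_mulS => //; rewrite -(cj_ord m); apply: cjS.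
Qed.

Lemma inv_norm_nat m c a : inv_norm m c a -> a `<=` O m ->
  exists2 n : nat, (0 < n)%N & c = n%:R.
Proof.
move=> na aO; have [m0 c0 sa Oa ea] := na.
have : O m c%:K.
  by apply/aO/(inv_norm_sub na aO); exists 1; rewrite ?mulr1 //; apply: ord1.
move=> /ord_scalar /intrP[[n|n] e]; move: c0; rewrite e.
  by rewrite -pmulrn ltr0n; exists n.
by rewrite ltr0z.
Qed.

Lemma inv_norm_mem_int m n a : inv_norm m n%:R a -> a `<=` O m -> a n%:R.
Proof.
move=> na aO; apply: (inv_norm_sub na aO); exists 1; rewrite ?mulr1 ?algn //.
exact: ord1.
Qed.

Lemma inv_norm1 m a : inv_norm m 1 a -> a `<=` O m -> a = O m.
Proof.
move=> na aO; apply/seteqP; split=> // x Ox.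
by apply: (inv_norm_sub na aO); rewrite alg1 scale1.
Qed.

(* Hermite normal form: [a] has the basis [al], [be + ga * w]. *)
Definition has_hnf a (al be ga : rat) : Prop :=
  forall x, a x <-> exists i j : int,
    x = (i%:~R * al + j%:~R * be)%:K + (j%:~R * ga)%:K * w.

(** [al] generates the rational elements of [a], and [ga] the projection of [a] to the
    [w]-coordinate. Both groups are cyclic because denominators are bounded by [N], and nonzero
    thanks to [q] and [x]. *)
Lemma exists_hnf a (N : nat) q x : is_subgroup a -> (0 < N)%N ->
  (forall x, a x -> N%:R * re x \is a Num.int /\ N%:R * im x \is a Num.int) ->
  a q%:K -> q != 0 -> a x -> im x != 0 ->
  exists al be ga, [/\ 0 < al, 0 < ga & has_hnf a al be ga].
Proof.
move=> sa N0 aN aq q0 ax x0; have [a0 aB] := sa.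
have [||||al al0 alE] := @cyclic_rat_subgroup (fun q => a q%:K) N.
- split=> [|r s ar as_]; first by rewrite rmorph0.
  by rewrite rmorphB; apply: aB.
- exact: N0.
- by move=> r /aN[+ _]; rewrite reimK.
- by exists q.
have [||||ga ga0 gaE] := @cyclic_rat_subgroup (fun q => exists2 x, a x & im x = q) N.
- split=> [|_ _ [y ay <-] [z az <-]]; first by exists 0 => //; rewrite reim0.
  by exists (y - z); [apply: aB | rewrite !reimE].
- exact: N0.
- by move=> _ [y /aN[_ +] <-].
- by exists (im x) => //; exists x.
have [y ay yga] : exists2 y, a y & im y = ga by apply/gaE; exists 1; rewrite mul1r.
exists al, (re y), ga; split=> // z; split=> [az|[i [j ->]]]; last first.
  have -> : (i%:~R * al + j%:~R * re y)%:K + (j%:~R * ga)%:K * w =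
    (i%:~R * al)%:K + j%:~R * y.
    by apply: coord_ext; rewrite !reimE yga; ring.
  by apply: subgroupD => //; [apply/alE; exists i | apply: subgroupMz].
have [j ej] : exists j : int, im z = j%:~R * ga by apply/gaE; exists z.
have : a (re z - j%:~R * re y)%:K.
  have -> : (re z - j%:~R * re y)%:K = z - j%:~R * y.
    by apply: coord_ext; rewrite !reimE yga ?ej; ring.
  by apply: aB => //; apply: subgroupMz.
move=> /alE[i ei]; exists i, j; rewrite -ei subrK -ej; exact: ib_coord.
Qed.

(* [c] is the content of the norm form on [a] and [th = w1 * w2 / c] has the trace and
   norm of a root of the primitive form; by maximality it lies in [Z + Z w], which gives
   [m], and [O m = Z + Z th]. *)
Lemma hnf_inv_norm a al be ga : 0 < al -> 0 < ga -> has_hnf a al be ga ->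
  exists m c, inv_norm m c a /\ c * m%:R = al * ga.
Proof.
move=> al0 ga0 aE.
pose w1 := al%:K; pose w2 := be%:K + ga%:K * w.
have aw x : a x <-> exists i j : int, x = i%:~R * w1 + j%:~R * w2.
  have e i j : (i%:~R * al + j%:~R * be)%:K + (j%:~R * ga)%:K * w =
      i%:~R * w1 + j%:~R * w2 by rewrite /w1 /w2; ring.
  by split=> [/aE[i [j ->]]|[i [j ->]]]; [exists i, j | apply/aE; exists i, j].
(* The norm form of the lattice: [nm (i * w1 + j * w2) = n1 * i^2 + n3 * i * j + n2 * j^2]. *)
pose n1 := nm w1; pose n2 := nm w2; pose n3 := al * (2 * be + ga * t%:~R).
have n1E : n1 = al * al by rewrite /n1 nm_alg.
have n10 : n1 != 0 by rewrite n1E mulf_neq0 ?lt0r_neq0.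
have [c c0 [[A eA] [C eC] [D eD] [i1 [i2 [i3 ei]]]]] := @rat_gcd3 n1 n2 n3 n10.
have cn0 : c != 0 by rewrite lt0r_neq0.
have [r er [m' em']] : exists2 r : int, al * be / c = r%:~R &
    exists m : int, al * ga / c = m%:~R.
  have [||/intrP[r er] /intrP[m em]] :=
    @ib_maximal _ B (al * be / c) (al * ga / c).
  - rewrite (_ : _ + _ = D%:~R) ?intr_int //.
    by apply: (mulIf cn0); rewrite -eD /n3; field.
  - rewrite (_ : _ + _ = (A * C)%:~R) ?intr_int //.
    apply: (mulIf (mulf_neq0 cn0 cn0)).
    have -> : (A * C)%:~R * (c * c) = n1 * n2 by rewrite eA eC; ring.
    by rewrite n1E /n2 /nm !reimE; field.
  by exists r => //; exists m.
have m'0 : 0 < m' by rewrite -(ltr0z rat) -em' !(mulr_gt0, invr_gt0).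
case: m' em' m'0 => // m em m0.
have emn : al * ga = c * m%:R by rewrite pmulrn -em; field.
pose th := r%:~R + m%:R * w.
have n1K : w1 * w1 = n1%:K by rewrite -algM n1E.
have cth : w1 * w2 = c%:K * th.
  apply: coord_ext; rewrite !reimE.
    by rewrite -er; field.
  by ring: emn.
have cjw1 : conjk w1 = w1 by exact: conj_alg.
have th2 : conjk th = D%:~R - th.
  rewrite /th conjD conjM conjw (conjz r) (conjz m).
  have -> : D = 2 * r + m%:Z * t.
    apply: (@intr_inj rat); apply: (mulIf cn0); rewrite -eD /n3.
    rewrite intrD !intrM -er -em; field.
    by [].
  by ring.
have cu : c%:K \is a GRing.unit by rewrite rmorph_unit ?unitfE.
have thw1 : th * w1 = A%:~R * w2.
  apply: (can_inj (mulKr cu)); rewrite mulrA -cth mulrAC n1K eA algM algz; ring.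
have thw2 : th * w2 = D%:~R * w2 - C%:~R * w1.
  apply: (can_inj (mulKr cu)); rewrite mulrA -cth.
  have -> : w1 * w2 * w2 = n3%:K * w2 - n2%:K * w1.
    by apply: coord_ext; rewrite /n3 /n2 /nm !reimE; ring.
  by rewrite eD eC !algM !algz; ring.
have Oth x : O m x <-> exists i j : int, x = i%:~R + j%:~R * th.
  rewrite ordP /th; split=> -[i [j ->]].
    by exists (i - j * r), j; ring.
  by exists (i + j * r), j; ring.
have sa : is_subgroup a.
  split; first by apply/aw; exists 0, 0; ring.
  move=> x y /aw[i [j ->]] /aw[i' [j' ->]]; apply/aw.
  by exists (i - i'), (j - j'); ring.
have Oa : O m ** a = a.
  apply/seteqP; split=> [|x ax]; last first.
    by rewrite -[x]mul1r; apply: mem_zmod_mul => //; apply: ord1.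
  apply: zmod_mul_sub => // _ _ /Oth[i [j ->]] /aw[i' [j' ->]]; apply/aw.
  exists (i * i' - j * j' * C), (i * j' + j * i' * A + j * j' * D).
  transitivity (i%:~R * (i'%:~R * w1 + j'%:~R * w2) +
      j%:~R * (i'%:~R * (th * w1) + j'%:~R * (th * w2))); first by ring.
  by rewrite thw1 thw2; ring.
have m0n : (0 < m)%N by [].
have aw1 : a w1 by apply/aw; exists 1, 0; ring.
have aw2 : a w2 by apply/aw; exists 0, 1; ring.
have w2w1 : w2 * conjk w1 = c%:K * th by rewrite cjw1 mulrC.
have w1w2 : w1 * conjk w2 = c%:K * (D%:~R - th).
  by rewrite -th2 -(conj_alg c) -conjM -w2w1 conjM conjK mulrC.
have w1w1 : w1 * conjk w1 = c%:K * A%:~R by rewrite mul_conj -/n1 eA algM algz mulrC.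
have w2w2 : w2 * conjk w2 = c%:K * C%:~R by rewrite mul_conj -/n2 eC algM algz mulrC.
exists m, c; split=> //; split=> //.
apply/seteqP; split.
  apply: zmod_mul_sub => [|x y /aw[i [j ->]] [y' /aw[i' [j' ->]] <-]].
    exact: subgroup_scale.
  exists ((i * i' * A + j * j' * C + i * j' * D)%:~R + (j * i' - i * j')%:~R * th).
    by apply/Oth; do 2!eexists.
  rewrite conjD !conjM !conjz.
  transitivity ((i * i')%:~R * (w1 * conjk w1) + (j * j')%:~R * (w2 * conjk w2) +
      (i * j')%:~R * (w1 * conjk w2) + (j * i')%:~R * (w2 * conjk w1)); last by ring.
  by rewrite w1w1 w1w2 w2w1 w2w2; ring.
have saa : is_subgroup (a ** cj a) by apply: subgroup_zmod_mul.
(* The Bezout relation for the content becomes a combination of the norms of [w1] and [w2] and of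
   the trace of [w1 * conjk w2]. *)
have caa : (a ** cj a) c%:K.
  have -> : c%:K = i1%:~R * (w1 * conjk w1) + i2%:~R * (w2 * conjk w2)
      + i3%:~R * (w1 * conjk w2 + w2 * conjk w1).
    have eK : c%:K = (i1 * A + i2 * C + i3 * D)%:~R * c%:K.
      by rewrite -algz -algM; congr (_%:K); rewrite {1}ei eA eC eD; ring.
    by rewrite {1}eK w1w1 w2w2 w1w2 w2w1; ring.
  do !apply: subgroupD => //; apply: subgroupMz => //.
  - by apply: mem_zmod_mul => //; exists w1.
  - by apply: mem_zmod_mul => //; exists w2.
  - by apply: subgroupD => //; apply: mem_zmod_mul => //; [exists w2 | exists w1].
move=> _ [_ /Oth[i [j ->]] <-].
rewrite mulrDr mulrC [_ * (j%:~R * th)]mulrCA -w2w1.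
apply: subgroupD => //; apply: subgroupMz => //.
by apply: mem_zmod_mul => //; exists w1.
Qed.

Lemma common_denominator_k (s : seq k) : exists2 N : nat, (0 < N)%N &
  forall x, x \in s -> O 1 (N%:R * x).
Proof.
have [N N0 NP] := common_denominator ([seq re x | x <- s] ++ [seq im x | x <- s]).
exists N => // x xs; apply/ordP.
have /intrP[i ei] : N%:R * re x \is a Num.int.
  by apply: NP; rewrite mem_cat map_f.
have /intrP[j ej] : N%:R * im x \is a Num.int.
  by apply: NP; rewrite mem_cat (map_f im) ?orbT.
exists i, j; rewrite mulr1 -!algz -ei -ej.
by apply: coord_ext; rewrite !reimE; ring.
Qed.

Lemma reim_ord1 x : O 1 x -> re x \is a Num.int /\ im x \is a Num.int.
Proof.
move=> /ordP[i [j ->]]; rewrite !reimE.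
by split; rewrite !(mul0r, mulr0, mulr1, subr0, addr0, add0r) intr_int.
Qed.

(** [inv_norm] does not mention finite generation. But [c] is a finite sum of products [p.1 * p.2],
    so [y] is the sum of the [p.1 * (p.2 * y / c)], where [p.2 * y / c] lies in [O m]; only the
    finitely many [p.1] need a denominator. *)
Lemma inv_norm_denominator m c a : inv_norm m c a ->
  exists2 N : nat, (0 < N)%N & forall x, a x -> O 1 (N%:R * x).
Proof.
move=> [m0 c0 sa Oa ea].
have [s [sP sE]] : (a ** cj a) c%:K.
  by rewrite ea; exists 1; rewrite ?mulr1 //; apply: ord1.
have cu : c%:K \is a GRing.unit by rewrite rmorph_unit ?unitfE ?lt0r_neq0.
have [d cd] : exists d, c%:K * d%:K = 1.
  by exists c^-1; rewrite -algM divff ?lt0r_neq0 ?alg1.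
have [N N0 NP] := common_denominator_k [seq p.1 | p <- s].
exists N => // y ay; have -> : N%:R * y = \sum_(p <- s) N%:R * p.1 * (d%:K * (p.2 * y)).
  apply: (can_inj (mulKr cu)); rewrite mulrCA {1}sE mulr_suml !mulr_sumr.
  by apply: eq_bigr => p _; ring: cd.
rewrite big_seq; apply: subgroup_sum => // p ps; have [a1 a2] := sP _ ps.
apply: ordM; first by apply: NP; apply: map_f.
have : (cj a ** a) (p.2 * y) by apply: mem_zmod_mul.
rewrite zmod_mulC ea => -[z Oz <-]; rewrite mulrA [d%:K * _]mulrC cd mul1r.
by apply: ord_sub Oz; apply: dvd1n.
Qed.

Lemma inv_norm_hnf m c a : inv_norm m c a -> exists al be ga,
  [/\ 0 < al, 0 < ga, has_hnf a al be ga & al * ga = c * m%:R].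
Proof.
move=> na; have [m0 c0 sa Oa ea] := na.
have [N N0 NP] := inv_norm_denominator na.
have [N' N'0 NP'] := inv_norm_denominator (inv_norm_cj na).
(* [c * x] is a sum of products from [a] and [cj a]; [N'] makes the factors from [cj a] integral,
   and [m] carries [O 1] into [O m], which acts on [a]. *)
have sub x : O m x -> a ((m * N')%:R * c%:K * x).
  move=> Ox; have : (a ** cj a) (c%:K * x) by rewrite ea; exists x.
  rewrite natrM -[_ * c%:K * x]mulrA => -[s [sP ->]]; rewrite mulr_sumr big_seq.
  apply: subgroup_sum => // p ps; have [a1 /NP' a2] := sP _ ps.
  have -> : m%:R * N'%:R * (p.1 * p.2) = m%:R * (N'%:R * p.2) * p.1 by ring.
  apply: inv_norm_memM na _ a1.
  case/ordP: a2 => i [j ->]; apply/ordP.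
  by exists (m%:Z * i), j; ring.
have [|||||al [be [ga [al0 ga0 aE]]]] := @exists_hnf a N ((m * N')%:R * c) ((m * N')%:R * c%:K * (m%:R * w)) sa N0.
- by move=> x /NP /reim_ord1; rewrite !reimE !(mul0r, mulr0, addr0, subr0).
- by rewrite algM algn -[X in a X]mulr1; apply: sub; apply: ord1.
- by rewrite mulf_neq0 ?lt0r_neq0 // ltr0n muln_gt0 m0.
- by apply: sub; apply: ordw.
- by rewrite !reimE !(mul0r, mulr0, addr0, subr0, add0r, mulr1) !mulf_neq0 ?lt0r_neq0 // ltr0n ?muln_gt0 ?m0.
have [m1 [c1 [na1 e]]] := hnf_inv_norm al0 ga0 aE.
have [em ec] := inv_norm_uniq na na1.
by exists al, be, ga; split=> //; rewrite em ec.
Qed.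

Lemma sum_ord2 (s : 2.-tuple k) (f : 'I_2 -> int) :
  \sum_(i < 2) s`_i *~ f i = (f ord0)%:~R * s`_0 + (f ord_max)%:~R * s`_1.
Proof.
rewrite big_ord_recr big_ord1 !mulrzl /=.
by rewrite (_ : widen_ord _ _ = ord0) //; apply: val_inj.
Qed.

Lemma hnf_zmod_fg a al be ga : has_hnf a al be ga -> zmod_fg a.
Proof.
move=> aE; exists 2%N, [tuple al%:K; be%:K + ga%:K * w]; apply/seteqP.
have e (f : 'I_2 -> int) : \sum_(i < 2) [tuple al%:K; be%:K + ga%:K * w]`_i *~ f i =
    ((f ord0)%:~R * al + (f ord_max)%:~R * be)%:K + ((f ord_max)%:~R * ga)%:K * w.
  by rewrite sum_ord2 -[_`_0]/(al%:K) -[_`_1]/(be%:K + ga%:K * w); ring.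
split=> x.
  move=> /aE[i [j ->]]; exists [ffun z => if z == ord0 then i else j].
  by rewrite e !ffunE.
by move=> [f ->]; rewrite e; apply/aE; do 2!eexists.
Qed.

Lemma sum_ord3 (s : 3.-tuple k) (f : 'I_3 -> int) :
  \sum_(i < 3) s`_i *~ f i =
  (f ord0)%:~R * s`_0 + (f (inord 1))%:~R * s`_1 + (f ord_max)%:~R * s`_2.
Proof.
rewrite 2!big_ord_recr big_ord1 !mulrzl /=.
congr (_ *~ (f _) + _ *~ (f _) + _); apply: val_inj => //=.
by rewrite inordK.
Qed.

Lemma hnf_zmod_rank a al be ga : 0 < al -> 0 < ga -> has_hnf a al be ga ->
  zmod_rank a 2.
Proof.
move=> al0 ga0 aE; split.
  exists [tuple al%:K; be%:K + ga%:K * w]; split.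
    move=> x; rewrite !inE => /orP[] /eqP ->; apply/aE.
      by exists 1, 0; ring.
    by exists 0, 1; ring.
  move=> f; rewrite sum_ord2 -[_`_0]/(al%:K) -[_`_1]/(be%:K + ga%:K * w) => e i.
  have := congr1 im e; rewrite !reimE => e1.
  have f1 : f ord_max = 0.
    apply: (@intr_inj rat); apply: (mulIf (lt0r_neq0 ga0)).
    by rewrite mul0r -e1; ring.
  have := congr1 re e; rewrite !reimE f1 => e0.
  have f0 : f ord0 = 0.
    apply: (@intr_inj rat); apply: (mulIf (lt0r_neq0 al0)).
    by rewrite mul0r -e0; ring.
  case: i => -[|[|//]] Hi.
    by rewrite (_ : Ordinal Hi = ord0) //; apply: val_inj.
  by rewrite (_ : Ordinal Hi = ord_max) //; apply: val_inj.
move=> s sa sfree.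
have /aE[x1 [y1 e1]] : a s`_0 by apply: sa; rewrite mem_nth // size_tuple.
have /aE[x2 [y2 e2]] : a s`_1 by apply: sa; rewrite mem_nth // size_tuple.
have /aE[x3 [y3 e3]] : a s`_2 by apply: sa; rewrite mem_nth // size_tuple.
have [c1 [c2 [c3 [c0 ex ey]]]] := int_dependent3 x1 y1 x2 y2 x3 y3.
pose f (i : 'I_3) : int := nth 0 [:: c1; c2; c3] i.
have f1 : f (inord 1) = c2 by rewrite /f inordK.
case: c0; have := sfree f; rewrite sum_ord3 f1 /f /= => H.
have {}H := H _; split.
- apply: (H _ ord0).
  rewrite e1 e2 e3.
  transitivity ((c1 * x1 + c2 * x2 + c3 * x3)%:~R * al%:K +
     (c1 * y1 + c2 * y2 + c3 * y3)%:~R * (be%:K + ga%:K * w)); first by ring.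
  by rewrite ex ey; ring.
- rewrite -f1; apply: H.
  rewrite e1 e2 e3.
  transitivity ((c1 * x1 + c2 * x2 + c3 * x3)%:~R * al%:K +
     (c1 * y1 + c2 * y2 + c3 * y3)%:~R * (be%:K + ga%:K * w)); first by ring.
  by rewrite ex ey; ring.
- apply: (H _ ord_max).
  rewrite e1 e2 e3.
  transitivity ((c1 * x1 + c2 * x2 + c3 * x3)%:~R * al%:K +
     (c1 * y1 + c2 * y2 + c3 * y3)%:~R * (be%:K + ga%:K * w)); first by ring.
  by rewrite ex ey; ring.
Qed.

Lemma zmod_fg_subgroup a : zmod_fg a -> is_subgroup a.
Proof.
move=> [n [s ->]]; split.
  by exists [ffun=> 0]; rewrite big1 // => i _; rewrite ffunE.
move=> _ _ [f ->] [g ->]; exists [ffun i => f i - g i]; rewrite -sumrB.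
by apply: eq_bigr => i _; rewrite ffunE mulrzBr.
Qed.

Lemma zmod_fg_denominator a : zmod_fg a ->
  exists2 N : nat, (0 < N)%N & forall x, a x -> O 1 (N%:R * x).
Proof.
move=> [n [s ->]]; have [N N0 NP] := common_denominator_k s.
exists N => // _ [f ->]; rewrite mulr_sumr; apply: subgroup_sum => // i _.
rewrite -mulrzl mulrCA; apply: subgroupMz => //.
by apply: NP; rewrite mem_nth // size_tuple.
Qed.

Lemma zmod_hnf a : zmod_fg a -> zmod_rank a 2 -> exists al be ga,
  [/\ 0 < al, 0 < ga & has_hnf a al be ga].
Proof.
move=> fga [[s [sP sfree]] _].
have sa := zmod_fg_subgroup fga; have [N N0 NP] := zmod_fg_denominator fga.
have aN x : a x -> N%:R * re x \is a Num.int /\ N%:R * im x \is a Num.int.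
  by move=> /NP /reim_ord1; rewrite !reimE !(mul0r, mulr0, addr0, subr0).
have ax : a s`_0 by apply: sP; rewrite mem_nth // size_tuple.
have ay : a s`_1 by apply: sP; rewrite mem_nth // size_tuple.
set x := s`_0 in ax; set y := s`_1 in ay.
have free (i j : int) : i%:~R * x + j%:~R * y = 0 -> i = 0 /\ j = 0.
  pose f (l : 'I_2) := if l == ord0 then i else j.
  by have := sfree f; rewrite sum_ord2 /f /= => H /H {}H; split; [apply: (H ord0) | apply: (H ord_max)].
have Nn0 : (N%:R : rat) != 0 by rewrite pnatr_eq0 -lt0n.
have [i1 ei1] := intrP (aN _ ax).2; have [i2 ei2] := intrP (aN _ ay).2.
have [r1 er1] := intrP (aN _ ax).1; have [r2 er2] := intrP (aN _ ay).1.
have im0 (i : int) v : N%:R * im v = i%:~R -> i = 0 -> im v = 0.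
  by move=> e i0; apply: (mulfI Nn0); rewrite e i0 mulr0.
have n12 : ~ (i1 = 0 /\ i2 = 0).
  move=> [/(im0 _ _ ei1) x0 /(im0 _ _ ei2) y0].
  have [|r20 r10] := free r2 (- r1).
    by apply: coord_ext; rewrite !reimE x0 y0 ?mulrNz -?er1 -?er2; ring.
  have [|//] := free 1 0.
  apply: coord_ext; rewrite !reimE ?x0 ?y0; last by ring.
  suff -> : re x = 0 by ring.
  by apply: (mulfI Nn0); rewrite er1 mulr0; apply/eqP; rewrite intr_eq0 -oppr_eq0 r10.
have [z az z0] : exists2 z, a z & im z != 0.
  have [x0|x0] := eqVneq (im x) 0; last by exists x.
  have [y0|y0] := eqVneq (im y) 0; last by exists y.
  by case: n12; split; apply: (@intr_inj rat); rewrite -?ei1 -?ei2 ?x0 ?y0 mulr0.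
(* Eliminates the [w]-coordinates, [i1] and [i2] being their numerators over [N], to obtain a
   rational element of [a]. *)
pose q : rat := i2%:~R * re x - i1%:~R * re y.
have qE : q%:K = i2%:~R * x - i1%:~R * y.
  by apply: coord_ext; rewrite !reimE /q -?ei1 -?ei2; ring.
apply: (@exists_hnf a N q z) => //.
  by rewrite qE; apply: sa.2; apply: subgroupMz.
apply/eqP => q0; have [|i20 i10] := free i2 (- i1).
  by rewrite mulrNz mulNr -qE q0 rmorph0.
by apply: n12; split=> //; apply/eqP; rewrite -oppr_eq0 i10.
Qed.

(** A lattice of rank two is always invertible over the order [O m1] found from its norm form. If it
    is also invertible over [O m], each order acts on the other through one of the two inverses, so
    [m = m1]. *)
Lemma invertible_idealP m a : (0 < m)%N ->
  invertible_ideal m a <-> exists c, inv_norm m c a.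
Proof.
move=> m0; split=> [[[fga ra Oa] [b [_ _ Ob] ab]]|[c na]]; last first.
  have frac m' c' a' : inv_norm m' c' a' -> fractional_ideal m' a'.
    move=> na'; have [al [be [ga [al0 ga0 aE _]]]] := inv_norm_hnf na'.
    by have [_ _ _ ? _] := na'; split=> //; [exact: hnf_zmod_fg aE | exact: hnf_zmod_rank aE].
  split; first exact: frac na.
  exists (inv_ideal c a); first exact: frac (inv_normV na).
  exact: mul_inv_ideal na.
have [al [be [ga [al0 ga0 aE]]]] := zmod_hnf fga ra.
have [m1 [c [na _]]] := hnf_inv_norm al0 ga0 aE.
exists c; suff -> : m = m1 by [].
have [_ _ _ O1 _] := na.
have H n n' : O n ** O n' = O n' -> (n' %| n)%N.
  move=> e; apply: ord_subP; rewrite -e => x Ox.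
  by rewrite -[x]mulr1; apply: mem_zmod_mul => //; apply: ord1.
apply/eqP; rewrite eqn_dvd; apply/andP; split; apply: H.
  by rewrite -ab zmod_mulA O1.
by rewrite -(mul_inv_ideal na) zmod_mulA Oa.
Qed.

(* The cosets of [a] in [O m] are represented by [x + y * (m * w)], [x < A], [y < C],
   when [A], [B + C * (m * w)] is a basis of [a]. *)
Lemma zmod_index_inv_norm m c a (n : nat) : inv_norm m c a -> a `<=` O m ->
  zmod_index (O m) a n <-> c = n%:R.
Proof.
move=> na aO; have [m0 c0 sa _ _] := na.
have [al [be [ga [al0 ga0 aE acm]]]] := inv_norm_hnf na.
have mq0 : (m%:R : rat) != 0 by rewrite pnatr_eq0 -lt0n.
have /ordP[i0 [j0]] : O m al%:K.
  by apply/aO/aE; exists 1, 0; ring.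
move=> /(congr1 re); rewrite !reimE !(mul0r, mulr0, subr0, addr0) => ali.
have /ordP[ib [jb e]] : O m (be%:K + ga%:K * w).
  by apply/aO/aE; exists 0, 1; ring.
have := congr1 re e; rewrite !reimE !(mul0r, mulr0, subr0, addr0) => bei.
have := congr1 im e; rewrite !reimE !(mul0r, mulr0, subr0, addr0, add0r, mulr1) => gai.
have {}i00 : 0 < i0 by rewrite -(ltr0z rat) -ali.
have {}jb0 : 0 < jb.
  by move: ga0; rewrite gai intrM pmulr_lgt0 ?ltr0z // -pmulrn ltr0n.
case: i0 i00 ali => // A A0 alA; case: jb jb0 gai {e} => // C C0 gaC.
pose th := m%:R * w : k.
have aP x : a x <-> exists i j : int, x = (i * A%:Z + j * ib)%:~R + (j * C%:Z)%:~R * th.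
  rewrite aE alA bei gaC /th; split=> -[i [j ->]]; exists i, j;
    apply: coord_ext; rewrite !reimE; ring.
have OP x : O m x <-> exists i j : int, x = i%:~R + j%:~R * th.
  rewrite ordP /th; split=> -[i [j ->]]; exists i, j; ring.
have thI (i j i' j' : int) : i%:~R + j%:~R * th = i'%:~R + j'%:~R * th ->
    i = i' /\ j = j'.
  move=> E; have := congr1 re E; have := congr1 im E.
  rewrite /th !reimE !(mul0r, mulr0, subr0, addr0, add0r, mulr1).
  by move=> /(mulIf mq0) /intr_inj -> /intr_inj ->.
have cAC : c = (A * C)%:R.
  apply: (mulIf mq0); rewrite -acm alA gaC natrM; ring.
pose coset x := [set x + y | y in a].
have cosetP x y : coset x = coset y <-> a (x - y).
  split=> [E|axy].
    have : coset x x by exists 0; [exact: sa.1 | rewrite addr0].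
    by rewrite E => -[z az <-]; rewrite addrC addKr.
  apply/seteqP; split=> _ [z az <-].
    by exists (x - y + z); [apply: subgroupD | ring].
  by exists (z - (x - y)); [apply: sa.2 | ring].
pose rep (i j : nat) : k := (i%:Z)%:~R + (j%:Z)%:~R * th.
have rep_inj i j i' j' : (i < A)%N -> (i' < A)%N -> (j < C)%N -> (j' < C)%N ->
    coset (rep i j) = coset (rep i' j') -> i = i' /\ j = j'.
  move=> Hi Hi' Hj Hj' /cosetP /aP [x [y E]].
  have [|e1 e2] := thI (i%:Z - i'%:Z) (j%:Z - j'%:Z) (x * A%:Z + y * ib) (y * C%:Z).
    by rewrite -E /rep; ring.
  have y0 : y = 0 by nia.
  have x0 : x = 0 by nia.
  by move: e1 e2; rewrite y0 x0; lia.
have rep_surj x : O m x -> exists i j, [/\ (i < A)%N, (j < C)%N & coset (rep i j) = coset x].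
  move=> /OP[i [j ->]].
  have C1 : C%:Z != 0 by lia.
  have A1 : A%:Z != 0 by lia.
  pose j1 := (j %% C%:Z)%Z; pose q := (j %/ C%:Z)%Z.
  pose i1 := ((i - q * ib) %% A%:Z)%Z; pose p := ((i - q * ib) %/ A%:Z)%Z.
  have j1P : 0 <= j1 < C%:Z by rewrite modz_ge0 // ltz_mod.
  have i1P : 0 <= i1 < A%:Z by rewrite modz_ge0 // ltz_mod.
  exists `|i1|%N, `|j1|%N; split; [lia | lia |].
  apply/cosetP/aP; exists (- p), (- q).
  rewrite /rep !gez0_abs; [|lia|lia].
  have ej : j = q * C%:Z + j1 by exact: divz_eq.
  have ei : i = q * ib + p * A%:Z + i1.
    by have := divz_eq (i - q * ib) A%:Z; rewrite -/p -/i1; lia.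
  by rewrite ei ej; ring.
pose f (l : nat) := coset (rep (l %% A)%N (l %/ A)%N).
have cosets : [set coset x | x in O m] = f @` `I_(A * C).
  apply/seteqP; split=> [_ [x /rep_surj[i [j [Hi Hj <-]]] <-]|_ [l lAC <-]].
    exists (j * A + i)%N; first by rewrite /=; nia.
    by rewrite /f modnMDl modn_small // divnMDl ?divn_small ?addn0 //; lia.
  by exists (rep (l %% A)%N (l %/ A)%N) => //; apply/OP; do 2!eexists.
rewrite /zmod_index cosets (card_eql (inj_card_eq _)); last first.
  move=> l l'; rewrite !inE /= => lAC l'AC /rep_inj[]; rewrite ?ltn_mod ?ltn_divLR //; try lia.
split=> [/card_eq_II e|]; first by rewrite cAC e.
rewrite cAC => /eqP; rewrite eqr_nat => /eqP ->.
by apply/card_eq_II.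
Qed.

Lemma LidealsP m n a : (0 < m)%N ->
  Lideals m n a <-> inv_norm m n%:R a /\ a `<=` O m.
Proof.
move=> m0; split=> [[/(invertible_idealP _ m0)[c na] aO]|[na aO]].
  by move=> /(zmod_index_inv_norm _ na aO) <-.
split=> //; first by apply/invertible_idealP => //; exists n%:R.
by apply/(zmod_index_inv_norm _ na aO).
Qed.

Lemma Lideals_gt0 m n a : (0 < m)%N -> Lideals m n a -> (0 < n)%N.
Proof. by move=> m0 /(LidealsP _ _ m0)[[_]]; rewrite ltr0n. Qed.

(** An ideal of norm [n] contains [n O_m], so it is determined by its residues modulo [n O_m], a
    subset of a finite set. *)
Lemma finite_Lideals m n : (0 < m)%N -> finite_set (Lideals m n : set (set k)).
Proof.
move=> m0; pose f a : {set 'I_n * 'I_n} :=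
  
    finset (fun ij : 'I_n * 'I_n =>
      `[< a ((ij.1%:Z)%:~R + (ij.2%:Z)%:~R * (m%:R * w)) >]).
have sub a : Lideals m n a -> forall i j : int, a (n%:R * (i%:~R + j%:~R * (m%:R * w))).
  move=> /(LidealsP _ _ m0)[na aO] i j; apply: (inv_norm_sub na aO).
  exists (i%:~R + j%:~R * (m%:R * w)); rewrite ?algn //.
  by apply/ordP; exists i, j; ring.
have H a b : Lideals m n a -> Lideals m n b -> f a = f b -> a `<=` b.
  move=> La Lb e x ax; have n0 := Lideals_gt0 m0 La.
  have [na aO] := (LidealsP _ _ m0).1 La; have [nb bO] := (LidealsP _ _ m0).1 Lb.
  have [_ _ sa _ _] := na; have [_ _ sb _ _] := nb.
  have /ordP[i [j ex]] := aO _ ax.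
  pose i1 := (i %% n%:Z)%Z; pose j1 := (j %% n%:Z)%Z.
  have i1P : 0 <= i1 < n%:Z by rewrite modz_ge0 ?ltz_mod //; lia.
  have j1P : 0 <= j1 < n%:Z by rewrite modz_ge0 ?ltz_mod //; lia.
  have Hi : (`|i1| < n)%N by lia.
  have Hj : (`|j1| < n)%N by lia.
  pose q := n%:R * ((i %/ n%:Z)%Z%:~R + (j %/ n%:Z)%Z%:~R * (m%:R * w)).
  have ex' : x - q = (`|i1|%N%:Z)%:~R + (`|j1|%N%:Z)%:~R * (m%:R * w).
    rewrite !gez0_abs; [|lia|lia].
    by rewrite ex /q {1}(divz_eq i n%:Z) {1}(divz_eq j n%:Z) -/i1 -/j1; ring.
  have : (Ordinal Hi, Ordinal Hj) \in f a.
    by rewrite finset.in_set; apply/asboolP; rewrite -ex'; apply: sa.2 => //; apply: sub.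
  rewrite e finset.in_set => /asboolP /=; rewrite -ex' => bx.
  by rewrite -[x](subrK q); apply: subgroupD => //; apply: sub.
have finj : {in Lideals m n &, injective f}.
  move=> a b; rewrite !inE => La Lb e.
  by apply/seteqP; split; apply: H.
have := inj_card_eq finj; move=> /card_esym /eq_finite_set ->.
exact: finite_finset.
Qed.

(** * Changing the conductor by a factor prime to the norm *)

(** Bezout; this is the substitute for localisation. *)
Lemma subgroup_coprime a x (i j : int) : is_subgroup a -> coprimez i j ->
  a (i%:~R * x) -> a (j%:~R * x) -> a x.
Proof.
move=> sa /coprimezP[[e f] /= E] ai aj.
have -> : x = e%:~R * (i%:~R * x) + f%:~R * (j%:~R * x).
  by transitivity ((e * i + f * j)%:~R * x); [rewrite E; ring | ring].
by apply: subgroupD => //; apply: subgroupMz.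
Qed.

Lemma subgroup_coprimen a x (i j : nat) : is_subgroup a -> coprime i j ->
  a (i%:R * x) -> a (j%:R * x) -> a x.
Proof. by move=> sa co ai aj; apply: (@subgroup_coprime _ _ i j). Qed.

Lemma mem_ordM m p x : O m x -> O (m * p)%N (p%:R * x).
Proof.
move=> /ordP[i [j ->]]; apply/ordP; exists (p%:Z * i), j.
by rewrite PoszM; ring.
Qed.

Lemma ordMP m p x : O (m * p)%N x <-> exists r : int, exists2 y, O m y & x = r%:~R + p%:R * y.
Proof.
split=> [/ordP[i [j ->]]|[r [y Oy ->]]].
  exists i, (0%:~R + (j * m%:Z)%:~R * w); first by apply/ordP; exists 0, j.
  by rewrite PoszM; ring.
by apply: subgroupD => //; [exact: ord_int | apply: mem_ordM].
Qed.

Lemma nm_congr m (p : nat) r y : O m y ->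
  exists j : int, nm (r%:~R + p%:R * y) = (r * r + p%:Z * j)%:~R.
Proof.
move=> /ordP[i [l ->]]; exists (2 * r * i + t * r * l * m%:Z +
  p%:Z * (i * i + t * i * l * m%:Z + u * l * l * m%:Z * m%:Z)).
by rewrite /nm !reimE; ring.
Qed.

(** The norm of the element is congruent to [r * r] modulo [p] and is a multiple of [n]. This is
    what forces ideals of [O (m * p)] with norm divisible by [p] into [p O_m]. *)
Lemma inv_norm_dvd_nm m m' n p a r y : inv_norm m n%:R a -> (p %| n)%N -> prime p ->
  O m' y -> a (r%:~R + p%:R * y) -> (p %| r)%Z.
Proof.
move=> na pn pp Oy ax; have [ i] := inv_norm_mem_nm na ax; have [j ->] := nm_congr p r Oy.
rewrite pmulrn -intrM => /intr_inj e.
have : (p%:Z %| r * r)%Z.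
  have -> : r * r = i * n%:Z - p%:Z * j by rewrite -e; ring.
  by apply: rpredB; [apply: dvdz_mull | apply: dvdz_mulr].
by rewrite !dvdzE abszM Euclid_dvdM // orbb.
Qed.

(** The inverse map is [b -> b] intersected with [O (m * p)]. Multiplication by [p] carries [O m]
    into [O (m * p)], multiplication by [n] carries the order into the ideal, and coprimality
    combines the two. *)
Lemma Lideals_coprime_bij m (p n : nat) : (0 < m)%N -> (0 < p)%N -> coprime p n ->
  set_bij (Lideals (m * p) n) (Lideals m n) (fun a => a ** O m).
Proof.
move=> m0 p0 co; have mp0 : (0 < m * p)%N by rewrite muln_gt0 m0.
have dm : (m %| m * p)%N by apply: dvdn_mulr.
have Oext : O (m * p) `<=` O m by apply: ord_sub.
have pO : scale p%:R (O m) `<=` O (m * p) by move=> _ [x Ox <-]; apply: mem_ordM.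
split.
- move=> a /(LidealsP _ _ mp0)[na aO]; apply/LidealsP => //.
  split; first exact: inv_norm_ext na.
  by rewrite -[X in _ `<=` X](ord_mul_self m); apply: zmod_mulS => // x /aO /Oext.
- suff H a : Lideals (m * p) n a -> (a ** O m) `&` O (m * p) = a.
    by move=> a a'; rewrite !inE => La La' e; rewrite -(H a) // -(H a') // e.
  move=> /(LidealsP _ _ mp0)[na aO]; have [_ _ sa Oa _] := na.
  apply/seteqP; split=> [x [ax Ox]|x ax]; last first.
    by split; [rewrite -[x]mulr1; apply: mem_zmod_mul => //; apply: ord1 | apply: aO].
  apply: (subgroup_coprimen sa co).
    have : (scale p%:R (a ** O m)) (p%:R * x) by exists x.
    by rewrite -zmod_mulZr => /(zmod_mulS (@subset_refl _ a) pO); rewrite zmod_mulC Oa.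
  rewrite mulrC; apply: (inv_norm_memM na) => //; exact: inv_norm_mem_int na aO.
- move=> b /(LidealsP _ _ m0)[nb bO]; have [_ _ sb Ob eb] := nb.
  pose a := b `&` O (m * p).
  have sa : is_subgroup a.
    split; first by split; [exact: sb.1 | exact: (subgroup_ord _).1].
    by move=> x y [bx Ox] [bY Oy]; split; [exact: sb.2 | exact: (subgroup_ord _).2].
  have Oa : O (m * p) ** a = a.
    apply/seteqP; split=> [|x ax]; last first.
      by rewrite -[x]mul1r; apply: mem_zmod_mul => //; apply: ord1.
    apply: zmod_mul_sub => // x y Ox [bY Oy]; split; last exact: ordM.
    by apply: (inv_norm_memM nb) => //; apply: Oext.
  have an : a n%:R.
    by split; [exact: inv_norm_mem_int nb bO | rewrite -[n%:R]/(n%:~R); exact: ord_int].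
  have aOb : a ** O m = b.
    apply/seteqP; split.
      by apply: zmod_mul_sub => // x y [bx _] Oy; rewrite mulrC; apply: (inv_norm_memM nb).
    have saO : is_subgroup (a ** O m) by apply: subgroup_zmod_mul.
    move=> x bx; apply: (subgroup_coprimen saO co).
      rewrite -[_ * x]mulr1; apply: mem_zmod_mul; last exact: ord1.
      by split; [apply: subgroupMn | apply: mem_ordM; apply: bO].
    by apply: mem_zmod_mul => //; apply: bO.
  have n0 : (0 : rat) < n%:R by have [] := nb.
  exists a => //; apply/LidealsP => //; split; last by move=> x [].
  split=> //; have saa : is_subgroup (a ** cj a) by apply: subgroup_zmod_mul.
  apply/seteqP; split.
    apply: zmod_mul_sub; first exact: subgroup_scale.
    move=> x _ [bx Ox] [y [bY Oy] <-].
    have : (b ** cj b) (x * conjk y) by apply: mem_zmod_mul => //; exists y.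
    rewrite eb algn => -[z Oz e]; exists z; rewrite ?algn //.
    apply: (subgroup_coprimen (subgroup_ord _) co); first exact: mem_ordM.
    by rewrite e; apply: ordM => //; apply: ordJ.
  (* The multiple by [p] comes from [b ** cj b], since [p O_m] lies in [O (m * p)]; the multiple by
     [n] from [n] lying in both [a] and [cj a]. *)
  have aan : (a ** cj a) n%:R.
    apply: (subgroup_coprimen saa co).
      have : (scale p%:R (b ** cj b)) (p%:R * n%:R).
        by exists n%:R => //; rewrite eb; exists 1; [exact: ord1 | rewrite mulr1 algn].
      rewrite -aOb cj_mul cj_ord zmod_mulACA ord_mul_self // -zmod_mulZr.
      move=> /(zmod_mulS (@subset_refl _ (a ** cj a)) pO).
      by rewrite zmod_mulC zmod_mulA Oa.
    apply: mem_zmod_mul => //; exists n%:R => //; exact: (conjz n).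
  move=> _ [x Ox <-]; rewrite algn mulrC.
  have : (O (m * p) ** (a ** cj a)) (x * n%:R) by apply: mem_zmod_mul.
  by rewrite zmod_mulA Oa.
Qed.


(** * Neighbours of an ideal at a prime *)

Lemma zmod_mulO m c a b : inv_norm m c a -> b `<=` O m -> a ** b `<=` a.
Proof.
move=> na bO; have [_ _ sa _ _] := na; apply: zmod_mul_sub => // x y ax /bO Oy.
by rewrite mulrC; apply: inv_norm_memM na _ _.
Qed.

Lemma sub_mul_ord m a : a `<=` a ** O m.
Proof.
by move=> x ax; rewrite -[x]mulr1; apply: mem_zmod_mul => //; apply: ord1.
Qed.

(* When [p] does not divide [nm x / c], with [c] the norm of the [O m]-ideal [b], this
   is an invertible [O (m * p)]-ideal, a neighbour of [b] in the tree of lattices at [p]. *)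
Definition neighbor (p : nat) x b : set k :=
  [set l%:~R * x + p%:R * y | l in [set: int] & y in b].

Lemma subgroup_neighbor p x b : is_subgroup b -> is_subgroup (neighbor p x b).
Proof.
move=> sb; split.
  by exists 0 => //; exists 0; [exact: sb.1 | ring].
move=> _ _ [l _ [y bY <-]] [l' _ [y' bY' <-]].
by exists (l - l') => //; exists (y - y'); [apply: sb.2 | ring].
Qed.

Lemma mem_neighbor p x b : is_subgroup b -> neighbor p x b x.
Proof. by move=> sb; exists 1 => //; exists 0; [exact: sb.1 | ring]. Qed.

Lemma mem_neighborM p x b y : b y -> neighbor p x b (p%:R * y).
Proof. by move=> bY; exists 0 => //; exists y => //; ring. Qed.

Lemma neighbor_sub p x b : is_subgroup b -> b x ->
  neighbor p x b `<=` b.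
Proof.
move=> sb bx _ [l _ [y bY <-]].
by apply: subgroupD => //; [apply: subgroupMz | apply: subgroupMn].
Qed.

(** In the product of [l * x + p * y] with a conjugate, only the term in [nm x] escapes the factor
    [p]. The bound is used both for [v] prime to [p] and for [v] divisible by [p]. *)
Lemma neighbor_mul_cj m c b x (p : nat) (v : int) : inv_norm m c b -> b x ->
  nm x = v%:~R * c -> neighbor p x b ** cj (neighbor p x b) `<=`
  [set c%:K * ((l * v)%:~R + p%:R * y) | l in [set: int] & y in O m].
Proof.
move=> nb bx xv; have [_ c0 sb Ob eb] := nb.
apply: zmod_mul_sub; first split.
- by exists 0 => //; exists 0; [exact: (subgroup_ord m).1 | ring].
- move=> _ _ [l _ [y Oy <-]] [l' _ [y' Oy' <-]].
  by exists (l - l') => //; exists (y - y'); [apply: (subgroup_ord m).2 | ring].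
move=> _ y' [l _ [y bY <-]] [_ [l' _ [z bz <-]] <-].
have e v1 v2 : b v1 -> b v2 -> exists2 o, O m o & v1 * conjk v2 = c%:K * o.
  move=> b1 b2; have : (b ** cj b) (v1 * conjk v2) by apply: mem_zmod_mul => //; exists v2.
  by rewrite eb => -[o Oo <-]; exists o.
have [o1 O1 e1] := e _ _ bx bz; have [o2 O2 e2] := e _ _ bY bx; have [o3 O3 e3] := e _ _ bY bz.
exists (l * l') => //; exists (l%:~R * o1 + l'%:~R * o2 + p%:R * o3).
  by do !apply: subgroupD => //; [apply: subgroupMz | apply: subgroupMz | apply: subgroupMn].
rewrite conjD !conjM !conjz -[p%:R]/(p%:Z%:~R) conjz.
transitivity ((l * l')%:~R * (x * conjk x) + p%:Z%:~R * (l%:~R * (x * conjk z) +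
  l'%:~R * (y * conjk x) + p%:Z%:~R * (y * conjk z))); last by ring.
by rewrite e1 e2 e3 mul_conj xv algM algz; ring.
Qed.

Lemma inv_norm_neighbor m c b x (p : nat) (v : int) : inv_norm m c b -> b x ->
  (0 < p)%N -> nm x = v%:~R * c -> coprimez v p ->
  inv_norm (m * p) c (neighbor p x b) /\ neighbor p x b ** O m = b.
Proof.
move=> nb bx p0 xv co; have [m0 c0 sb Ob eb] := nb.
have sa := @subgroup_neighbor p x _ sb.
set a := neighbor p x b in sa *.
have cu : c%:K \is a GRing.unit by rewrite rmorph_unit ?unitfE ?lt0r_neq0.
have Oa : O (m * p) ** a = a.
  apply/seteqP; split=> [|y ay]; last first.
    by rewrite -[y]mul1r; apply: mem_zmod_mul => //; apply: ord1.
  apply: zmod_mul_sub => // _ _ /ordMP[r [y Oy ->]] [l _ [z bz <-]].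
  exists (r * l) => //; exists (l%:~R * (y * x) + (r%:~R + p%:R * y) * z); last by ring.
  apply: subgroupD => //; first by apply: subgroupMz => //; apply: (inv_norm_memM nb).
  rewrite mulrDl -mulrA; apply: subgroupD => //; first exact: subgroupMz.
  by apply: subgroupMn => //; apply: (inv_norm_memM nb).
have saa : is_subgroup (a ** cj a) by apply: subgroup_zmod_mul.
have pb : scale p%:R b `<=` a by move=> _ [y bY <-]; apply: mem_neighborM.
split; last first.
  apply/seteqP; split.
    rewrite -Ob zmod_mulC; apply: zmod_mulS => //; exact: neighbor_sub.
  have saO : is_subgroup (a ** O m) by apply: subgroup_zmod_mul.
  move=> y bY; apply: (subgroup_coprime saO co).
    have : (b ** cj b) (y * conjk x) by apply: mem_zmod_mul => //; exists x.
    (* Here [o] is [y * conjk x / c], so [x * o] equals [y] times the norm of [x] over [c], which is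
       [v]. *)
    rewrite eb => -[o Oo e]; have -> : v%:~R * y = x * o.
      apply: (can_inj (mulKr cu)).
      transitivity (x * (c%:K * o)); last by ring.
      transitivity (y * (x * conjk x)); last by rewrite e; ring.
      by rewrite mul_conj xv algM algz; ring.
    by apply: mem_zmod_mul => //; apply: mem_neighbor.
  by apply: sub_mul_ord; apply: pb; exists y.
split=> //; first by rewrite muln_gt0 m0.
apply/seteqP; split.
  move=> y /(neighbor_mul_cj nb bx xv)[l _ [z Oz <-]].
  by exists ((l * v)%:~R + p%:R * z) => //; apply/ordMP; exists (l * v), z.
have aac : (a ** cj a) c%:K.
  (* [v * c] is the norm of [x], and [p * p * c] comes from multiplying [p b] by its conjugate. *)
  have co2 : coprimez v (p%:Z * p%:Z) by rewrite coprimezMr co.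
  apply: (subgroup_coprime saa co2).
    rewrite -algz -algM -xv -mul_conj; apply: mem_zmod_mul; first exact: mem_neighbor.
    by exists x => //; apply: mem_neighbor.
  have : (scale (p%:R * p%:R) (b ** cj b)) (p%:R * p%:R * c%:K).
    by exists c%:K => //; rewrite eb; exists 1; rewrite ?mulr1 //; apply: ord1.
  rewrite -scaleA -zmod_mulZr -zmod_mulZl -[X in scale X (cj b)](conjz p) -cj_scale.
  by rewrite intrM; apply: zmod_mulS => //; apply: cjS.
move=> _ [y Oy <-]; rewrite mulrC.
have : (O (m * p) ** (a ** cj a)) (y * c%:K) by apply: mem_zmod_mul.
by rewrite zmod_mulA Oa.
Qed.

(** The norm form of [b] divided by [c] is primitive. Were all its values divisible by [p], the
    values at [w1], [w2] and [w1 + w2] would make every coefficient divisible by [p]. *)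
Lemma exists_coprime_nm m c b (p : nat) : inv_norm m c b -> prime p ->
  exists2 x, b x & exists2 v : int, nm x = v%:~R * c & coprimez v p.
Proof.
move=> nb pp; apply: contrapT => H.
have [m0 c0 sb Ob eb] := nb.
have {}H x : b x -> exists i : int, nm x = (p%:Z * i)%:~R * c.
  move=> bx; have [v xv] := inv_norm_mem_nm nb bx.
  have [/dvdzP[i vi]|pv] := boolP (p%:Z %| v)%Z; first by exists i; rewrite xv vi [i * _]mulrC.
  case: H; exists x => //; exists v => //.
  by rewrite coprimez_sym coprimezE prime_coprime // -dvdzE.
have [al [be [ga [al0 ga0 aE _]]]] := inv_norm_hnf nb.
pose w1 := al%:K; pose w2 := be%:K + ga%:K * w.
have bw x : b x <-> exists i j : int, x = i%:~R * w1 + j%:~R * w2.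
  have e i j : (i%:~R * al + j%:~R * be)%:K + (j%:~R * ga)%:K * w =
      i%:~R * w1 + j%:~R * w2 by rewrite /w1 /w2; ring.
  by split=> [/aE[i [j ->]]|[i [j ->]]]; [exists i, j | apply/aE; exists i, j].
have [i1 e1] : exists i : int, nm w1 = (p%:Z * i)%:~R * c.
  by apply/H/bw; exists 1, 0; ring.
have [i2 e2] : exists i : int, nm w2 = (p%:Z * i)%:~R * c.
  by apply/H/bw; exists 0, 1; ring.
have [i3 e3] : exists i : int, nm (w1 + w2) = (p%:Z * i)%:~R * c.
  by apply/H/bw; exists 1, 1; ring.
have e12 : w1 * conjk w2 + w2 * conjk w1 = (p%:Z * (i3 - i1 - i2))%:~R * c%:K.
  transitivity ((w1 + w2) * conjk (w1 + w2) - w1 * conjk w1 - w2 * conjk w2).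
    by rewrite (conjD w1 w2); ring.
  by rewrite !mul_conj e1 e2 e3 !algM !algz; ring.
have [th thE] : exists th, th = w2 * conjk w1 by exists (w2 * conjk w1).
(* [S] is spanned by [p * c] and [th]. It would contain [b ** cj b], hence [c] and [c * m * w]; the
   latter makes [im th] nonzero, so that [c] would be a multiple of [p * c]. *)
pose S := [set x | exists i j : int, x = (p%:Z * i)%:~R * c%:K + j%:~R * th].
have bS : b ** cj b `<=` S.
  apply: zmod_mul_sub; first split.
  - by exists 0, 0; ring.
  - by move=> _ _ [i [j ->]] [i' [j' ->]]; exists (i - i'), (j - j'); ring.
  move=> _ _ /bw[i [j ->]] [_ /bw[i' [j' ->]] <-].
  exists (i * i' * i1 + j * j' * i2 + i * j' * (i3 - i1 - i2)), (j * i' - i * j').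
  rewrite conjD !conjM !conjz.
  transitivity ((i * i')%:~R * (w1 * conjk w1) + (j * j')%:~R * (w2 * conjk w2) +
     (i * j')%:~R * (w1 * conjk w2 + w2 * conjk w1) + (j * i' - i * j')%:~R * (w2 * conjk w1)).
    by ring.
  by rewrite e12 !mul_conj e1 e2 !algM !algz thE; ring.
have [i [j E]] : S c%:K.
  by apply: bS; rewrite eb; exists 1; rewrite ?mulr1 //; apply: ord1.
have [i' [j' E']] : S (c%:K * (m%:R * w)).
  by apply: bS; rewrite eb; exists (m%:R * w) => //; apply: ordw.
have := congr1 im E; have := congr1 im E'; rewrite !reimE.
rewrite !(mul0r, mulr0, subr0, addr0, add0r, mulr1) => im2 im1.
have j0 : j = 0.
  apply/eqP/negP => /negP j0; have jq0 : (j%:~R : rat) != 0 by rewrite intr_eq0.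
  have th0 : im th = 0 by apply: (mulfI jq0); rewrite -im1 mulr0.
  by move: im2; rewrite th0 mulr0 => /eqP; rewrite mulf_eq0 (gt_eqF c0) pnatr_eq0 (gtn_eqF m0).
have := congr1 re E; rewrite j0 !reimE !(mul0r, mulr0, subr0, addr0, add0r, mulr1) => ec.
have pi1 : p%:Z * i = 1.
  apply: (@intr_inj rat); apply: (mulIf (lt0r_neq0 c0)); rewrite -ec mul1r //.
have := congr1 absz pi1; rewrite abszM /= => /eqP.
by rewrite muln_eq1 => /andP[/eqP p1 _]; move: pp; rewrite p1.
Qed.

(** Surjectivity of the map between class groups, at the level of ideals and with the norm
    preserved. *)
Lemma exists_inv_norm_ext m c b (p : nat) : inv_norm m c b -> prime p ->
  exists a, inv_norm (m * p) c a /\ a ** O m = b.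
Proof.
move=> nb pp; have [x bx [v xv co]] := exists_coprime_nm nb pp.
by exists (neighbor p x b); apply: inv_norm_neighbor xv co; rewrite ?prime_gt0.
Qed.

(** * Sublattices of index [p] in the order and the projective line over F_p *)

Lemma ord_coordP m x : O m x <-> exists r s : int, x = r%:~R + s%:~R * (m%:R * w).
Proof. by rewrite ordP; split=> -[i [j ->]]; exists i, j; ring. Qed.

Lemma ord_coord_inj m (r s r' s' : int) : (0 < m)%N ->
  r%:~R + s%:~R * (m%:R * w) = r'%:~R + s'%:~R * (m%:R * w) -> r = r' /\ s = s'.
Proof.
move=> m0 E; have mq0 : (m%:R : rat) != 0 by rewrite pnatr_eq0 -lt0n.
have := congr1 re E; have := congr1 im E.
rewrite !reimE !(mul0r, mulr0, subr0, addr0, add0r, mulr1).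
by move=> /(mulIf mq0) /intr_inj -> /intr_inj ->.
Qed.

Lemma mem_scale_ord m (p : nat) (r s : int) : (p%:Z %| r)%Z -> (p%:Z %| s)%Z ->
  scale p%:R (O m) (r%:~R + s%:~R * (m%:R * w)).
Proof.
move=> /dvdzP[i ->] /dvdzP[j ->]; exists (i%:~R + j%:~R * (m%:R * w)); last by ring.
by apply/ord_coordP; exists i, j.
Qed.

Definition nm_shift m (i : nat) : int := i%:Z * i%:Z + t * i%:Z * m%:Z + u * m%:Z * m%:Z.
(** The affine points of the projective line: the image of [nbr m p i] modulo [p O_m] is the line
    through [i + m * w]. The remaining point, the line through 1, is [O (m * p)]. *)
Definition nbr m p (i : nat) := neighbor p (i%:R + m%:R * w) (O m).

Lemma nm_shiftE m i : nm (i%:R + m%:R * w) = (nm_shift m i)%:~R.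
Proof. by rewrite /nm !reimE /nm_shift; ring. Qed.

Lemma ord_shift m (i : nat) : O m (i%:R + m%:R * w).
Proof. by apply/ord_coordP; exists i%:Z, 1; ring. Qed.

Lemma nbrP m p i (r s : int) : (0 < m)%N ->
  nbr m p i (r%:~R + s%:~R * (m%:R * w)) <-> (p%:Z %| r - s * i%:Z)%Z.
Proof.
move=> m0; split=> [[l _ [_ /ord_coordP[r' [s' ->]]]]|/dvdzP[j ej]].
  move=> e; have [er es] : (l * i%:Z + p%:Z * r') = r /\ (l + p%:Z * s') = s.
    by apply: (ord_coord_inj m0); rewrite -e; ring.
  rewrite -er -es; have -> : l * i%:Z + p%:Z * r' - (l + p%:Z * s') * i%:Z = (r' - s' * i%:Z) * p%:Z by ring.
  exact: dvdz_mull.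
exists s => //; exists j%:~R; first exact: ord_int.
by have -> : r = j * p%:Z + s * i%:Z by [rewrite -ej; ring]; ring.
Qed.

Lemma scale_sub_nbr m p i : scale p%:R (O m) `<=` nbr m p i.
Proof. by move=> _ [y Oy <-]; apply: mem_neighborM. Qed.

Lemma nbr_sub_ord m p i : nbr m p i `<=` O m.
Proof. apply: neighbor_sub => //; exact: ord_shift. Qed.

Lemma nbr_inj m p (i j : nat) : (0 < m)%N -> (i < p)%N -> (j < p)%N ->
  nbr m p i = nbr m p j -> i = j.
Proof.
move=> m0 ip jp e.
have : nbr m p i (i%:Z%:~R + 1%:~R * (m%:R * w)) by apply/nbrP => //; rewrite mul1r subrr.
by rewrite e => /(nbrP _ _ _ _ m0); rewrite mul1r; apply: eq_of_dvdz.
Qed.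

Lemma nbr_neq_ord m p i : (0 < m)%N -> (1 < p)%N -> nbr m p i <> O (m * p).
Proof.
move=> m0 p1 e.
have : nbr m p i (i%:Z%:~R + 1%:~R * (m%:R * w)) by apply/nbrP => //; rewrite mul1r subrr.
rewrite e => /ordP[r [s]].
have -> : r%:~R + (s * (m * p)%N%:Z)%:~R * w = r%:~R + (s * p%:Z)%:~R * (m%:R * w).
  by rewrite PoszM; ring.
move=> /(ord_coord_inj m0)[_ e1].
have : (p%:Z %| 1)%Z by apply/dvdzP; exists s.
by rewrite dvdzE dvdn1 => /eqP /= p2; move: p1; rewrite p2.
Qed.

Lemma exists_inv_mod (p : nat) (s : int) : prime p -> ~~ (p%:Z %| s)%Z ->
  exists e f : int, e * s = 1 + f * p%:Z.
Proof.
move=> pp ps; have : coprimez s p%:Z.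
  by rewrite coprimez_sym coprimezE prime_coprime // -dvdzE.
by move=> /coprimezP[[e f] /= E]; exists e, (- f); rewrite -E; ring.
Qed.

Lemma exists_modn (p : nat) (r : int) : (0 < p)%N ->
  exists2 i : nat, (i < p)%N & exists f : int, r = i%:Z + f * p%:Z.
Proof.
move=> p0; have P : 0 <= (r %% p%:Z)%Z < p%:Z by rewrite modz_ge0 ?ltz_mod //; lia.
exists `|(r %% p%:Z)%Z|%N; first by lia.
by exists (r %/ p%:Z)%Z; rewrite gez0_abs; [rewrite {1}(divz_eq r p%:Z) addrC | lia].
Qed.

(** An inverse of [s] modulo [p] normalises the second coordinate to 1; [i] is the residue of the
    first. *)
Lemma sub_nbr_subgroup m a p (r s : int) : is_subgroup a -> prime p ->
  scale p%:R (O m) `<=` a -> a (r%:~R + s%:~R * (m%:R * w)) -> ~~ (p%:Z %| s)%Z ->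
  exists2 i : nat, (i < p)%N & nbr m p i `<=` a.
Proof.
move=> sa pp pa ax ps; have [e [f ef]] := exists_inv_mod pp ps.
have [i ip [g eg]] := exists_modn (e * r) (prime_gt0 pp).
exists i => //.
have ai : a (i%:R + m%:R * w).
  have -> : i%:R + m%:R * w = e%:~R * (r%:~R + s%:~R * (m%:R * w)) -
      ((g * p%:Z)%:~R + (f * p%:Z)%:~R * (m%:R * w)).
    transitivity ((e * r - g * p%:Z)%:~R + (e * s - f * p%:Z)%:~R * (m%:R * w)); last by ring.
    by rewrite eg ef; ring.
  apply: sa.2; first exact: subgroupMz.
  by apply: pa; apply: mem_scale_ord; apply: dvdz_mull.
move=> _ [l _ [y Oy <-]]; apply: subgroupD => //; first exact: subgroupMz.
by apply: pa; exists y.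
Qed.

Lemma subgroup_ord1 m a (z : int) p i : is_subgroup a -> prime p ->
  scale p%:R (O m) `<=` a -> nbr m p i `<=` a -> a z%:~R -> ~~ (p%:Z %| z)%Z ->
  O m `<=` a.
Proof.
move=> sa pp pa na az pz.
have a1 : a 1.
  apply: (subgroup_coprime sa (i := z) (j := p)).
  - by rewrite coprimez_sym coprimezE prime_coprime // -dvdzE.
  - by rewrite mulr1.
  - by apply: pa; exists 1 => //; apply: ord1.
move=> x /ord_coordP[r [s ->]].
have -> : r%:~R + s%:~R * (m%:R * w) = (r - s * i%:Z)%:~R * 1 + s%:~R * (i%:R + m%:R * w) by ring.
apply: subgroupD => //; apply: subgroupMz => //; apply: na; exact: mem_neighbor.
Qed.

Lemma coprime_nm_shift m p i : prime p -> ~~ (p%:Z %| nm_shift m i)%Z ->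
  coprimez (nm_shift m i) p.
Proof. by move=> pp pn; rewrite coprimez_sym coprimezE prime_coprime // -dvdzE. Qed.

Lemma inv_norm_nbr m p i : (0 < m)%N -> prime p -> ~~ (p%:Z %| nm_shift m i)%Z ->
  inv_norm (m * p) 1 (nbr m p i) /\ nbr m p i ** O m = O m.
Proof.
move=> m0 pp pn; apply: (inv_norm_neighbor (v := nm_shift m i)).
- exact: inv_norm_ord.
- exact: ord_shift.
- exact: prime_gt0.
- by rewrite mulr1 nm_shiftE.
- exact: coprime_nm_shift.
Qed.

(** Describes the kernel of extension from [O (m * p)] to [O m]. Such an [a] lies between [p O_m]
    and [O m] and differs from [O m], whose ring of multipliers is too large, so it is a point of
    the projective line. *)
Lemma inv_norm1_extP m p a : (0 < m)%N -> prime p ->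
  inv_norm (m * p) 1 a /\ a ** O m = O m <->
  a = O (m * p) \/ exists i, [/\ (i < p)%N, ~~ (p%:Z %| nm_shift m i)%Z & a = nbr m p i].
Proof.
move=> m0 pp; split; last first.
  case=> [->|[i [ip pn ->]]]; last exact: inv_norm_nbr.
  split; first by apply: inv_norm_ord; rewrite muln_gt0 m0 prime_gt0.
  by apply: ord_mul; apply: dvdn_mulr.
move=> [na aOm]; have [_ _ sa Oa ea] := na.
have aO : a `<=` O m by rewrite -aOm; apply: sub_mul_ord.
have pa : scale p%:R (O m) `<=` a.
  rewrite -[in X in X `<=` _]aOm -zmod_mulZr; apply: (zmod_mulO na).
  by move=> _ [x Ox <-]; apply: mem_ordM.
have [sub|] := pselect (a `<=` O (m * p)).
  by left; apply: (inv_norm1 na).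
move=> /existsNP[x /not_implyP[ax]].
have /ord_coordP[r [s ex]] := aO _ ax; rewrite ex in ax *.
move=> nO; have ps : ~~ (p%:Z %| s)%Z.
  apply/negP => /dvdzP[s' es]; apply: nO; apply/ordP.
  by exists r, s'; rewrite es PoszM; ring.
have [i ip nia] := sub_nbr_subgroup sa pp pa ax ps.
right; exists i.
have anb : a = nbr m p i.
  apply/seteqP; split=> // y ay.
  have /ord_coordP[r' [s' ey]] := aO _ ay.
  rewrite ey; apply/nbrP => //; apply/negPn/negP => pz.
  have az : a (r' - s' * i%:Z)%:~R.
    have -> : (r' - s' * i%:Z)%:~R = y - s'%:~R * (i%:R + m%:R * w) by rewrite ey; ring.
    by apply: sa.2 => //; apply: subgroupMz => //; apply: nia; apply: mem_neighbor.
  have aE : a = O m.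
    by apply/seteqP; split=> //; exact: (subgroup_ord1 sa pp pa nia az pz).
  rewrite aE in na; have [e _] := inv_norm_uniq na (inv_norm_ord m0).
  by have := prime_gt1 pp; nia.
(* At a zero of the norm form, [a ** cj a] lies in [p O_m], which does not contain 1. *)
split=> //; apply/negP => /dvdzP[v ev].
have : (a ** cj a) 1.
  by rewrite ea; exists 1; [exact: ord1 | rewrite alg1 mulr1].
rewrite anb => /(neighbor_mul_cj (v := nm_shift m i) (inv_norm_ord m0) (ord_shift m i)).
rewrite mulr1 nm_shiftE => /(_ erefl)[l _ [y /ord_coordP[r' [s' ->]]]].
rewrite alg1 mul1r ev => e.
have [|e1 _] := @ord_coord_inj m (l * (v * p%:Z) + p%:Z * r') (p%:Z * s') 1 0 m0.
  by rewrite mul0r addr0 -[RHS]e; ring.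
have : (p%:Z %| 1)%Z.
  by apply/dvdzP; exists (l * v + r'); rewrite -[LHS]e1; ring.
by rewrite dvdzE dvdn1 => /eqP /= p1; move: pp; rewrite p1.
Qed.

Lemma Lideals_dvd_sub m p n a : (0 < m)%N -> prime p -> (p %| n)%N ->
  Lideals (m * p) n a -> a `<=` scale p%:R (O m).
Proof.
move=> m0 pp pn; have mp0 : (0 < m * p)%N by rewrite muln_gt0 m0 prime_gt0.
move=> /(LidealsP _ _ mp0)[na aO] x ax.
have /ordMP[r [y Oy ex]] := aO _ ax; rewrite ex in ax *.
have /dvdzP[j ->] := inv_norm_dvd_nm na pn pp Oy ax.
exists (j%:~R + y); last by ring.
by apply: subgroupD => //; apply: ord_int.
Qed.

(** The product with the conjugate contains [p] times each of [p], [v] and the trace of [x], where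
    [v] is the norm of [x] over [p]. It contains [p] unless both [v] and the trace are divisible by
    [p]. *)
Lemma Lideals_nbr m p i : (0 < m)%N -> prime p -> ~~ (p %| m)%N ->
  (p%:Z %| nm_shift m i)%Z -> Lideals m p (nbr m p i).
Proof.
move=> m0 pp pm /dvdzP[v ev]; apply/LidealsP => //; split; last exact: nbr_sub_ord.
have sn : is_subgroup (nbr m p i) by apply: subgroup_neighbor.
have On : O m ** nbr m p i = nbr m p i.
  apply/seteqP; split=> [|y ay]; last first.
    by rewrite -[y]mul1r; apply: mem_zmod_mul => //; apply: ord1.
  apply: zmod_mul_sub => // x _ /ord_coordP[r [s ->]] [l _ [z Oz <-]].
  rewrite mulrDr; apply: subgroupD => //; last first.
    apply: scale_sub_nbr; exists ((r%:~R + s%:~R * (m%:R * w)) * z); last by ring.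
    by apply: ordM => //; apply/ord_coordP; exists r, s.
  have -> : (r%:~R + s%:~R * (m%:R * w)) * (l%:~R * (i%:R + m%:R * w)) =
    (l * (r * i%:Z) - l * s * (u * m%:Z * m%:Z))%:~R +
    (l * (r + s * i%:Z + s * t * m%:Z))%:~R * (m%:R * w).
    by apply: coord_ext; rewrite !reimE; ring.
  apply/nbrP => //.
  have -> : l * (r * i%:Z) - l * s * (u * m%:Z * m%:Z) - l * (r + s * i%:Z + s * t * m%:Z) * i%:Z =
    - (l * s) * nm_shift m i by rewrite /nm_shift; ring.
  by rewrite ev mulrA; apply: dvdz_mull.
split=> //; first by rewrite ltr0n prime_gt0.
pose x := i%:R + m%:R * w.
apply/seteqP; split.
  move=> y /(neighbor_mul_cj (v := nm_shift m i) (inv_norm_ord m0) (ord_shift m i)).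
  rewrite mulr1 nm_shiftE => /(_ erefl)[l _ [z Oz <-]].
  exists ((l * v)%:~R + z); first by apply: subgroupD => //; exact: ord_int.
  by rewrite alg1 algn ev; ring.
have sJ : is_subgroup (nbr m p i ** cj (nbr m p i)) by apply: subgroup_zmod_mul.
have nx : nbr m p i x by apply: mem_neighbor.
have np : nbr m p i p%:R by rewrite -[p%:R]mulr1; apply: mem_neighborM; exact: ord1.
have cjp : cj (nbr m p i) p%:R by exists p%:R => //; exact: (conjz p).
have cjx : cj (nbr m p i) (conjk x) by exists x.
suff Jp : (nbr m p i ** cj (nbr m p i)) p%:R.
  move=> _ [y Oy <-]; rewrite algn mulrC.
  have : (O m ** (nbr m p i ** cj (nbr m p i))) (y * p%:R) by apply: mem_zmod_mul.
  by rewrite zmod_mulA On.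
have Jpp : (nbr m p i ** cj (nbr m p i)) (p%:Z%:~R * p%:R) by apply: mem_zmod_mul.
have cop (z : int) : ~~ (p%:Z %| z)%Z -> coprimez z p.
  by move=> pz; rewrite coprimez_sym coprimezE prime_coprime // -dvdzE.
have [pv|/cop pv] := boolP (p%:Z %| v)%Z; last first.
  apply: (subgroup_coprime sJ pv) => //.
  have -> : v%:~R * p%:R = x * conjk x by rewrite mul_conj nm_shiftE ev algz; ring.
  exact: mem_zmod_mul.
have [ptr|/cop ptr] := boolP (p%:Z %| 2 * i%:Z + t * m%:Z)%Z; last first.
  apply: (subgroup_coprime sJ ptr) => //.
  have -> : (2 * i%:Z + t * m%:Z)%:~R * p%:R = x * p%:R + p%:R * conjk x.
    by rewrite /x; apply: coord_ext; rewrite !(reimJ, reimE); ring.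
  by apply: subgroupD => //; apply: mem_zmod_mul.
case/negP: pm; have pq0 : (p%:R : rat) != 0 by rewrite pnatr_eq0 -lt0n prime_gt0.
(* Now [(i + m * w) / p] has integral trace and norm, so maximality makes [m / p] an integer. *)
have [v' ev'] := dvdzP pv; have [tr etr] := dvdzP ptr.
have [||_ /intrP[j ej]] := @ib_maximal _ B (i%:R / p%:R) (m%:R / p%:R).
- rewrite (_ : _ + _ = tr%:~R) ?intr_int //; apply: (mulIf pq0).
  have -> : tr%:~R * p%:R = (2 * i%:Z + t * m%:Z)%:~R :> rat by rewrite etr; ring.
  by field.
- rewrite (_ : _ + _ = v'%:~R) ?intr_int //; apply: (mulIf pq0); apply: (mulIf pq0).
  have -> : v'%:~R * p%:R * p%:R = (nm_shift m i)%:~R :> rat by rewrite ev ev'; ring.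
  by rewrite /nm_shift; field.
apply/dvdnP; exists `|j|%N; apply/eqP; rewrite -(eqr_nat rat) natrM; apply/eqP.
have -> : (m%:R : rat) = j%:~R * p%:R by rewrite -ej divfK.
congr (_ * _); rewrite pmulrn gez0_abs // -(ler0z rat) -ej.
by rewrite divr_ge0 ?ler0n.
Qed.

(** Modulo [p] the ideal is a line on which the norm form vanishes. It is not the line through 1,
    where the form takes the value 1, so it is an affine point. *)
Lemma Lideals_sub_nbr m p n a : (0 < m)%N -> prime p -> (p %| n)%N ->
  Lideals m n a -> ~ a `<=` scale p%:R (O m) ->
  exists2 i : nat, (i < p)%N & (p%:Z %| nm_shift m i)%Z /\ a `<=` nbr m p i.
Proof.
move=> m0 pp pn /(LidealsP _ _ m0)[na aO] /existsNP[x /not_implyP[ax nx]].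
have [_ _ sa _ _] := na.
have /ord_coordP[r [s ex]] := aO _ ax; rewrite ex in ax nx.
(* If [p] divided [s], the norm would be congruent to [r * r], so [p] would divide [r] too. *)
have ps : ~~ (p%:Z %| s)%Z.
  apply/negP => ps; apply: nx; apply: mem_scale_ord => //.
  have /dvdzP[s' es] := ps.
  apply: (inv_norm_dvd_nm (y := s'%:~R * (m%:R * w)) na pn pp).
    by apply: subgroupMz => //; exact: ordw.
  by move: ax; rewrite es; congr a; ring.
have [e [f ef]] := exists_inv_mod pp ps.
have [i ip [g eg]] := exists_modn (e * r) (prime_gt0 pp).
have aex : a (e%:~R * (r%:~R + s%:~R * (m%:R * w))) by apply: subgroupMz.
have exE : e%:~R * (r%:~R + s%:~R * (m%:R * w)) =
    i%:R + m%:R * w + p%:R * (g%:~R + f%:~R * (m%:R * w)).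
  transitivity ((e * r)%:~R + (e * s)%:~R * (m%:R * w)); first by ring.
  by rewrite eg ef; ring.
exists i => //; split.
  have [l el] := inv_norm_mem_nm na aex.
  have [n' en] := dvdnP pn.
  rewrite exE in el.
  pose D := 2 * i%:Z * g + t * (i%:Z * f * m%:Z + g * m%:Z) + 2 * u * f * m%:Z * m%:Z +
     p%:Z * (g * g + t * g * f * m%:Z + u * f * f * m%:Z * m%:Z).
  have : nm_shift m i + p%:Z * D = l * (n' * p)%N%:Z.
    apply: (@intr_inj rat); rewrite [RHS]intrM -pmulrn -en -el /D /nm_shift.
    by rewrite /nm !reimE; ring.
  move=> /(canRL (addrK _)) ->; apply: rpredB; last exact: dvdz_mulr.
  by rewrite PoszM mulrA; apply: dvdz_mull.
move=> y ay; have /ord_coordP[r' [s' ey]] := aO _ ay.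
rewrite ey; apply/nbrP => //.
apply: (inv_norm_dvd_nm (y := - s'%:~R * (g%:~R + f%:~R * (m%:R * w))) na pn pp).
  rewrite mulNr; apply: subgroupN => //; apply: subgroupMz => //.
  by apply/ord_coordP; exists g, f.
have -> : (r' - s' * i%:Z)%:~R + p%:R * (- s'%:~R * (g%:~R + f%:~R * (m%:R * w))) =
    y - s'%:~R * (e%:~R * (r%:~R + s%:~R * (m%:R * w))) by rewrite exE ey; ring.
by apply: sa.2 => //; apply: subgroupMz.
Qed.

Lemma sub_nbr_uniq m p n a (i j : nat) : (0 < m)%N -> prime p -> (p %| n)%N ->
  Lideals m n a -> ~ a `<=` scale p%:R (O m) -> (i < p)%N -> (j < p)%N ->
  a `<=` nbr m p i -> a `<=` nbr m p j -> i = j.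
Proof.
move=> m0 pp pn /(LidealsP _ _ m0)[na aO] /existsNP[x /not_implyP[ax nx]] ip jp ai aj.
have /ord_coordP[r [s ex]] := aO _ ax; rewrite ex in ax nx.
have /(nbrP _ _ _ _ m0) di := ai _ ax; have /(nbrP _ _ _ _ m0) dj := aj _ ax.
have ps : ~~ (p%:Z %| s)%Z.
  apply/negP => ps; apply: nx; apply: mem_scale_ord => //.
  have -> : r = (r - s * i%:Z) + s * i%:Z by ring.
  by apply: rpredD => //; apply: dvdz_mulr.
have : (p%:Z %| s * (i%:Z - j%:Z))%Z.
  have -> : s * (i%:Z - j%:Z) = (r - s * j%:Z) - (r - s * i%:Z) by ring.
  exact: rpredB.
rewrite Gauss_dvdzr; last by rewrite coprimezE prime_coprime // -dvdzE.
exact: eq_of_dvdz.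
Qed.

(** * Ideal classes and primitive characters *)

Lemma nm_unit x : x \is a GRing.unit -> nm x != 0.
Proof.
move=> ux; apply/eqP => n0; have := mul_conj x.
rewrite n0 rmorph0 => /(canRL (mulKr ux)); rewrite mulr0 => e.
by move: ux; rewrite -[x]conjK e (conjz 0) unitr0.
Qed.

Lemma alg_unit c : c != 0 -> c%:K \is a GRing.unit.
Proof. by move=> c0; rewrite rmorph_unit ?unitfE. Qed.

Lemma ideal_classE m c a : inv_norm m c a ->
  ideal_class m a = [set scale x a | x in [set x | x \is a GRing.unit]].
Proof.
move=> [_ _ _ Oa _]; have e x : principal_ideal m x ** a = scale x a.
  by rewrite -[principal_ideal m x]/(scale x (O m)) zmod_mulZl Oa.
by apply/seteqP; split=> _ [x ux <-]; exists x; rewrite ?e.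
Qed.

Lemma mem_ideal_class m c a : inv_norm m c a -> ideal_class m a a.
Proof. by move=> na; rewrite (ideal_classE na); exists 1; rewrite ?scale1 //= unitr1. Qed.

Lemma ideal_class_scale m c a x : inv_norm m c a -> x \is a GRing.unit ->
  ideal_class m (scale x a) = ideal_class m a.
Proof.
move=> na ux; have nxa := inv_norm_scale (nm_unit ux) na.
rewrite (ideal_classE na) (ideal_classE nxa).
apply/seteqP; split=> _ [y uy <-].
  by exists (y * x); rewrite /= ?unitrM ?uy ?scaleA.
exists (y * x^-1); first by rewrite /= unitrM uy unitrV.
by rewrite scaleA mulrVK.
Qed.

Lemma class_mapE m m' c a : (m' %| m)%N -> inv_norm m c a ->
  class_map m' (ideal_class m a) = ideal_class m' (a ** O m').
Proof.
move=> d na; have e x : x \is a GRing.unit ->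
    ideal_class m' (scale x a ** O m') = ideal_class m' (a ** O m').
  by move=> ux; rewrite zmod_mulZl; apply: ideal_class_scale => //; exact: inv_norm_ext na.
rewrite /class_map; apply/seteqP; split=> b.
  by move=> [a']; rewrite (ideal_classE na) => -[x ux <-]; rewrite e.
by move=> Hb; exists a => //; apply: mem_ideal_class na.
Qed.

Section Character.
Variables (C : fieldType) (f : nat) (f0 : (0 < f)%N) (chi : set (set k) -> C).
Hypothesis hchi : is_character f chi.
Local Notation chif a := (chi (ideal_class f a)).

Lemma charM c c' a b : inv_norm f c a -> inv_norm f c' b -> chif (a ** b) = chif a * chif b.
Proof.
by move=> na nb; apply: hchi.2; apply/invertible_idealP => //; [exists c | exists c'].
Qed.

Lemma char_neq0 c a : inv_norm f c a -> chif a != 0.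
Proof. by move=> na; apply: hchi.1; apply/invertible_idealP => //; exists c. Qed.

Lemma char_ord : chif (O f) = 1.
Proof.
have n1 := inv_norm_ord f0; apply: (mulfI (char_neq0 n1)).
by rewrite mulr1 -(charM n1 n1) ord_mul_self.
Qed.

Lemma char_scale c a x : inv_norm f c a -> x \is a GRing.unit -> chif (scale x a) = chif a.
Proof. by move=> na ux; rewrite (ideal_class_scale na). Qed.

(* If [chi] were trivial on the kernel of [Cl_{k,f} -> Cl_{k,f/p}], then it would be
   defined at [f / p]. *)
Lemma exists_char_neq1 p : primitive f chi -> prime p -> (p %| f)%N ->
  exists2 a, inv_norm f 1 a /\ a ** O (f %/ p) = O (f %/ p) & chif a != 1.
Proof.
move=> hprim pp pf; apply: contrapT => H.
pose m := (f %/ p)%N; have fE : f = (m * p)%N by rewrite divnK.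
have m0 : (0 < m)%N by move: f0; rewrite fE muln_gt0 => /andP[].
have dm : (m %| f)%N by rewrite fE dvdn_mulr.
have {}H a : inv_norm f 1 a -> a ** O m = O m -> chif a = 1.
  by move=> na aO; apply/eqP/negPn/negP => Xa; apply: H; exists a.
pose lifts D := [set a | (exists c, inv_norm f c a) /\ ideal_class m (a ** O m) = D].
(* [chi'] evaluates [chi] at a chosen lift of the class; the default [set0] is reached only where no
   lift exists. *)
pose chi' D := chif (xget set0 (lifts D)).
have chi'E c a : inv_norm f c a -> chi' (ideal_class m (a ** O m)) = chif a.
  move=> na; rewrite /chi'; case: xgetP => [b _ [[c' nb] bE]|/(_ a)[]]; last first.
    by split=> //; exists c.
  have : ideal_class m (a ** O m) (b ** O m).
    by rewrite -bE; apply: mem_ideal_class (inv_norm_ext dm nb).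
  rewrite (ideal_classE (inv_norm_ext dm na)) => -[x ux xE].
  rewrite -(char_scale na ux); have nxa := inv_norm_scale (nm_unit ux) na.
  have := inv_normV nxa; have := mul_inv_ideal nxa; set v := inv_ideal _ _ => xv nv.
  (* [b ** v] is the quotient of two lifts of the same class, after the principal factor [x] has
     been moved into [a]. It becomes trivial over [O m], hence has norm 1 and lies in the kernel. *)
  have bvO : (b ** v) ** O m = O m.
    rewrite -zmod_mulA [v ** _]zmod_mulC zmod_mulA -xE -zmod_mulZl -zmod_mulA.
    by rewrite [O m ** _]zmod_mulC zmod_mulA xv ord_mul.
  have nbv := inv_normM nb nv.
  have c1 : c' * (`|nm x| * c)^-1 = 1.
    have := inv_norm_ext dm nbv; rewrite bvO => n1.
    by have [] := inv_norm_uniq n1 (inv_norm_ord m0).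
  rewrite c1 in nbv; have := charM nbv nxa.
  rewrite (H _ nbv bvO) mul1r => <-; congr (chi (ideal_class f _)).
  by rewrite -zmod_mulA [v ** _]zmod_mulC xv zmod_mulC; have [] := nb.
have lift b : invertible_ideal m b -> exists a c, inv_norm f c a /\ a ** O m = b.
  move=> /(invertible_idealP _ m0)[c nb]; have [a [na e]] := exists_inv_norm_ext nb pp.
  by exists a, c; rewrite fE.
have def : defined_at f chi m.
  exists chi'; first split.
  - by move=> b /lift[a [c [na <-]]]; rewrite (chi'E _ _ na); apply: char_neq0 na.
  - move=> b b' /lift[a [c [na <-]]] /lift[a' [c' [na' <-]]].
    rewrite (chi'E _ _ na) (chi'E _ _ na') zmod_mulACA ord_mul_self.
    by rewrite (chi'E _ _ (inv_normM na na')); apply: charM na na'.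
  - move=> _ [a /(invertible_idealP _ f0)[c na] <-].
    by rewrite /induced /= (class_mapE dm na) (chi'E _ _ na).
(* The conductor is a gcd over all levels at which [chi] is defined, so [f] would divide the smaller
   number [m]. *)
have : (f %| m)%N.
  rewrite -{1}hprim /conductor big_mkcond (bigD1_seq m) /= ?divisors_uniq //; last first.
    by rewrite -dvdn_divisors.
  by rewrite asboolT // dvdn_gcdl.
move=> /(dvdn_leq m0); rewrite fE; have := prime_gt1 pp; move: m0; clear; nia.
Qed.

End Character.

(* The number of roots modulo [p] of the norm form of [O m] dehomogenised at [m * w]; the
   form takes the value 1 at the remaining point of the projective line. *)
Definition rho m (p : nat) : nat := #|[pred i : 'I_p | (p%:Z %| nm_shift m i)%Z]|.

(** * Passing from the order of conductor [m] to that of conductor [m * p] *)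

Section Character.
Variables (C : fieldType) (f : nat) (f0 : (0 < f)%N) (chi : set (set k) -> C).
Hypothesis hchi : is_character f chi.
Local Notation chif a := (chi (ideal_class f a)).

(* The coefficients of [L(s, chi, O_m)], for [f %| m]. *)
Definition Ysum m (n : nat) : C := \sum_(a \in Lideals m n) chif (a ** O f).

Lemma Lseries_induced d n : (0 < d)%N -> Lseries (f * d) (induced f chi) n = Ysum (f * d) n.
Proof.
move=> d0; have m0 : (0 < f * d)%N by rewrite muln_gt0 f0.
apply: eq_fsbigr => a; rewrite inE => /(LidealsP _ _ m0)[na _].
by rewrite /induced /= (class_mapE _ na) ?dvdn_mulr.
Qed.

Lemma Ysum_conductor n : Ysum f n = \sum_(a \in Lideals f n) chif a.
Proof.
apply: eq_fsbigr => a; rewrite inE => /(LidealsP _ _ f0)[[_ _ _ Oa _] _].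
by rewrite zmod_mulC Oa.
Qed.

Lemma Ysum_coprime m (p n : nat) : (0 < m)%N -> (f %| m)%N -> (0 < p)%N ->
  coprime p n -> Ysum (m * p) n = Ysum m n.
Proof.
move=> m0 fm p0 co; rewrite /Ysum.
rewrite (reindex_fsbig _ _ _ _ (Lideals_coprime_bij m0 p0 co)).
by apply: eq_fsbigr => a _; rewrite -zmod_mulA ord_mul.
Qed.

(** As [a] lies in [p O_m], the extension of [a / p] to [O m] is an integral ideal, and its norm is
    [n / p^2]. *)
Lemma Lideals_dvd_sqr m (p n : nat) a : (0 < m)%N -> prime p -> (p %| n)%N ->
  Lideals (m * p) n a -> (p * p %| n)%N.
Proof.
move=> m0 pp pn La; have mp0 : (0 < m * p)%N by rewrite muln_gt0 m0 prime_gt0.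
have apO := Lideals_dvd_sub m0 pp pn La.
have [na _] := (LidealsP _ _ mp0).1 La.
have p0 : (0 : rat) < p%:R by rewrite ltr0n prime_gt0.
have pi0 : (0 : rat) < p%:R^-1 by rewrite invr_gt0.
have nb := inv_norm_ext (dvdn_mulr p (dvdnn m)) (inv_norm_scaleK pi0 na).
have [|q q0 e] := inv_norm_nat nb.
  rewrite -[X in _ `<=` X]ord_mul_self; apply: zmod_mulS => // x [y /apO[z Oz <-] <-].
  by rewrite -algn mulrA -algM mulVf ?alg1 ?mul1r ?lt0r_neq0.
apply/dvdnP; exists q; apply/eqP; rewrite -(eqr_nat rat) !natrM -e.
by apply/eqP; field; rewrite lt0r_neq0.
Qed.

(** Two lifts of one [O m]-ideal differ by exactly one kernel element, so every ideal of norm [n] is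
    [p * lift b * T x] for a unique pair. The admissible [x] are the [p + 1] points of the
    projective line minus the [rho] zeros. *)
Lemma Ysum_ramified m (p n : nat) : (0 < m)%N -> (f %| m)%N -> prime p ->
  (p %| n)%N -> Ysum (m * p) n =
  if (p * p %| n)%N then (p.+1 - rho m p)%:R * Ysum m (n %/ (p * p)) else 0.
Proof.
move=> m0 fm pp pn; have mp0 : (0 < m * p)%N by rewrite muln_gt0 m0 prime_gt0.
have [pn2|pn2] := boolP (p * p %| n)%N; last first.
  by rewrite /Ysum fsbig1 // => a /(Lideals_dvd_sqr m0 pp pn) pn2'; rewrite pn2' in pn2.
set n' := (n %/ (p * p))%N; have nE : n = (n' * (p * p))%N by rewrite divnK.
have p0 : (0 : rat) < p%:R by rewrite ltr0n prime_gt0.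
have pi0 : (0 : rat) < p%:R^-1 by rewrite invr_gt0.
have pu : (p%:R : k) \is a GRing.unit by rewrite -algn; apply: alg_unit; rewrite lt0r_neq0.
have nq : (n%:R : rat) = p%:R * p%:R * n'%:R by rewrite nE !natrM mulrC.
pose lift b := xget set0 [set a | inv_norm (m * p) n'%:R a /\ a ** O m = b].
have liftP b : Lideals m n' b -> inv_norm (m * p) n'%:R (lift b) /\ lift b ** O m = b.
  move=> /(LidealsP _ _ m0)[nb _]; rewrite /lift; case: xgetP => [a _ //|H].
  by have [a Ha] := exists_inv_norm_ext nb pp; case: (H a).
(* [None] is the point at infinity, with lattice [O (m * p)]; [P] selects the points where the norm
   form does not vanish. *)
pose P (x : option 'I_p) : bool :=
  if x is Some i then ~~ (p%:Z %| nm_shift m i)%Z else true.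
pose T (x : option 'I_p) : set k := if x is Some i then nbr m p i else O (m * p).
have TP (x : option 'I_p) : P x -> inv_norm (m * p) 1 (T x) /\ T x ** O m = O m.
  move=> Px; apply/(inv_norm1_extP _ m0 pp); case: x Px => [i|] /=; last by left.
  by move=> Pi; right; exists i.
have T_inj (x y : option 'I_p) : T x = T y -> x = y.
  case: x => [i|]; case: y => [j|] //=.
  - by move=> /(nbr_inj m0) e; congr Some; apply: val_inj; apply: e.
  - by move=> /(nbr_neq_ord m0 (prime_gt1 pp)).
  - by move=> /esym /(nbr_neq_ord m0 (prime_gt1 pp)).
pose h (x : option 'I_p) b := scale p%:R (lift b ** T x).
have hO (x : option 'I_p) b : P x -> Lideals m n' b -> h x b ** O m = scale p%:R b.
  move=> Px Lb; have [_ lE] := liftP _ Lb; have [_ TE] := TP _ Px.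
  by rewrite /h zmod_mulZl -zmod_mulA TE lE.
have scaleI a b : scale p%:R a = scale p%:R b -> a = b.
  move=> e; rewrite -[a]scale1 -[b]scale1 -(mulVr pu) -!scaleA e //.
have hA (x : option 'I_p) b : P x -> Lideals m n' b -> Lideals (m * p) n (h x b).
  move=> Px Lb; have [nl lE] := liftP _ Lb; have [nT TE] := TP _ Px.
  have [_ bO] := (LidealsP _ _ m0).1 Lb.
  apply/LidealsP => //; split.
    rewrite nq -[n'%:R]mulr1 /h -algn; apply: inv_norm_scaleK => //; exact: inv_normM.
  move=> y /(sub_mul_ord m); rewrite hO // => -[z /bO Oz <-].
  exact: mem_ordM.
have -> : Ysum (m * p) n = \sum_(a \in Lideals (m * p) n) chif (a ** O f) *+
    #|[pred x | P x & `[< exists2 b, Lideals m n' b & h x b = a >]]|.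
  apply: eq_fsbigr => a; rewrite inE => La; rewrite (_ : #|_| = 1%N) ?mulr1n //.
  have [na aO] := (LidealsP _ _ mp0).1 La.
  have apO := Lideals_dvd_sub m0 pp pn La.
  pose a' := scale p%:R^-1%:K a; pose b := a' ** O m.
  have aE : a = scale p%:R a' by rewrite scaleA -algn -algM divff ?alg1 ?scale1 ?lt0r_neq0.
  have na' : inv_norm (m * p) n'%:R a'.
    have := inv_norm_scaleK pi0 na; rewrite nq; congr (inv_norm _ _ _).
    by field; rewrite lt0r_neq0.
  have Lb : Lideals m n' b.
    apply/LidealsP => //; split; first exact: inv_norm_ext (dvdn_mulr p (dvdnn m)) na'.
    rewrite -[X in _ `<=` X]ord_mul_self; apply: zmod_mulS => // x [y /apO[z Oz <-] <-].
    by rewrite -algn mulrA -algM mulVf ?alg1 ?mul1r ?lt0r_neq0.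
  have [nl lE] := liftP _ Lb.
  have [v [nv lv]] : exists v, inv_norm (m * p) n'%:R^-1 v /\ lift b ** v = O (m * p).
    by exists (inv_ideal n'%:R (lift b)); split; [exact: inv_normV | exact: mul_inv_ideal nl].
  have n'0 : (n'%:R : rat) != 0 by have [_ /lt0r_neq0] := na'.
  have ne : inv_norm (m * p) 1 (a' ** v) by rewrite -(divff n'0); apply: inv_normM.
  have eO : (a' ** v) ** O m = O m.
    rewrite -zmod_mulA [v ** _]zmod_mulC zmod_mulA -/b -lE -zmod_mulA.
    by rewrite [O m ** v]zmod_mulC zmod_mulA lv ord_mul ?dvdn_mulr.
  (* The quotient of [a'] by the chosen lift of its extension becomes trivial over [O m], so it is
     one of the [T x]. *)
  have [x Px Tx] : exists2 x : option 'I_p, P x & T x = a' ** v.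
    have /(inv_norm1_extP _ m0 pp)[e|[i [ip Pi e]]] : inv_norm (m * p) 1 (a' ** v) /\ a' ** v ** O m = O m by [].
      by exists None.
    by exists (Some (Ordinal ip)).
  rewrite -(card1 x); apply: eq_card => y; rewrite !inE.
  apply/andP/eqP => [[Py /asboolP[b' Lb' e]]|->]; last first.
    split=> //; apply/asboolP; exists b => //; rewrite /h Tx aE; congr (scale _ _).
    rewrite zmod_mulCA [lift b ** _]lv zmod_mulC; by have [_ _ _ ? _] := na'.
  apply: T_inj; have eb : b' = b.
    by apply: scaleI; rewrite -(hO _ _ Py Lb') e [in LHS]aE zmod_mulZl.
  have eT : lift b ** T y = a' by apply: scaleI; rewrite -aE -e eb.
  have OT : O (m * p) ** T y = T y by have [[_ _ _ ? _] _] := TP _ Py.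
  by rewrite Tx -eT [lift b ** T y]zmod_mulC -zmod_mulA lv zmod_mulC OT.
rewrite -(fsbig_fibers (P := P) (D := Lideals m n') (h := h) (fun a => chif (a ** O f))).
(* Each admissible [x] contributes a full copy of [Ysum m n']: over [O f], the ideal [h x b] becomes
   [p] times the extension of [b], and a principal factor does not affect [chi]. *)
- rewrite (eq_bigr (fun=> Ysum m n')) => [|x Px]; last first.
    apply: eq_fsbigr => b; rewrite inE => Lb.
    have [nb bO] := (LidealsP _ _ m0).1 Lb.
    have : (h x b ** O m) ** O f = scale p%:R (b ** O f) by rewrite hO // zmod_mulZl.
    rewrite -zmod_mulA (ord_mul fm) => ->.
    apply: char_scale; [exact: inv_norm_ext fm nb | exact: pu].
  rewrite sumr_const mulr_natl; congr (_ *+ _).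
  apply/eqP; rewrite -(eqn_add2r (rho m p)) subnK; last first.
    by apply: leqW; apply: leq_trans (max_card _) _; rewrite card_ord.
  rewrite [#|P|](_ : _ = (#|[pred i : 'I_p | ~~ (p%:Z %| nm_shift m i)%Z]|).+1).
    rewrite addSn eqSS addnC; apply/eqP.
    by rewrite -[RHS](card_ord p) -(cardC [pred i : 'I_p | (p%:Z %| nm_shift m i)%Z]).
  by rewrite card_option_pred.
- exact: finite_Lideals.
- move=> x Px b b'; rewrite !inE => Lb Lb' e; apply: scaleI.
  by rewrite -(hO _ _ Px Lb) e (hO _ _ Px Lb').
- exact: hA.
Qed.

End Character.

(** * Zeros of the norm form modulo [p] when the conductor varies *)

Lemma nm_shift_congr m p (i j : nat) : (p%:Z %| i%:Z - j%:Z)%Z ->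
  (p%:Z %| nm_shift m i)%Z = (p%:Z %| nm_shift m j)%Z.
Proof.
move=> d; have D : (p%:Z %| nm_shift m i - nm_shift m j)%Z.
  have -> : nm_shift m i - nm_shift m j = (i%:Z - j%:Z) * (i%:Z + j%:Z + t * m%:Z).
    by rewrite /nm_shift; ring.
  exact: dvdz_mulr.
by rewrite -[nm_shift m i](subrK (nm_shift m j)) rpredDl.
Qed.

Lemma nm_shift_congr_ord m m' p (i : nat) : (p%:Z %| m%:Z - m'%:Z)%Z ->
  (p%:Z %| nm_shift m i)%Z = (p%:Z %| nm_shift m' i)%Z.
Proof.
move=> d; have D : (p%:Z %| nm_shift m i - nm_shift m' i)%Z.
  have -> : nm_shift m i - nm_shift m' i = (m%:Z - m'%:Z) * (t * i%:Z + u * (m%:Z + m'%:Z)).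
    by rewrite /nm_shift; ring.
  exact: dvdz_mulr.
by rewrite -[nm_shift m i](subrK (nm_shift m' i)) rpredDl.
Qed.

Lemma nm_shiftM m d i : nm_shift (m * d) (i * d) = d%:Z * d%:Z * nm_shift m i.
Proof. by rewrite /nm_shift !PoszM; ring. Qed.

Lemma dvdz_subn_mod (p i : nat) : (p%:Z %| i%:Z - (i %% p)%N%:Z)%Z.
Proof. by apply/dvdzP; exists ((i %/ p)%N%:Z); rewrite {1}(divn_eq i p) PoszD PoszM; ring. Qed.

(** The form is homogeneous of degree two, so [i -> i * d] sends zeros for [m] to zeros for [m * d];
    it is injective modulo [p]. *)
Lemma rho_le m d p : prime p -> coprime p d -> (rho m p <= rho (m * d) p)%N.
Proof.
move=> pp co; pose h (i : 'I_p) : 'I_p := Ordinal (ltn_pmod (i * d) (prime_gt0 pp)).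
have h_inj : injective h.
  move=> i j /(congr1 val) /= e; apply/val_inj/(eq_of_dvdz (ltn_ord i) (ltn_ord j)).
  have : (p%:Z %| (i%:Z - j%:Z) * d%:Z)%Z.
    have -> : (i%:Z - j%:Z) * d%:Z = ((i * d)%N%:Z - (i * d %% p)%N%:Z) - ((j * d)%N%:Z - (j * d %% p)%N%:Z).
      by rewrite e !PoszM; ring.
    by apply: rpredB; apply: dvdz_subn_mod.
  by rewrite Gauss_dvdzl.
rewrite /rho -(fintype.card_image h_inj); apply: subset_leq_card.
apply/fintype.subsetP => y /mapP[ i]; rewrite mem_enum inE => Hi ->; rewrite inE.
rewrite -(nm_shift_congr _ (i := i * d)); last exact: dvdz_subn_mod.
by rewrite nm_shiftM; apply: dvdz_mull.
Qed.

(** The reverse inequality is [rho_le] for an inverse [e] of [d] modulo [p], since the zeros depend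
    on the conductor only modulo [p]. *)
Lemma rho_coprime m d p : prime p -> coprime p d -> rho (m * d) p = rho m p.
Proof.
move=> pp co; apply/eqP; rewrite eqn_leq rho_le // andbT.
have [d0|d0] := posnP d.
  by move: co; rewrite d0 /coprime gcdn0 => /eqP p1; move: pp; rewrite p1.
have [e ed] : exists e, (e * d)%N = 1%N %[mod p].
  have [e g E _] := egcdnP p d0; exists e.
  by rewrite E gcdnC (eqP co) modnMDl.
have coe : coprime p e.
  by have := coprimeMr p e d; rewrite -[coprime p (e * d)]coprime_modr ed coprime_modr coprimen1 => /esym/andP[].
apply: leq_trans (rho_le (m * d) pp coe) _.
suff -> : rho (m * d * e) p = rho m p by [].
apply: eq_card => i; rewrite !inE; apply: nm_shift_congr_ord.
have -> : (m * d * e)%N%:Z - m%:Z = m%:Z * ((e * d)%N%:Z - 1%N%:Z) by rewrite !PoszM; ring.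
apply: dvdz_mull; rewrite -eqz_mod_dvd !modz_nat eqz_nat; exact/eqP.
Qed.

(** Modulo [p] the form reduces to the square of [i], whose only zero is 0. *)
Lemma rho_dvd m p : prime p -> (p %| m)%N -> rho m p = 1%N.
Proof.
move=> pp pm; rewrite /rho -(card1 (Ordinal (prime_gt0 pp))); apply: eq_card => i.
rewrite !inE (@nm_shift_congr_ord m 0); last by rewrite subr0 dvdzE.
have -> : nm_shift 0 i = (i * i)%N%:Z by rewrite /nm_shift PoszM; ring.
rewrite dvdzE /= Euclid_dvdM // orbb -val_eqE /=; apply/idP/eqP => [/dvdnP[q e]|-> //].
have := ltn_ord i; case: (q) e => [|q'] -> //; rewrite mulSn; lia.
Qed.

(** * The Hecke relation, and vanishing at the primes dividing [f] *)

Section Character.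
Variables (C : fieldType) (f : nat) (f0 : (0 < f)%N) (chi : set (set k) -> C).
Hypothesis hchi : is_character f chi.
Local Notation chif a := (chi (ideal_class f a)).
Local Notation Ysum := (Ysum f chi).

(** Counts the products of an ideal of norm [p] with one of norm [n]. An ideal of norm [p * n]
    inside [p O_f] arises [rho] times, any other exactly once; the excess [rho - 1] falls on the
    ideals [p b] with [b] of norm [n / p]. *)
Lemma Ysum_hecke p n : prime p -> ~~ (p %| f)%N -> (0 < n)%N ->
  (\sum_(i < p | (p%:Z %| nm_shift f i)%Z) chif (nbr f p i)) * Ysum f n =
  Ysum f (p * n) + ((rho f p)%:R - 1) * (if (p %| n)%N then Ysum f (n %/ p) else 0).
Proof.
move=> pp pf n0; have p0 : (0 : rat) < p%:R by rewrite ltr0n prime_gt0.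
have pi0 : (0 : rat) < p%:R^-1 by rewrite invr_gt0.
have pu : (p%:R : k) \is a GRing.unit by rewrite -algn; apply: alg_unit; rewrite lt0r_neq0.
have pn : (p %| p * n)%N by apply: dvdn_mulr.
rewrite !Ysum_conductor // mulr_suml.
have nP (i : 'I_p) : (p%:Z %| nm_shift f i)%Z -> inv_norm f p%:R (nbr f p i).
  by move=> Pi; have /(LidealsP _ _ f0)[] := Lideals_nbr f0 pp pf Pi.
pose h (i : 'I_p) b := nbr f p i ** b.
rewrite (eq_bigr (fun i => \sum_(b \in Lideals f n) chif (h i b))); last first.
  move=> i Pi; rewrite mulr_fsumr; apply: eq_fsbigr => b; rewrite inE.
  move=> /(LidealsP _ _ f0)[nb _]; apply/esym; exact: (charM f0 hchi (nP _ Pi) nb).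
rewrite (@fsbig_fibers _ _ (fun i : 'I_p => (p%:Z %| nm_shift f i)%Z) _ _ (Lideals f (p * n)) (Lideals f n) h (fun a => chif a)); first last.
- move=> i b Pi /(LidealsP _ _ f0)[nb bO]; apply/LidealsP => //; split.
    by rewrite natrM; apply: inv_normM nb; apply: nP.
  apply: subset_trans (zmod_mulO (nP _ Pi) bO) _; exact: nbr_sub_ord.
- move=> i Pi b b'; rewrite !inE => /(LidealsP _ _ f0)[nb _] /(LidealsP _ _ f0)[nb' _].
  by apply: (inv_normI (nP _ Pi)); [have [] := nb | have [] := nb'].
- exact: finite_Lideals.
(* For invertible ideals, to contain is to divide: the cofactor is [a] times the inverse of
   [nbr f p i]. *)
have image i a : (p%:Z %| nm_shift f i)%Z -> (i < p)%N -> Lideals f (p * n) a ->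
    (exists2 b, Lideals f n b & nbr f p i ** b = a) <-> a `<=` nbr f p i.
  move=> Pi ip /(LidealsP _ _ f0)[na aO].
  have ni : inv_norm f p%:R (nbr f p i) := nP (Ordinal ip) Pi.
  split=> [[b /(LidealsP _ _ f0)[nb bO] <-]|ai]; first exact: zmod_mulO ni bO.
  have nv := inv_normV ni; have iv := mul_inv_ideal ni; set v := inv_ideal _ _ in nv iv.
  exists (v ** a); last by rewrite zmod_mulA iv; have [] := na.
  apply/LidealsP => //; split.
    have -> : (n%:R : rat) = p%:R^-1 * (p * n)%:R by rewrite natrM mulKf ?lt0r_neq0.
    exact: inv_normM nv na.
  by rewrite -iv [X in _ `<=` X]zmod_mulC; apply: zmod_mulS.
have count a : Lideals f (p * n) a ->
    #|[pred i : 'I_p | (p%:Z %| nm_shift f i)%Z & `[< exists2 b, Lideals f n b & h i b = a >]]| =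
    if `[< a `<=` scale p%:R (O f) >] then rho f p else 1%N.
  move=> La; case: asboolP => [apO|napO].
    apply: eq_card => i; rewrite !inE; apply: andb_idr => Pi.
    apply/asboolP/image => //; apply: subset_trans apO _; exact: scale_sub_nbr.
  have [i ip [Pi ai]] := Lideals_sub_nbr f0 pp pn La napO.
  rewrite -(card1 (Ordinal ip)); apply: eq_card => j; rewrite !inE.
  apply/andP/eqP => [[Pj /asboolP Hj]|->].
    have aj := (image _ _ Pj (ltn_ord j) La).1 Hj.
    exact/val_inj/(sub_nbr_uniq f0 pp pn La napO (ltn_ord j) ip aj ai).
  by split=> //; apply/asboolP; exact/(image _ _ Pi ip La).
(* Splits the multiplicity into 1 for every ideal and [rho - 1] more for those inside [p O_f]. *)
rewrite (eq_fsbigr (fun a => chif a +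
    if a \in [set a | a `<=` scale p%:R (O f)] then chif a * ((rho f p)%:R - 1) else 0)); last first.
  move=> a; rewrite inE => La; rewrite count //.
  case: asboolP => H.
    by rewrite ifT ?inE // -mulr_natr; ring.
  by rewrite ifF ?addr0 ?mulr1n //; apply/negbTE; rewrite notin_setE.
rewrite fsbig_split; last exact: finite_Lideals.
congr (_ + _).
rewrite -(fsbig_mkcondr _ _ [set a | a `<=` scale p%:R (O f)] (fun a => chif a * ((rho f p)%:R - 1))).
rewrite -mulr_fsuml mulrC; congr (_ * _).
have descend a : Lideals f (p * n) a -> a `<=` scale p%:R (O f) ->
    exists2 qb : nat * set k, Lideals f qb.1 qb.2 /\ n = (qb.1 * p)%N & scale p%:R qb.2 = a.
  move=> /(LidealsP _ _ f0)[na aO] apO.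
  have nb := inv_norm_scaleK pi0 na; set b := scale _ a in nb.
  have bO : b `<=` O f.
    move=> _ [y /apO[z Oz <-] <-].
    by rewrite -algn mulrA -algM mulVf ?alg1 ?mul1r ?lt0r_neq0.
  have [q q0 eq] := inv_norm_nat nb bO.
  exists (q, b) => /=; last by rewrite /b scaleA -algn -algM divff ?alg1 ?scale1 ?lt0r_neq0.
  split; first by apply/LidealsP => //; rewrite -eq.
  apply/eqP; rewrite -(eqr_nat rat) natrM -eq natrM; apply/eqP.
  by field; rewrite lt0r_neq0.
have [pdn|pdn] := boolP (p %| n)%N; last first.
  rewrite fsbig1 // => a [La apO]; case/negP: pdn.
  by have [q [_ ->] _] := descend _ La apO; apply: dvdn_mull.
rewrite (@reindex_fsbig _ _ _ _ _ (scale p%:R) (Lideals f (n %/ p))).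
  apply: eq_fsbigr => b; rewrite inE => /(LidealsP _ _ f0)[nb _].
  by apply: char_scale; [exact: nb | exact: pu].
split.
- move=> b /(LidealsP _ _ f0)[nb bO]; split; last exact: scaleS.
  apply/LidealsP => //; split.
    have -> : ((p * n)%:R : rat) = p%:R * p%:R * (n %/ p)%:R.
      by rewrite -!natrM -mulnA [(p * (n %/ p))%N]mulnC divnK.
    by rewrite -algn; apply: inv_norm_scaleK.
  by move=> _ [x /bO Ox <-]; apply: subgroupMn.
- by move=> b b' _ _ e; rewrite -[b]scale1 -[b']scale1 -(mulVr pu) -!scaleA e.
- move=> a [La apO]; have [[q b] /= [Lb eq] <-] := descend _ La apO.
  by exists b => //; rewrite eq mulnK // prime_gt0.
Qed.

Lemma Ysum_conductor_dvd p n : primitive f chi -> prime p -> (p %| f)%N ->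
  (p %| n)%N -> Ysum f n = 0.
Proof.
move=> hprim pp pf pn; rewrite Ysum_conductor //.
have [v [nv vO] v1] := exists_char_neq1 f0 hchi hprim pp pf.
pose m := (f %/ p)%N; have fE : f = (m * p)%N by rewrite divnK.
have m0 : (0 < m)%N by move: f0; rewrite fE muln_gt0 => /andP[].
have sub a b : inv_norm f 1 a -> a ** O m = O m -> Lideals f n b -> Lideals f n (a ** b).
  move=> na aO /(LidealsP _ _ f0)[nb bO]; apply/LidealsP => //.
  split; first by rewrite -[n%:R]mul1r; apply: inv_normM.
  have bpO : b `<=` scale p%:R (O m).
    apply: (Lideals_dvd_sub m0 pp pn); apply/LidealsP => //; first by rewrite -fE.
    by rewrite -fE.
  apply: subset_trans (zmod_mulS (@subset_refl _ a) bpO) _.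
  by rewrite zmod_mulZr aO => _ [x Ox <-]; rewrite fE; apply: mem_ordM.
set S := \sum_(a \in _) _; suff : S = chif v * S.
  move=> /eqP; rewrite -[X in X == _]mul1r -subr_eq0 -mulrBl mulf_eq0 subr_eq0.
  by rewrite eq_sym (negPf v1) => /eqP.
rewrite /S mulr_fsumr (@reindex_fsbig _ _ _ _ _ (zmod_mul v) (Lideals f n)).
  apply: eq_fsbigr => b; rewrite inE => /(LidealsP _ _ f0)[nb _].
  exact: (charM f0 hchi nv nb).
have nv' := inv_normV nv; have vv := mul_inv_ideal nv; set v' := inv_ideal _ _ in nv' vv.
rewrite invr1 in nv'.
have vO' : v' ** O m = O m.
  have vOm : v ** O m = O m := vO.
  rewrite -{1}vOm zmod_mulA [v' ** v]zmod_mulC vv; apply: ord_mul.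
  by rewrite fE dvdn_mulr.
split.
- by move=> b Lb; apply: sub.
- move=> b b'; rewrite !inE => /(LidealsP _ _ f0)[nb _] /(LidealsP _ _ f0)[nb' _].
  by apply: (inv_normI nv); [have [] := nb | have [] := nb'].
- move=> b Lb; exists (v' ** b); first exact: sub.
  by rewrite zmod_mulA vv; have [[_ _ _ ? _] _] := (LidealsP _ _ f0).1 Lb.
Qed.

End Character.

(** * The series [Lstar] and the summation over all orders *)

Section Character.
Variables (C : fieldType) (f : nat) (f0 : (0 < f)%N) (chi : set (set k) -> C).
Hypotheses (hchi : is_character f chi) (hprim : primitive f chi).
Local Notation chif a := (chi (ideal_class f a)).
Local Notation Ysum := (Ysum f chi).

Lemma Lideals1 : Lideals f 1 = [set O f].
Proof.
apply/seteqP; split=> [a /(LidealsP _ _ f0)[na aO]|_ ->].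
  exact: inv_norm1 na aO.
by apply/LidealsP => //; split=> //; exact: inv_norm_ord.
Qed.

Lemma Ysum1 : Ysum f 1 = 1.
Proof. by rewrite Ysum_conductor // Lideals1 fsbig_set1 char_ord. Qed.

Lemma not_scale_ord1 m p : prime p -> ~ scale p%:R (O m) (1 : k).
Proof.
move=> pp [_ /ordP[i [j ->]] /(congr1 re)].
rewrite !reimE !(mul0r, mulr0, mulr1, subr0, addr0) pmulrn -intrM => /eqP.
rewrite -[1]/(1%:~R) eqr_int => /eqP pi1.
have := congr1 absz pi1; rewrite abszM /= => /eqP.
by rewrite muln_eq1 => /andP[/eqP p1 _]; move: pp; rewrite p1.
Qed.

Lemma conductor_idealP m x : conductor_ideal m x <-> exists2 y, O 1 y & x = m%:R * y.
Proof.
by split=> [[y /(ib_max B)[i [j ->]] <-]|[y /ordP[i [j ->]] ->]];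
  (eexists; last reflexivity); [apply/ordP; exists i, j; rewrite mulr1 |
  apply/(ib_max B); exists i, j; rewrite mulr1].
Qed.

(** Bezout: [a] contains [n O_f], and the conductor ideal contains [f O_f]. *)
Lemma Lstar_ideals_coprime n : coprime n f -> Lstar_ideals f n = Lideals f n :> set (set k).
Proof.
move=> co; apply/seteqP; split=> [a [La _] //|a La]; split=> //.
have [na aO] := (LidealsP _ _ f0).1 La; have [_ _ sa _ _] := na.
apply/seteqP; split=> [_ [y [z [/aO Oy /conductor_idealP[z' Oz ->] ->]]]|x Ox].
  by apply: subgroupD => //; rewrite -[f in O f]mul1n; exact: mem_ordM.
have /coprimezP[[e g] /= E] : coprimez n f by [].
exists (e%:~R * (n%:R * x)), (f%:R * (g%:~R * x)); split.
- apply: subgroupMz => //; rewrite mulrC; apply: (inv_norm_memM na Ox).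
  exact: inv_norm_mem_int na aO.
- apply/conductor_idealP; exists (g%:~R * x) => //.
  apply: subgroupMz; first exact: subgroup_ord.
  exact: (ord_sub (dvd1n f)).
transitivity ((e * n%:Z + g * f%:Z)%:~R * x); first by rewrite E; ring.
by ring.
Qed.

(** Both [a] and the conductor ideal lie in [p O_(f/p)], which does not contain 1. *)
Lemma Lstar_ideals_dvd p n : prime p -> (p %| f)%N -> (p %| n)%N ->
  Lstar_ideals f n = set0 :> set (set k).
Proof.
move=> pp pf pn; apply/seteqP; split=> // a [La aE].
have fE : f = (f %/ p * p)%N by rewrite divnK.
have m0 : (0 < f %/ p)%N by rewrite divn_gt0 ?prime_gt0 // dvdn_leq.
have aS : a `<=` scale p%:R (O (f %/ p)).
  by apply: (Lideals_dvd_sub m0 pp pn); rewrite -fE.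
apply: (@not_scale_ord1 (f %/ p) p pp).
have : O f 1 by exact: ord1.
rewrite -aE => -[y [z [/aS [y' Oy' <-] /conductor_idealP[z' Oz ->] e]]].
have fq : (f%:R : k) = (f %/ p)%:R * p%:R by rewrite -natrM -fE.
exists (y' + (f %/ p)%:R * z'); last by rewrite [RHS]e fq; ring.
by apply: subgroupD => //; rewrite -[X in O X]mul1n; exact: mem_ordM.
Qed.

(** If [n] shares a prime with [f], both sides vanish: the left for want of ideals, the right by
    primitivity. *)
Lemma Lstar_Ysum : Lstar f chi = Ysum f.
Proof.
apply/funext => n; rewrite /Lstar Ysum_conductor //.
have [co|nco] := boolP (coprime n f); first by rewrite Lstar_ideals_coprime.
have [n0|n0] := posnP n.
  rewrite [RHS]fsbig1 => [|a /(Lideals_gt0 f0)]; last by rewrite n0.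
  by rewrite fsbig1 // => a [/(Lideals_gt0 f0)]; rewrite n0.
have g1 : (1 < gcdn n f)%N by rewrite ltn_neqAle eq_sym nco gcdn_gt0 n0.
have pp := pdiv_prime g1; have := pdiv_dvd (gcdn n f).
rewrite dvdn_gcd => /andP[pn pf].
rewrite (Lstar_ideals_dvd pp pf pn) fsbig_set0 -Ysum_conductor //.
by rewrite (Ysum_conductor_dvd f0 hchi hprim pp pf pn).
Qed.

Lemma csum_Ysum n : (0 < n)%N -> csum (fun d => Ysum (f * d)) n =
  dmul (dmul (dzeta C) (dsubst (dzeta C) 3 1))
       (ddiv (Lstar f chi) (dsubst (Lstar f chi) 2 0)) n.
Proof.
(* At a prime dividing [f] both parameters are 0, so the Euler factor is 1; elsewhere [tt p] sums
   [chi] over ideals of norm [p]. *)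
pose tt p := if (p %| f)%N then 0 else
  \sum_(i < p | (p%:Z %| nm_shift f i)%Z) chif (nbr f p i).
pose ee p : C := if (p %| f)%N then 0 else (rho f p)%:R - 1.
move=> n0; rewrite Lstar_Ysum -[X in Ysum X]muln1.
apply: (@csum_dirichlet _ (fun d => Ysum (f * d)) tt ee) => // [|d p m d0 pp m0 pm|d p m d0 pp m0 pm|p m pp m0].
- by rewrite muln1 Ysum1.
- have fd0 : (0 < f * d)%N by rewrite muln_gt0 f0.
  rewrite mulnA; apply: Ysum_coprime => //; rewrite ?dvdn_mulr ?prime_gt0 //.
  by rewrite prime_coprime.
- have fd0 : (0 < f * d)%N by rewrite muln_gt0 f0.
  rewrite mulnA (Ysum_ramified chi fd0 (dvdn_mulr d (dvdnn f)) pp pm).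
  case: ifP => // _.
  congr (_ * _); rewrite /ee; have [pd|pd] := boolP (p %| d)%N.
    by rewrite rho_dvd ?subSS ?subn0 // dvdn_mull.
  have [pf|pf] := boolP (p %| f)%N; first by rewrite rho_dvd ?subSS ?subn0 ?subr0 // dvdn_mulr.
  rewrite rho_coprime ?prime_coprime // natrB; first by rewrite -natr1; ring.
  by apply: leqW; apply: leq_trans (max_card _) _; rewrite card_ord.
rewrite muln1 /tt /ee; have [pf|pf] := boolP (p %| f)%N; last exact: Ysum_hecke.
by rewrite !mul0r addr0 (Ysum_conductor_dvd f0 hchi hprim pp pf) ?dvdn_mulr.
Qed.

Lemma dmul_dmonom d (F : nat -> C) n : (0 < n)%N ->
  dmul (dmonom C d) F n = if (d %| n)%N then F (n %/ d)%N else 0.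
Proof.
move=> n0; rewrite /dmul /dmonom; case: ifP => dn.
  rewrite (bigD1_seq d) ?divisors_uniq -?dvdn_divisors //= eqxx mul1r.
  by rewrite big1 ?addr0 // => e /negPf ->; rewrite mul0r.
rewrite big_seq big1 // => e; rewrite -dvdn_divisors // => en.
by rewrite (_ : (e == d) = false) ?mul0r //; apply: contraFF dn => /eqP <-.
Qed.

Lemma dsums_to_Lseries :
  dsums_to (fun d => dmul (dmonom C d) (Lseries (f * d) (induced f chi)))
    (dmul (dmul (dzeta C) (dsubst (dzeta C) 3 1))
       (ddiv (Lstar f chi) (dsubst (Lstar f chi) 2 0))).
Proof.
(* Only divisors of [n] contribute to the coefficient at [n], so the partial sums are constant once
   [D] exceeds [n]. *)
move=> n n0; exists n.+1 => // D /= nD; rewrite -csum_Ysum // /csum.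
rewrite (bigID (fun d => d \in divisors n)) /= [X in _ + X]big1_seq ?addr0; last first.
  move=> d /andP[+ _]; rewrite -dvdn_divisors // dmul_dmonom // => /negPf ->//.
rewrite -big_filter (perm_big (divisors n)); last first.
  apply: uniq_perm; rewrite ?filter_uniq ?iota_uniq ?divisors_uniq // => d.
  rewrite mem_filter mem_index_iota; apply: andb_idr; rewrite -dvdn_divisors // => dn.
  by rewrite (dvdn_gt0 n0 dn) (leq_ltn_trans _ nD) // dvdn_leq.
rewrite big_seq [RHS]big_seq; apply: eq_bigr => d; rewrite -dvdn_divisors // => dn.
by rewrite dmul_dmonom // dn Lseries_induced // (dvdn_gt0 n0 dn).
Qed.

End Character.

End QuadraticOrders.

(** * Integral basis of a quadratic etale algebra *)

Section EtaleGenerator.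
Variable k : comUnitAlgType rat.
Local Notation "a %:K" := (in_alg k a)
  (at level 2, left associativity, format "a %:K").

Lemma field_generator (L : fieldExtType rat) : \dim {:L} = 2%N ->
  exists th : L, (forall x, exists r s : rat, x = r *: 1 + s *: th) /\
    (forall r s : rat, r *: 1 + s *: th = 0 -> r = 0 /\ s = 0).
Proof.
move=> dim2; have [th th1] : exists th : L, th \notin (1%VS : {vspace L}).
  apply: contrapT => H; have : ({:L} <= 1%VS)%VS.
    by apply/subvP => x _; apply/negPn/negP => x1; apply: H; exists x.
  by move=> /dimvS; rewrite dim2 dimv1.
have th_free : free [:: th; 1].
  by rewrite free_cons span_seq1 th1 seq1_free oner_neq0.
have full : (<<[:: th; 1%R]>> = fullv :> {vspace L})%VS.
  by apply/eqP; rewrite eqEdim subvf dim2 (eqP th_free).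
exists th; split=> [x|r s E].
  have : x \in <<[:: th; 1%R]>>%VS by rewrite full memvf.
  rewrite span_cons span_seq1 => /memv_addP[_ /vlineP[s ->] [_ /vlineP[r ->] ->]].
  by exists r, s; rewrite addrC.
have s0 : s = 0.
  apply/eqP/negPn/negP => s0; case/negP: th1; apply/vlineP; exists (- s^-1 * r).
  apply: (scalerI s0); rewrite scalerA mulrA mulrN divff // mulN1r scaleNr.
  by apply/eqP; rewrite -addr_eq0 addrC E.
move: E; rewrite s0 scale0r addr0 => /eqP; rewrite scaler_eq0 oner_eq0 orbF.
by move=> /eqP.
Qed.

Lemma lrmorphism_alg (L : lalgType rat) (g : {lrmorphism k -> L}) (r s : rat) th :
  g (r%:K + s%:K * th) = r *: 1 + s *: g th.
Proof. by rewrite rmorphD rmorphM /= !linearZ /= !rmorph1 mulr_algl. Qed.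

Lemma etale_generator : quadratic_etale k -> exists (th : k) (a b : rat),
  [/\ th * th = a%:K * th + b%:K,
      forall x, exists r s : rat, x = r%:K + s%:K * th,
      forall r s : rat, r%:K + s%:K * th = 0 -> r = 0 /\ s = 0 &
      a * a + 4 * b != 0].
Proof.
have transport (L : lalgType rat) (g : {lrmorphism k -> L}) (th : L) : bijective g ->
    (forall x, exists r s : rat, x = r *: 1 + s *: th) ->
    (forall r s : rat, r *: 1 + s *: th = 0 -> r = 0 /\ s = 0) ->
    exists th' : k, [/\ g th' = th, forall x, exists r s : rat, x = r%:K + s%:K * th' &
      forall r s : rat, r%:K + s%:K * th' = 0 -> r = 0 /\ s = 0].
  move=> [h gK hK] span free; exists (h th); split=> //.
    move=> x; have [r [s e]] := span (g x); exists r, s.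
    by apply: (can_inj gK); rewrite lrmorphism_alg hK.
  by move=> r s E; apply: free; rewrite -[th]hK -lrmorphism_alg E rmorph0.
case=> [[L [dim2 [g gbij]]]|[g gbij]].
  have [th0 [span0 free0]] := field_generator dim2.
  have [th [gth span free]] := transport L g th0 gbij span0 free0.
  have [b [a E]] := span (th * th); exists th, a, b; split=> //; first by rewrite E addrC.
  (* With discriminant zero the equation of [th] is a square, [(th - c)^2 = 0], which is impossible
     for a nonrational [th] in a field. *)
  apply/eqP => D0; have [c ac] : exists c : rat, a = 2 * c by exists (a / 2); field.
  have bc : b = - (c * c).
    apply: (mulfI (isT : (4 : rat) != 0)).
    transitivity (a * a + 4 * b - 4 * (c * c)); first by rewrite ac; ring.
    by rewrite D0; ring.
  have : (th - c%:K) * (th - c%:K) = 0.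
    have -> : (th - c%:K) * (th - c%:K) = th * th - 2 * c%:K * th + c%:K * c%:K by ring.
    by rewrite E ac bc algN !algM (algn k 2); ring.
  move=> /(congr1 g); rewrite rmorphM rmorph0 => /eqP.
  rewrite mulf_eq0 orbb => /eqP g0.
  have [] := free (- c) 1; last by move=> _ /eqP; rewrite oner_eq0.
  case: gbij => h gK _; apply: (can_inj gK); rewrite rmorph0 -[RHS]g0; congr (g _).
  by rewrite algN alg1; ring.
(* In the split case the generator is the idempotent [(1, 0)], with equation [th * th = th] and
   discriminant 1. *)
have [||th [gth span free]] := transport (rat^o * rat^o)%type g (1, 0) gbij.
- move=> [x1 x2]; exists x2, (x1 - x2).
  have e1 : x1 = x2 * 1 + (x1 - x2) * 1 :> rat by ring.
  have e2 : x2 = x2 * 1 + (x1 - x2) * 0 :> rat by ring.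
  by rewrite [in LHS]e1 [X in (_, X) = _]e2.
- move=> r s [E1 E2].
  have r0 : r = 0 by transitivity (r * 1 + s * 0 : rat); [ring | exact: E2].
  split=> //; transitivity (r * 1 + s * 1 : rat); first by rewrite r0; ring.
  exact: E1.
exists th, 1, 0; split=> //.
case: gbij => h gK _; apply: (can_inj gK).
rewrite alg1 rmorph0 mul1r addr0; transitivity (g th * g th); first exact: rmorphM.
rewrite gth; have e1 : 1 * 1 = 1 :> rat by []; have e2 : 0 * 0 = 0 :> rat by [].
by congr pair.
Qed.

End EtaleGenerator.

(** * Integrality over the integers *)

Lemma monic_quadratic (R : nzRingType) (T n : R) :
  'X^2 + (n%:P - T%:P * 'X) \is monic.
Proof.
rewrite monicE lead_coefDl ?lead_coefXn // size_polyXn ltnS.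
apply/leq_sizeP => -[|[|j]] // _; rewrite coefB coefC coefCM coefX /=.
by rewrite mulr0 subr0.
Qed.

Lemma rat_integral (q : rat) : integralOver (intr : int -> rat) q -> q \is a Num.int.
Proof.
move=> [p pm /rootP pq].
have rp : root (map_poly (intr : int -> algC) p) (ratr q).
  apply/rootP; have -> : map_poly (intr : int -> algC) p = map_poly ratr (map_poly (intr : int -> rat) p).
    by rewrite -map_poly_comp; apply: eq_map_poly => i /=; rewrite ratr_int.
  by rewrite horner_map pq rmorph0.
have : (ratr q : algC) \in Num.int.
  apply: Cint_rat_Aint; first exact: Crat_rat.
  apply: root_monic_Aint rp _ _; first exact: monic_map.
  by apply/polyOverP => i; rewrite coef_map intr_int.
move=> /intrP[i E]; apply/intrP; exists i; apply: (fmorph_inj (@ratr algC)).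
by rewrite [RHS]ratr_int; exact: E.
Qed.

(** The [th]-coordinates of integral elements form a cyclic group. An integral element [om] above
    its generator completes 1 to a basis: subtracting a multiple of [om] from an integral element
    leaves an integral rational, that is, an integer. *)
Lemma exists_integral_basis (k : comUnitAlgType rat) :
  quadratic_etale k -> exists B : integral_basis k, True.
Proof.
move=> /etale_generator[th0 [a0 [b0 [th02 span0 free0 D00]]]].
pose ii := intr : int -> k.
have int_alg q : integralOver ii (in_alg k q) -> q \is a Num.int.
  move=> [p pm /rootP pq]; apply: rat_integral; exists p => //; apply/rootP.
  apply: (fmorph_inj (in_alg k)); rewrite rmorph0 -pq -horner_map -map_poly_comp.
  by congr (_.[_]); apply: eq_map_poly => i; exact: algz.
have [th [a [b [th2 span free D0]]]] : exists (th : k) (a b : int),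
    [/\ th * th = a%:~R * th + b%:~R,
      forall x, exists r s : rat, x = in_alg k r + in_alg k s * th,
      forall r s : rat, in_alg k r + in_alg k s * th = 0 -> r = 0 /\ s = 0 &
      a * a + 4 * b != 0].
  have [N N0 NP] := common_denominator [:: a0; b0].
  have [a ea] : exists a : int, N%:R * a0 = a%:~R by apply/intrP/NP; rewrite !inE eqxx.
  have [b eb] : exists b : int, N%:R * b0 = b%:~R by apply/intrP/NP; rewrite !inE eqxx orbT.
  have Nq : (N%:R : rat) != 0 by rewrite pnatr_eq0 -lt0n.
  exists (N%:R * th0), a, (N%:Z * b); split.
  - have -> : N%:R * th0 * (N%:R * th0) = N%:R * N%:R * (th0 * th0) by ring.
    rewrite th02 -algz -ea [in RHS]intrM -[b%:~R in RHS]algz -eb !algM !algn; ring.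
  - move=> x; have [r [s ->]] := span0 x; exists r, (s / N%:R).
    by congr (_ + _); rewrite mulrA -(algn k N) -algM divfK.
  - move=> r s; rewrite mulrA -(algn k N) -algM => /free0[-> /eqP].
    by rewrite mulf_eq0 (negPf Nq) orbF => /eqP.
  - rewrite -(intr_eq0 rat) rmorphD !rmorphM /= -ea -eb.
    have -> : N%:R * a0 * (N%:R * a0) + 4%:~R * (N%:~R * (N%:R * b0)) =
       N%:R * N%:R * (a0 * a0 + 4 * b0) by ring.
    by rewrite !mulf_neq0.
have int_int (i : int) : integralOver ii i%:~R by apply: integral_id.
have alg_inj r s r' s' : in_alg k r + in_alg k s * th = in_alg k r' + in_alg k s' * th ->
    r = r' /\ s = s'.
  move=> E; have [|r0 s0] := free (r - r') (s - s').
    transitivity (in_alg k r + in_alg k s * th - (in_alg k r' + in_alg k s' * th)).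
      by ring.
    by rewrite E subrr.
  by split; apply/eqP; rewrite -subr_eq0 ?r0 ?s0.
have [c cE] := choice (fun x => let: ex_intro r (ex_intro s e) := span x in
  ex_intro (fun rs : rat * rat => x = in_alg k rs.1 + in_alg k rs.2 * th) (r, s) e).
(* Conjugation sends [th] to [a - th]. Being a ring morphism that fixes the rationals it preserves
   integrality, so integral elements have integral trace and norm. *)
pose cj x := in_alg k ((c x).1 + (c x).2 * a%:~R) - in_alg k (c x).2 * th.
have cj0 r s : cj (in_alg k r + in_alg k s * th) = in_alg k (r + s * a%:~R) - in_alg k s * th.
  by rewrite /cj; have [<- <-] := alg_inj _ _ _ _ (cE (in_alg k r + in_alg k s * th)).
have cjD x y : cj (x + y) = cj x + cj y.
  have -> : x + y = in_alg k ((c x).1 + (c y).1) + in_alg k ((c x).2 + (c y).2) * th.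
    by rewrite {1}(cE x) {1}(cE y); ring.
  by rewrite cj0 /cj; ring.
have cjM x y : cj (x * y) = cj x * cj y.
  have -> : x * y = in_alg k ((c x).1 * (c y).1 + b%:~R * (c x).2 * (c y).2) +
      in_alg k ((c x).1 * (c y).2 + (c x).2 * (c y).1 + a%:~R * (c x).2 * (c y).2) * th.
    by rewrite {1}(cE x) {1}(cE y); ring: th2.
  by rewrite cj0 /cj; ring: th2.
have cj_alg q : cj (in_alg k q) = in_alg k q.
  have {1}-> : in_alg k q = in_alg k q + in_alg k 0 * th by ring.
  by rewrite cj0; ring.
have int_cj x : integralOver ii x -> integralOver ii (cj x).
  move=> [p pm /rootP px]; exists p => //; apply/rootP.
  have cjX n : cj (x ^+ n) = cj x ^+ n.
    elim: n => [|n IH]; first by rewrite !expr0 -(alg1 k) cj_alg.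
    by rewrite !exprS cjM IH.
  have z0 : cj 0 = 0 by rewrite -[0](rmorph0 (in_alg k)) cj_alg.
  move: px; rewrite !horner_coef => /(congr1 cj); rewrite z0 (big_morph cj cjD z0) => px.
  rewrite -[RHS]px.
  apply: eq_bigr => i _; rewrite cjM cjX; congr (_ * _).
  have -> : (map_poly ii p)`_i = in_alg k (p`_i)%:~R by rewrite coef_map [RHS]algz.
  by rewrite cj_alg.
pose tr x := 2 * (c x).1 + (c x).2 * a%:~R.
pose nr x := (c x).1 * (c x).1 + (c x).1 * (c x).2 * a%:~R - (c x).2 * (c x).2 * b%:~R.
have trE x : x + cj x = in_alg k (tr x) by rewrite {1}(cE x) /cj /tr; ring.
have nrE x : x * cj x = in_alg k (nr x) by rewrite {1}(cE x) /cj /nr; ring: th2.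
have int_tr x : integralOver ii x -> tr x \is a Num.int.
  by move=> ix; apply: int_alg; rewrite -trE; apply: integral_add => //; apply: int_cj.
have int_nr x : integralOver ii x -> nr x \is a Num.int.
  by move=> ix; apply: int_alg; rewrite -nrE; apply: integral_mul => //; apply: int_cj.
have tr_nr_int x : tr x \is a Num.int -> nr x \is a Num.int -> integralOver ii x.
  move=> /intrP[T eT] /intrP[n en].
  exists ('X^2 + (n%:P - T%:P * 'X)); first exact: monic_quadratic.
  apply/rootP; rewrite !(rmorphD, rmorphN, rmorphM) /= ?map_polyXn !map_polyC !map_polyX !hornerE /=.
  have : x * x - in_alg k (tr x) * x + in_alg k (nr x) = 0 by rewrite -trE -nrE; ring.
  by rewrite eT en !algz => <-; rewrite /ii; ring.
pose S : set rat := [set s | exists r, integralOver ii (in_alg k r + in_alg k s * th)].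
have cEr r s : c (in_alg k r + in_alg k s * th) = (r, s).
  by rewrite [LHS]surjective_pairing; have [<- <-] := alg_inj _ _ _ _ (cE (in_alg k r + in_alg k s * th)).
(* The absolute discriminant of [th] bounds the denominators in [S]: with [D] the discriminant, the
   square of [D * s] equals [D * (tr^2 - 4 * nr)], an integer. *)
pose M : nat := absz (a * a + 4 * b).
have Sint s : S s -> M%:R * s \is a Num.int.
  move=> [r ix]; have := int_nr _ ix; have := int_tr _ ix.
  rewrite /tr /nr cEr /= => it inn.
  pose D : rat := (a * a + 4 * b)%:~R.
  have sD : (D * s) * (D * s) \is a Num.int.
    have -> : (D * s) * (D * s) = D * ((2 * r + s * a%:~R) * (2 * r + s * a%:~R) -
        4 * (r * r + r * s * a%:~R - s * s * b%:~R)) by rewrite /D; ring.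
    by rewrite rpredM ?intr_int // rpredB // rpredM // ?rpred_nat.
  have : D * s \is a Num.int.
    apply: rat_integral; have [v ev] := intrP sD.
    exists ('X^2 - v%:P); first by rewrite monicXnsubC.
    by apply/rootP; rewrite !(rmorphB, rmorphM) /= ?map_polyXn ?map_polyX map_polyC !hornerE /= -ev; ring.
  have [e|e] : M%:Z = a * a + 4 * b \/ M%:Z = - (a * a + 4 * b) by rewrite /M; lia.
    by rewrite pmulrn e.
  by rewrite pmulrn e mulrNz mulNr rpredN.
have Sth r s : integralOver ii (in_alg k r + in_alg k s * th) -> S s by exists r.
have [||||g g0 SE] := @cyclic_rat_subgroup S M.
- split=> [|s s' [r Hr] [r' Hr']].
    exists 0; rewrite (_ : _ + _ = 0%:~R); first exact: int_int.
    by rewrite rmorph0; ring.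
  exists (r - r'); rewrite (_ : _ + _ = (in_alg k r + in_alg k s * th) -
    (in_alg k r' + in_alg k s' * th)); last by ring.
  exact: integral_sub.
- by rewrite /M absz_gt0.
- exact: Sint.
- exists 1 => //; exists 0; apply: tr_nr_int; rewrite /tr /nr cEr /=.
    by rewrite mulr0 add0r mul1r intr_int.
  by rewrite !mul0r !add0r !mul1r rpredN intr_int.
have [r0 int_om] : S g by apply/SE; exists 1; rewrite mul1r.
pose om := in_alg k r0 + in_alg k g * th.
have gq : g != 0 by rewrite lt0r_neq0.
have c_om r s : c (in_alg k r + in_alg k s * om) = (r + s * r0, s * g).
  rewrite -cEr; congr c; rewrite /om; ring.
have [T eT] := intrP (int_tr _ int_om); have [U eU] := intrP (int_nr _ int_om).
have tr_om r s : tr (in_alg k r + in_alg k s * om) = 2 * r + s * T%:~R.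
  by rewrite -eT /tr c_om cEr /=; ring.
have nr_om r s : nr (in_alg k r + in_alg k s * om) = r * r + r * s * T%:~R + s * s * U%:~R.
  by rewrite -eT -eU /tr /nr c_om cEr /=; ring.
have omE : om * om = T%:~R * om - U%:~R.
  have : om * om - in_alg k (tr om) * om + in_alg k (nr om) = 0 by rewrite -trE -nrE; ring.
  by rewrite eT eU !algz => E; rewrite -[RHS]add0r -E; ring.
have maxE x : max_order x <-> exists i j : int, x = i%:~R + j%:~R * om.
  split=> [ix|[i [j ->]]]; last first.
    apply: integral_add; first exact: int_int.
    by apply: integral_mul; [exact: int_int | exact: int_om].
  have : S (c x).2 by apply: (Sth (c x).1); rewrite -cE.
  move=> /SE[j ej].
  have e : x - j%:~R * om = in_alg k ((c x).1 - j%:~R * r0).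
    by rewrite {1}(cE x) ej /om; ring.
  have : integralOver ii (x - j%:~R * om).
    apply: integral_sub => //; apply: integral_mul; [exact: int_int | exact: int_om].
  rewrite e => /int_alg /intrP[i ei]; exists i, j.
  by rewrite -(algz k i) -ei -e subrK.
pose ib_re x := (c x).1 - (c x).2 / g * r0.
pose ib_im x := (c x).2 / g.
have reE r s : ib_re (in_alg k r + in_alg k s * om) = r by rewrite /ib_re c_om /=; field.
have imE r s : ib_im (in_alg k r + in_alg k s * om) = s by rewrite /ib_im c_om /=; field.
unshelve eexists (@IntegralBasis k om T U ib_re ib_im _ reE imE omE maxE _) => //.
  move=> x; have : (c x).2 = ib_im x * g by rewrite divfK.
  rewrite /ib_re -/(ib_im x); move: (ib_im x) => v ev.
  by rewrite {1}(cE x) ev /om; ring.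
move=> r s; rewrite -tr_om -nr_om => Htr Hnr.
(* Integral trace and norm provide a monic integral quadratic equation, so the element lies in
   [max_order]. *)
have /maxE[i [j]] := tr_nr_int _ Htr Hnr.
rewrite -(algz k i) -(algz k j) => E.
have -> : r = i%:~R by rewrite -[LHS](reE r s) E reE.
have -> : s = j%:~R by rewrite -[LHS](imE r s) E imE.
by rewrite !intr_int.
Qed.

Theorem theorem5p1 (R : realType) (k : comUnitAlgType rat)
    (hk : quadratic_etale k)
    (f : nat) (hf : (0 < f)%N)
    (chi : set (set k) -> complex R)
    (hchi : is_character f chi) (hprim : primitive f chi)
    (n : nat) (hn : char_order f chi n) (hodd : odd n) :
  dsums_to
    (fun d : nat => dmul (dmonom _ d) (Lseries (f * d)%N (induced f chi)))
    (dmul (dmul (dzeta _) (dsubst (dzeta _) 3 1))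
          (ddiv (Lstar f chi) (dsubst (Lstar f chi) 2 0))).
Proof.
have [B _] := exists_integral_basis hk.
exact: (dsums_to_Lseries B hf hchi hprim).
Qed.
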